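(* Let $K$ be a non-degenerate Calderón–Zygmund kernel on $\mathbb{R}^d$, and $b\in L^1_{\mathrm{loc}}(\mathbb{R}^d)$. Let $$1<p\leq q<\infty,\qquad\alpha:=d\Big(\frac1p-\frac1q\Big)\geq0,$$ and let $\kappa>0$ be a constant. Suppose that, for some $\Theta\geq0$, $$|\langle[b,T]f,g\rangle|=\Big|\iint(b(x)-b(y))K(x,y)f(y)g(x)\,dy\,dx\Big|\leq\Theta\cdot\|f\|_\infty|B|^{1/p}\cdot\|g\|_\infty|\tilde B|^{1/q'}$$ whenever $f\in L^\infty(B)$ and $g\in L^\infty(\tilde B)$ for any two balls $B,\tilde B$ of equal radius $r$ and distance $\operatorname{dist}(B,\tilde B)\geq\kappa r$. Then there is a constant $C$, depending only on $d,p,q,K,\kappa$ (not on $b$ or $\Theta$), such that: \begin{itemize} \item if $\alpha=0$, equivalently $p=q$, then $b\in\mathrm{BMO}(\mathbb{R}^d)$ and $\|b\|_{\mathrm{BMO}}\leq C\Theta$; \item if $\alpha\in(0,1]$, then $b\in\dot C^{0,\alpha}(\mathbb{R}^d)$ and $\|b\|_{\dot C^{0,\alpha}}\leq C\Theta$; \item if $\alpha>1$, then $b$ is constant, so in fact $[b,T]=0$. \end{itemize}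
   Context: All functions are complex-valued. $q'=q/(q-1)$. For a ball $B$, $L^\infty(B)=\{f\in L^\infty(\mathbb{R}^d):f=1_Bf\}$. The symbol $\langle[b,T]f,g\rangle$ is just an abbreviation for the (absolutely convergent) double integral displayed; no operator $T$ need be defined, and no $L^p$ boundedness of $T$ is assumed. Statements that $b$ is Hölder continuous or constant are understood after redefinition on a null set. An $\omega$-Calderón–Zygmund kernel is a measurable $K(x,y)$, $x\neq y$, with $|K(x,y)|\leq c_K|x-y|^{-d}$ and $$|K(x,y)-K(x',y)|+|K(y,x)-K(y,x')|\leq\frac1{|x-y|^d}\omega\Big(\frac{|x-x'|}{|x-y|}\Big)\quad\text{whenever }|x-x'|<\tfrac12|x-y|,$$ with $\omega:[0,1)\to[0,\infty)$ increasing. $K$ is a non-degenerate Calderón–Zygmund kernel if at least one of the following holds: (i) $K$ is an $\omega$-Calderón–Zygmund kernel with $\omega(t)\to0$ as $t\to0$, and for some $c_0>0$, for every $y\in\mathbb{R}^d$ and $r>0$ there exists $x\in B(y,r)^c$ with $|K(x,y)|\geq\frac1{c_0r^d}$; (ii) $K(x,y)=\frac{\Omega(x-y)}{|x-y|^d}$ where $\Omega(tx)=\Omega(x)$ for all $t>0$, and $\Omega\in L^1(S^{d-1})\setminus\{0\}$. $\|b\|_{\mathrm{BMO}}=\sup_B\frac1{|B|}\int_B|b-\langle b\rangle_B|$ over all balls $B$, with $\langle b\rangle_B=\frac1{|B|}\int_Bb$; $\|b\|_{\dot C^{0,\alpha}}=\sup_{x\neq y}\frac{|b(x)-b(y)|}{|x-y|^\alpha}$.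 *)

(* Defs.v *)
From HB Require Import structures.
From mathcomp Require Import all_boot all_order all_algebra.
From mathcomp Require Import all_classical all_reals all_analysis.
From mathcomp Require Import measurable_realfun.
From mathcomp Require Export complex.

Set Implicit Arguments.
Unset Strict Implicit.
Unset Printing Implicit Defensive.
Import Order.TTheory GRing.Theory Num.Theory.
Import numFieldNormedType.Exports.

Local Open Scope classical_set_scope.
Local Open Scope ring_scope.
Local Open Scope complex_scope.

(* The Borel sigma-algebra of R^n, generated by the coordinates as for
   n.-tuple in the library. *)
Section borel_rV.
Context {R : realType} (n : nat).

Let coors : 'I_n -> 'rV[R]_n -> R := fun i x => x 0 i.

Let rV_set0 : g_sigma_preimage coors set0.
Proof. exact: sigma_algebra0. Qed.

Let rV_setC A : g_sigma_preimage coors A -> g_sigma_preimage coors (~` A).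
Proof. exact: sigma_algebraC. Qed.

Let rV_bigcup (F : (set _)^nat) : (forall i, g_sigma_preimage coors (F i)) ->
  g_sigma_preimage coors (\bigcup_i (F i)).
Proof. exact: sigma_algebra_bigcup. Qed.

HB.instance Definition _ := @isMeasurable.Build default_measure_display
  'rV[R]_n (g_sigma_preimage coors) rV_set0 rV_setC rV_bigcup.

Lemma measurable_coord (i : 'I_n) :
  measurable_fun setT (fun x : 'rV[R]_n => x 0 i).
Proof.
move=> _ Y mY; rewrite setTI; apply: sub_sigma_algebra => /=.
rewrite -bigcup_seq/=; exists i => /=; first by rewrite mem_index_enum.
by exists Y => //; rewrite setTI.
Qed.

Lemma measurable_fun_rVP d (T : measurableType d) (f : T -> 'rV[R]_n) :
  measurable_fun setT f <->
  forall i, measurable_fun setT (fun x => f x 0 i).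
Proof.
split=> [mf i|mf].
  exact: (measurableT_comp (measurable_coord i) mf).
have H : g_sigma_preimage (fun i => coors i \o f) `<=` measurable.
  apply: smallest_sub; first exact: sigma_algebra_measurable.
  rewrite -bigcup_seq/=; apply: bigcup_sub => i _.
  by move=> A [B mB <-]; exact: mf.
move: H; rewrite g_sigma_preimage_comp => H _ A mA.
by apply: H; exists A.
Qed.

End borel_rV.

Section lebesgue_rV.
Context {R : realType}.

Definition row_cons n (z : R * 'rV[R]_n) : 'rV[R]_n.+1 :=
  \row_i (if unlift ord0 i is Some j then z.2 0 j else z.1).

Definition row_uncons n (x : 'rV[R]_n.+1) : R * 'rV[R]_n :=
  (x 0 ord0, \row_j x 0 (lift ord0 j)).

Lemma row_consK n : cancel (@row_cons n) (@row_uncons n).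
Proof.
move=> [t x]; rewrite /row_uncons mxE unlift_none; congr (_, _).
by apply/rowP => j; rewrite !mxE liftK.
Qed.

Lemma measurable_row_cons n : measurable_fun setT (@row_cons n).
Proof.
apply/measurable_fun_rVP => i; under eq_fun do rewrite mxE.
case: (unlift ord0 i) => [j|]; last exact: measurable_fst.
exact: (measurableT_comp (measurable_coord j) measurable_snd).
Qed.

Lemma measurable_row_uncons n : measurable_fun setT (@row_uncons n).
Proof.
apply: measurable_fun_pair; first exact: measurable_coord.
by apply/measurable_fun_rVP => i; under eq_fun do rewrite mxE;
  exact: measurable_coord.
Qed.

Section step.
Variables (n : nat) (m : {sigma_finite_measure set 'rV[R]_n -> \bar R}).

Definition lebesgue_rV_step : set 'rV[R]_n.+1 -> \bar R :=
  pushforward (@lebesgue_measure R \x m)%E (@row_cons n).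

Let step0 : lebesgue_rV_step set0 = 0%E.
Proof. by rewrite /lebesgue_rV_step /pushforward preimage_set0 measure0. Qed.

Let step_ge0 A : (0 <= lebesgue_rV_step A)%E.
Proof. by rewrite /lebesgue_rV_step /pushforward measure_ge0. Qed.

Let step_sigma_additive : semi_sigma_additive lebesgue_rV_step.
Proof.
by apply: measure_semi_sigma_additive; exact: measurable_row_cons.
Qed.

HB.instance Definition _ := isMeasure.Build _ _ _ lebesgue_rV_step
  step0 step_ge0 step_sigma_additive.

Let step_sigma_finite : sigma_finite setT lebesgue_rV_step.
Proof.
have /sigma_finiteP[F [TF ndF Foo]] := sigma_finiteT (@lebesgue_measure R).
have /sigma_finiteP[G [TG ndG Goo]] := sigma_finiteT m.
exists (fun k => @row_uncons n @^-1` (F k `*` G k)).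
  apply/esym; rewrite -subTset => x _.
  have [k _ Fx] : (\bigcup_k F k) (x 0 ord0) by rewrite -TF.
  have [l _ Gx] : (\bigcup_k G k) (row_uncons x).2 by rewrite -TG.
  exists (maxn k l) => //; split => /=.
    by move: Fx; exact/subsetPset/ndF/leq_maxl.
  by move: Gx; exact/subsetPset/ndG/leq_maxr.
move=> k; have [mF Fk] := Foo k; have [mG Gk] := Goo k.
have mFG : measurable (F k `*` G k) by exact: measurableX.
split; first by rewrite -[X in measurable X]setTI; exact: measurable_row_uncons.
rewrite /lebesgue_rV_step /pushforward -comp_preimage.
rewrite (_ : _ \o _ = id) ?preimage_id//.
  by rewrite product_measure1E// lte_mul_pinfty// ge0_fin_numE.
by apply/funext => z /=; rewrite row_consK.
Qed.

HB.instance Definition _ :=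
  Measure_isSigmaFinite.Build _ _ _ lebesgue_rV_step step_sigma_finite.

End step.

(* Lebesgue measure on R^n as the n-fold product of lebesgue_measure. *)
Fixpoint lebesgue_rV n : {sigma_finite_measure set 'rV[R]_n -> \bar R} :=
  match n with
  | 0 => \d_(0 : 'rV[R]_0)
  | n.+1 => lebesgue_rV_step (lebesgue_rV n)
  end.

Lemma lebesgue_rV_box n (a b : 'rV[R]_n) : (forall i, a 0 i <= b 0 i) ->
  lebesgue_rV n [set x : 'rV[R]_n | forall i, a 0 i <= x 0 i <= b 0 i] =
  (\prod_i (b 0 i - a 0 i))%:E.
Proof.
elim: n => [|n IH] in a b *.
  by move=> _; rewrite big_ord0 /= diracE mem_set// => -[].
move=> ab; rewrite /= /lebesgue_rV_step /pushforward.
pose a' : 'rV[R]_n := \row_j a 0 (lift ord0 j).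
pose b' : 'rV[R]_n := \row_j b 0 (lift ord0 j).
rewrite (_ : _ @^-1` _ = `[a 0 ord0, b 0 ord0] `*`
    [set x : 'rV[R]_n | forall i, a' 0 i <= x 0 i <= b' 0 i]); last first.
  apply/seteqP; split=> -[t x] /=.
    move=> H; split=> [|i]; first by have := H ord0; rewrite mxE unlift_none in_itv.
    by have := H (lift ord0 i); rewrite !mxE liftK.
  move=> [Ht Hx] i; rewrite mxE; case: unliftP => [j|] ->.
    by have := Hx j; rewrite !mxE.
  by move: Ht; rewrite in_itv.
rewrite product_measure1E//; last first.
  rewrite (_ : [set _ | _] = \bigcap_(i in [set: 'I_n])
      ((fun x : 'rV[R]_n => x 0 i) @^-1` `[a' 0 i, b' 0 i])).
    apply: fin_bigcap_measurable => // i _.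
    by rewrite -[X in measurable X]setTI; exact: measurable_coord.
  apply/seteqP; split=> x /= H i; first by move=> _ /=; rewrite in_itv/=.
  by have /= := H i I; rewrite in_itv.
rewrite big_ord_recl EFinM IH; last by move=> i; rewrite !mxE.
congr (_ * _)%E; last by congr EFin; apply: eq_bigr => i _; rewrite !mxE.
apply: etrans (lebesgue_measure_itv _) _; rewrite /= lte_fin -EFinB.
by case: ltP => // /(conj (ab ord0)) /andP; rewrite -eq_le => /eqP ->; rewrite subrr.
Qed.

End lebesgue_rV.

Section euclidean.
Context {R : realType} {d : nat}.
Implicit Types (x y : 'rV[R]_d) (A B : set 'rV[R]_d).

(* The library's norm and balls on 'rV[R]_d are those of the sup norm. *)
Definition enorm x : R := Num.sqrt (\sum_i x 0 i ^+ 2).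

Definition eball x (r : R) : set 'rV[R]_d := [set y | enorm (y - x) < r].

Definition set_dist A B : R := inf [set enorm (x - y) | x in A & y in B].

Lemma measurable_enorm : measurable_fun setT enorm.
Proof.
apply: measurableT_comp => //.
  exact: continuous_measurable_fun (@sqrt_continuous R).
apply: measurable_sum => i; apply: measurable_funX; exact: measurable_coord.
Qed.

Definition sphere : set 'rV[R]_d := [set x | enorm x = 1].

Definition radial_proj x : 'rV[R]_d := (enorm x)^-1 *: x.

Lemma measurable_radial_proj : measurable_fun setT radial_proj.
Proof.
apply/measurable_fun_rVP => i.
rewrite (_ : (fun _ => _) = fun x => (enorm x `^ (-1)) * x 0 i).
  apply: measurable_funM; last exact: measurable_coord.
  exact: (measurableT_comp (measurable_powR _) measurable_enorm).
by apply/funext => x; rewrite mxE powR_inv1// sqrtr_ge0.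
Qed.

Definition punctured_ball : set 'rV[R]_d := [set x | 0 < enorm x < 1].

Lemma measurable_punctured_ball : measurable punctured_ball.
Proof.
rewrite (_ : punctured_ball = enorm @^-1` `]0, 1[).
  by rewrite -[X in measurable X]setTI; exact: measurable_enorm.
by apply/seteqP; split=> x /=; rewrite in_itv.
Qed.

(* The surface measure of S^(d-1), as a measure on R^d carried by the sphere:
   sigma A = d * |{x : 0 < |x| < 1, x / |x| \in A}|, which is the measure
   appearing in integration in polar coordinates. *)
Definition surface_measure : set 'rV[R]_d -> \bar R := fun A =>
  (d%:R%:E * lebesgue_rV d (radial_proj @^-1` A `&` punctured_ball))%E.

Let surface0 : surface_measure set0 = 0%E.
Proof. by rewrite /surface_measure preimage_set0 set0I measure0 mule0. Qed.

Let surface_ge0 A : (0 <= surface_measure A)%E.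
Proof. by rewrite /surface_measure mule_ge0// lee_fin. Qed.

Let surface_sigma_additive : semi_sigma_additive surface_measure.
Proof.
pose m := mscale (NngNum (ler0n R d))
  (mrestr (lebesgue_rV (R := R) d) measurable_punctured_ball).
rewrite (_ : surface_measure = pushforward m radial_proj)//.
by apply: measure_semi_sigma_additive; exact: measurable_radial_proj.
Qed.

HB.instance Definition _ := isMeasure.Build _ _ _ surface_measure
  surface0 surface_ge0 surface_sigma_additive.

End euclidean.

Section complex_valued.
Context {R : realType} {dT : measure_display} {T : measurableType dT}.
Variable mu : {measure set T -> \bar R}.
Implicit Types (f g : T -> R[i]) (D : set T).

(* Measurability of f on D with respect to the mu-completion.  The library
   integral of a nonnegative function is the supremum over measurable simple
   minorants, so it is also the integral of f for the completed measure. *)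
Definition completed_measurable D f := exists g : T -> R[i],
  [/\ measurable_fun setT (fun x => complex.Re (g x)),
      measurable_fun setT (fun x => complex.Im (g x)) &
      f = g %[ae mu in D]].

Definition cintegral D f : R[i] :=
  (\int[mu]_(x in D) complex.Re (f x)) +i* (\int[mu]_(x in D) complex.Im (f x)).

End complex_valued.

Local Notation normc := Normc.normc.

Section harmonic_analysis.
Context {R : realType} {d : nat}.
Local Notation Rd := 'rV[R]_d.
Local Notation mu := (@lebesgue_rV R d).
Implicit Types (b f g : Rd -> R[i]) (K : Rd -> Rd -> R[i]) (B : set Rd).

Definition L1loc b := completed_measurable mu setT b /\
  forall A, compact A -> (\int[mu]_(x in A) (normc (b x))%:E < +oo)%E.

Definition Linfty_norm f : \bar R := 'N[mu]_+oo[(fun x => (normc (f x))%:E)]%E.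

(* L^infty(B): essentially bounded functions with f = 1_B f. *)
Definition Linfty_on B f :=
  [/\ completed_measurable mu setT f,
      (Linfty_norm f < +oo)%E &
      f = (fun x => (\1_B x : R)%:C * f x) %[ae mu]].

Definition average b B : R[i] := ((fine (mu B))^-1)%:C * cintegral mu B b.

Definition BMO_norm b : \bar R :=
  ereal_sup [set e | exists x r, 0 < r /\
    e = (((fine (mu (eball x r)))^-1)%:E * \int[mu]_(y in eball x r)
          (normc (b y - average b (eball x r)))%:E)%E].

Definition BMO b := L1loc b /\ (BMO_norm b < +oo)%E.

Definition holder_norm (alpha : R) b : \bar R :=
  ereal_sup [set e | exists x y, x <> y /\
    e = (normc (b x - b y) / (enorm (x - y) `^ alpha))%:E].

(* <[b, T]f, g>; the integration variable z stands for the pair (x, y). *)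
Definition commutator_form b K f g : R[i] :=
  cintegral (mu \x mu)%E setT
    (fun z => (b z.1 - b z.2) * K z.1 z.2 * f z.2 * g z.1).

(* K x y is only meaningful for x <> y; its diagonal values are never used. *)
Definition CZ_kernel (omega : R -> R) K :=
  [/\ completed_measurable (mu \x mu)%E [set z | z.1 <> z.2]
        (fun z => K z.1 z.2),
      exists cK : R, forall x y, x <> y ->
        normc (K x y) <= cK * enorm (x - y) ^- d &
      forall x x' y, enorm (x - x') < 2^-1 * enorm (x - y) ->
        normc (K x y - K x' y) + normc (K y x - K y x') <=
        enorm (x - y) ^- d * omega (enorm (x - x') / enorm (x - y))].

Definition nondegenerate_CZ_kernel K :=
  (exists omega : R -> R,
    [/\ forall t, 0 <= t < 1 -> 0 <= omega t,
        forall s t, 0 <= s -> s <= t -> t < 1 -> omega s <= omega t,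
        omega t @[t --> 0^'+] --> (0 : R),
        CZ_kernel omega K &
        exists2 c0 : R, 0 < c0 & forall y r, 0 < r ->
          exists2 x, ~ eball y r x & (c0 * r ^+ d)^-1 <= normc (K x y)])
  \/
  (exists Omega : Rd -> R[i],
    [/\ forall (t : R) x, 0 < t -> Omega (t *: x) = Omega x,
        completed_measurable surface_measure sphere Omega,
        (\int[surface_measure]_(x in sphere) (normc (Omega x))%:E < +oo)%E,
        ~ (Omega = cst 0 %[ae surface_measure in sphere]) &
        forall x y, x <> y ->
          K x y = Omega (x - y) * (enorm (x - y) ^- d)%:C]).

End harmonic_analysis.

(* Main.v *)
Require Import Defs.
From HB Require Import structures.
From mathcomp Require Import all_boot all_order all_algebra.
From mathcomp Require Import all_classical all_reals all_analysis.
From mathcomp Require Import measurable_realfun ess_sup_inf.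
From mathcomp Require Import lra ring.

(** Let Q and Q' be cubes of side r at distance comparable to r such that K is
close to a constant K0 of size r^-d on Q' x Q.  Testing the commutator with f
the indicator of Q and g the sign of b - <b>_Q on Q' (separately for the real
and imaginary parts of b) gives |K0| |Q| int_Q' |b - <b>_Q|, up to an error
that is a small multiple of |K0| |Q| times oscillations of b on Q and Q'.
Adding the symmetric test with the roles of Q and Q' exchanged, the error is
absorbed, and int_Q |b - <b>_Q| <= C Theta r^alpha |Q| for every cube Q.
For alpha = 0 this is the BMO bound; for alpha > 0 the means of b over grid
cells converge uniformly to a Hoelder function equal to b almost everywhere,
which is constant if alpha > 1.

A companion cube Q' exists for a regular kernel by the modulus of continuity.
For a rough homogeneous kernel, closeness to K0 is meant in L^1 on each slice
of Q' x Q; a small cube on which the kernel is nearly constant in mean exists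
because otherwise comparing measures on dyadic cells would show that the
kernel vanishes almost everywhere, and homogeneity transports this cube to
all positions and scales. *)

Set Implicit Arguments.
Unset Strict Implicit.
Unset Printing Implicit Defensive.
Import Order.TTheory GRing.Theory Num.Theory.
Import numFieldNormedType.Exports.

Local Open Scope classical_set_scope.
Local Open Scope ring_scope.

Local Notation normc := Normc.normc.
Local Notation Re := complex.Re.
Local Notation Im := complex.Im.

(** The functions [b], [K] and [Omega] are measurable only up to null sets, so measurable
    representatives are used, and integrals of the originals are compared through their simple
    minorants.

    The real and imaginary parts of [b] cannot be treated one at a time: multiplication by the
    complex error [K - K0] mixes them. Four cross oscillations (two parts, two cubes) are therefore
    bounded by one linear system, and the kernel error is allowed the fraction 1/24 so that the
    system returns exactly half of its own left side.

    Cubes are those of the sup norm, with explicit volumes, while the hypothesis speaks of Euclidean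
    balls; passing between them costs only factors depending on [d]. The power of [r] comes from the
    volumes of the balls, since 1/p + 1/q' = 1 + alpha/d.

    Where the Lebesgue differentiation theorem would be natural, to recover [b] from its means and
    to find where a rough kernel is nearly constant, two measures are compared cell by cell on fine
    grids instead. *)

Section ae_integral.
Import HBNNSimple.
Local Open Scope ereal_scope.
Context {dT : measure_display} {T : measurableType dT} {R : realType}.
Variable mu : {measure set T -> \bar R}.
Implicit Types f g : T -> \bar R.

(** The integral is a supremum over simple minorants: a simple minorant of [f], set to 0 on the
    exceptional null set, becomes a minorant of [g] with the same integral. This handles integrands
    that agree with measurable functions only almost everywhere. *)
Lemma ge0_ae_le_integral f g : (forall x, 0 <= f x) -> (forall x, 0 <= g x) ->
  {ae mu, forall x, f x <= g x} -> \int[mu]_x f x <= \int[mu]_x g x.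
Proof.
move=> f0 g0 [N [mN N0 subN]]; rewrite !ge0_integralTE//.
apply: ge_ereal_sup => _ /= [h hf <-].
have mNC : measurable (~` N) by exact: measurableC.
apply: ereal_sup_ubound; exists (proj_nnsfun h mNC) => /=.
  move=> x; rewrite mindicE; have [xN|xN] := boolP (x \in ~` N).
    rewrite mulr1; apply: le_trans (hf x) _; apply: contrapT => fg.
    by move: xN; rewrite inE; apply; apply: subN => /=.
  by rewrite mulr0.
have := @integral_nnsfun _ _ _ mu _ measurableT (proj_nnsfun h mNC).
rewrite patch_setT => <-.
have := @integral_nnsfun _ _ _ mu _ measurableT h.
rewrite patch_setT => <-.
apply: ge0_ae_eq_integral => //.
- exact/measurable_EFinP.
- exact/measurable_EFinP.
- by move=> x _; rewrite lee_fin.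
- by move=> x _; rewrite lee_fin.
exists N; split => // x /= /not_implyP[_ hx]; apply: contrapT => xN; apply: hx.
by rewrite mindicE mem_set// mulr1.
Qed.

Lemma ae_eq_integral_nonmeas D f g : f = g %[ae mu in D] ->
  \int[mu]_(x in D) f x = \int[mu]_(x in D) g x.
Proof.
have le F G : F = G %[ae mu in D] -> 
    \int[mu]_(x in D) F^\+ x <= \int[mu]_(x in D) G^\+ x.
  move=> FG; rewrite [leLHS]integral_mkcond [leRHS]integral_mkcond.
  apply: ge0_ae_le_integral.
  - by move=> x; rewrite patchE; case: ifP.
  - by move=> x; rewrite patchE; case: ifP.
  apply: filterS FG => x FGx; rewrite !patchE; case: ifPn => // /set_mem Dx.
  by rewrite !funeposE FGx.
have leN F G : F = G %[ae mu in D] -> 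
    \int[mu]_(x in D) F^\- x <= \int[mu]_(x in D) G^\- x.
  move=> FG; rewrite -!funeposN; apply: le.
  by apply: filterS FG => x FGx Dx /=; rewrite FGx.
move=> fg; have gf : g = f %[ae mu in D].
  by apply: filterS fg => x H Dx; rewrite H.
rewrite integralE [RHS]integralE; congr (_ - _); apply/eqP; rewrite eq_le.
  by rewrite !le.
by rewrite !leN.
Qed.

Lemma ae_eq_Rintegral D (f g : T -> R) : f = g %[ae mu in D] ->
  Rintegral mu D f = Rintegral mu D g.
Proof.
move=> fg; congr fine; apply: ae_eq_integral_nonmeas.
by apply: filterS fg => x H Dx; rewrite H.
Qed.

End ae_integral.

(** * Lebesgue measure on R^n *)

Section boxes.
Context {R : realType} {d : nat}.
Local Notation Rd := 'rV[R]_d.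
Local Notation mu := (@lebesgue_rV R d).
Implicit Types (a b x y : Rd) (A : set Rd).

(** Coordinates generate the sigma-algebra and rays generate the Borel sets of the line; since the
    sets of the line whose preimage under a coordinate lies in [S] form a sigma-algebra, rays are
    enough. *)
Lemma sub_measurable_rV (S : set (set Rd)) : sigma_algebra setT S ->
  (forall i (t : R), S [set x | t <= x 0 i]) -> measurable `<=` S.
Proof.
move=> sS Si; apply: smallest_sub => //; rewrite -bigcup_seq/=.
apply: bigcup_sub => i _ _ [B mB <-]; rewrite setTI.
pose f (x : Rd) := x 0 i.
have : measurable `<=` image_set_system setT f S.
  have -> : (measurable : set (set R)) = <<s @RGenCInfty.G R >>.
    exact: RGenCInfty.measurableE.
  apply: smallest_sub.
    exact: sigma_algebra_image.
  move=> _ [t ->]; rewrite /image_set_system /= setTI.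
  suff -> : f @^-1` `[t, +oo[ = [set x | t <= x 0 i] by exact: Si.
  by apply/seteqP; split => x /=; rewrite in_itv/= andbT.
by move=> /(_ _ mB); rewrite /image_set_system /= setTI.
Qed.

Definition box a b : set Rd := [set x | forall i, a 0 i <= x 0 i <= b 0 i].

Lemma measurable_box a b : measurable (box a b).
Proof.
rewrite (_ : box a b = \bigcap_(i in [set: 'I_d])
    ((fun x : Rd => x 0 i) @^-1` `[a 0 i, b 0 i])).
  apply: fin_bigcap_measurable => // i _.
  by rewrite -[X in measurable X]setTI; exact: measurable_coord.
apply/seteqP; split=> x /= H i; first by move=> _ /=; rewrite in_itv/=.
by have /= := H i I; rewrite in_itv.
Qed.

Definition boxes : set (set Rd) := [set A | exists a b, A = box a b].

Let bigbox (n : nat) : set Rd := box (const_mx (- n%:R)) (const_mx n%:R).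

Let bigbox_cover : \bigcup_n bigbox n = setT.
Proof.
apply/seteqP; split => // x _.
have [n hn] : exists n : nat, forall i, `|x 0 i| <= n%:R.
  exists (\max_(i < d) (Num.truncn `|x 0%R i|).+1)%N => i.
  apply: (@le_trans _ _ (Num.truncn `|x 0 i|).+1%:R).
    exact/ltW/truncnS_gt.
  by rewrite ler_nat (leq_bigmax i).
by exists n => // i; rewrite !mxE -ler_norml.
Qed.

Lemma measurable_rVE : measurable = <<s boxes >> :> set (set Rd).
Proof.
apply/seteqP; split; last first.
  apply: smallest_sub; first exact: sigma_algebra_measurable.
  by move=> _ [a [b ->]]; exact: measurable_box.
apply: sub_measurable_rV; first exact: smallest_sigma_algebra.
move=> i t.
(* A half-space cut by the [n]-th big box is again a box: the lower bound of coordinate [i] is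
   raised from [- n] to the maximum with [t]. *)
rewrite -[X in smallest _ _ X]setTI -bigbox_cover setI_bigcupl.
apply: sigma_algebra_bigcup => n; apply: sub_sigma_algebra.
exists (\row_j (if j == i then Num.max t (- n%:R) else - n%:R)), (const_mx n%:R).
apply/seteqP; split => x /=.
  move=> [H tx] j; rewrite !mxE; have := H j; rewrite !mxE.
  by case: eqP => [->|//]; rewrite ge_max tx.
move=> H; split => [j|].
  have := H j; rewrite !mxE; case: eqP => // _ /andP[].
  by rewrite ge_max => /andP[_ ->] ->.
by have := H i; rewrite !mxE eqxx ge_max => /andP[/andP[]].
Qed.

Lemma mu_box a b : (forall i, a 0 i <= b 0 i) ->
  mu (box a b) = (\prod_i (b 0 i - a 0 i))%:E.
Proof. exact: lebesgue_rV_box. Qed.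

(** Boxes form a generating class stable under intersection, with an exhaustion of finite measure.
    Only ordered endpoints have to be tested, because a box with [b 0 i < a 0 i] for some [i] is
    empty. *)
Lemma lebesgue_rV_unique (m1 m2 : {measure set Rd -> \bar R}) :
  (forall a b, (forall i, a 0 i <= b 0 i) -> m1 (box a b) = m2 (box a b)) ->
  (forall a b, (forall i, a 0 i <= b 0 i) -> (m1 (box a b) < +oo)%E) ->
  forall A, measurable A -> m1 A = m2 A.
Proof.
move=> m12 m1oo; apply: (measure_unique boxes bigbox).
- exact: measurable_rVE.
- move=> _ _ [a [b ->]] [a' [b' ->]].
  exists (\row_i Num.max (a 0 i) (a' 0 i)), (\row_i Num.min (b 0 i) (b' 0 i)).
  apply/seteqP; split => x /=.
    move=> [H1 H2] i; rewrite !mxE ge_max le_min.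
    have /andP[h1 h2] := H1 i; have /andP[h3 h4] := H2 i.
    by rewrite h1 h2 h3 h4.
  move=> H; split=> i; have := H i; rewrite !mxE ge_max le_min;
    by move=> /andP[/andP[h1 h2] /andP[h3 h4]]; rewrite ?h1 ?h2 ?h3 ?h4.
- by move=> n; exists (const_mx (- n%:R)), (const_mx n%:R).
- exact: bigbox_cover.
- move=> _ [a [b ->]].
  have [|/existsNP[i /negP]] := pselect (forall i, a 0 i <= b 0 i).
    exact: m12.
  rewrite -ltNge => ba; rewrite (_ : box a b = set0) ?measure0//.
  apply/seteqP; split => // x /(_ i) /andP[ax xb].
  by have := le_lt_trans (le_trans ax xb) ba; rewrite ltxx.
- move=> n; apply: m1oo => i; rewrite !mxE.
  by rewrite ge0_cp ?ler0n.
Qed.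

Lemma measurable_rV_affine (a : Rd) (t : R) :
  measurable_fun setT (fun y : Rd => a + t *: y).
Proof.
apply/measurable_fun_rVP => i.
under eq_fun do rewrite !mxE.
by apply: measurable_funD => //; apply: measurable_funM => //;
  exact: measurable_coord.
Qed.

(** Both sides are measures in [A], so boxes decide. Negative [t] matters: in a difference [x - y]
    the variable [y] enters with a minus sign. *)
Lemma lebesgue_rV_affine (a : Rd) (t : R) A : t != 0 -> measurable A ->
  mu ((fun y => a + t *: y) @^-1` A) = ((`|t| ^- d)%:E * mu A)%E.
Proof.
move=> t0 mA.
pose phi := fun y : Rd => a + t *: y.
have mphi : measurable_fun setT phi := measurable_rV_affine a t.
have td0 : 0 <= `|t| ^- d by rewrite invr_ge0 exprn_ge0.
have boxE (u v : Rd) : (forall i, u 0 i <= v 0 i) ->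
    mu (phi @^-1` box u v) = (`|t| ^- d * \prod_i (v 0 i - u 0 i))%:E.
  move=> uv.
  (* A negative [t] exchanges the two endpoints, hence the minimum here and the maximum below. *)
  pose u' : Rd := \row_i Num.min ((u 0 i - a 0 i) / t) ((v 0 i - a 0 i) / t).
  pose v' : Rd := \row_i Num.max ((u 0 i - a 0 i) / t) ((v 0 i - a 0 i) / t).
  have -> : phi @^-1` box u v = box u' v'.
    apply/seteqP; split => x /= H i; have := H i; rewrite !mxE; have := uv i.
      move=> uvi; rewrite ge_min le_max => /andP[h1 h2].
      have : t < 0 \/ 0 < t by apply/orP; rewrite -neq_lt.
      case=> tl; [rewrite !ler_ndivrMr// !ler_ndivlMr//|
                  rewrite !ler_pdivrMr// !ler_pdivlMr//].
        by apply/andP; split; apply/orP; [right|left]; lra.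
      by apply/andP; split; apply/orP; [left|right]; lra.
    move=> uvi; have : t < 0 \/ 0 < t by apply/orP; rewrite -neq_lt.
    case=> tl; rewrite ge_min le_max => /andP[].
      rewrite !ler_ndivrMr// !ler_ndivlMr// => h1 h2; apply/andP.
      by case/orP: h1 => h1; case/orP: h2 => h2; split; lra.
    rewrite !ler_pdivrMr// !ler_pdivlMr// => h1 h2; apply/andP.
    by case/orP: h1 => h1; case/orP: h2 => h2; split; lra.
  rewrite lebesgue_rV_box; last by move=> i; rewrite !mxE ge_min !le_max lexx.
  rewrite -exprVn -[X in (_ ^+ X)](card_ord d) -prodr_const -big_split/=.
  congr EFin; apply: eq_bigr => i _; rewrite !mxE -normfV.
  have -> (p q : R) : Num.max p q - Num.min p q = `|q - p|.
    by case: ltP => pq; [rewrite ger0_norm// subr_ge0 ltW|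
                          rewrite ler0_norm ?opprB// subr_le0].
  rewrite -mulrBl opprD addrACA opprK addNr addr0 normrM mulrC.
  by rewrite (@ger0_norm _ (_ - _)) ?subr_ge0.
pose m2 := mscale (NngNum td0) mu.
have := @lebesgue_rV_unique (pushforward mu phi) m2 _ _ A mA.
apply.
- move=> u v uv.
  apply: etrans (boxE _ _ uv) _.
  by rewrite EFinM -mu_box.
- move=> u v uv; have /= := ltry (`|t| ^- d * \prod_i (v 0 i - u 0 i)).
  by rewrite -boxE.
Qed.

End boxes.

(** * Dyadic grids *)

Section countable_fibers.
Context {dT : measure_display} {T : measurableType dT} {R : realType}.
Context {J : countType} (g : T -> J).
Hypothesis mg : forall j, measurable (g @^-1` [set j]).

Lemma measurable_countable_fibers (S : set J) : measurable (g @^-1` S).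
Proof.
rewrite (_ : g @^-1` S = \bigcup_j [set x | S j /\ g x = j]).
  apply: countable_bigcupT_measurable => // j.
  have [Sj|nSj] := pselect (S j).
    rewrite (_ : [set _ | _] = g @^-1` [set j])//.
    by apply/seteqP; split => x //= [].
  by rewrite (_ : [set _ | _] = set0)//; apply/seteqP; split => x //= [].
by apply/seteqP; split=> [x Sx|x [j _ [Sj /= ->]]]//; exists (g x).
Qed.

(** Sorting the points by the code of [g x] gives countably many pieces [F k], each empty or a whole
    fibre, so countable additivity sums the assumed inequalities. *)
Lemma le_measure_fibers (m1 m2 : {measure set T -> \bar R}) :
  (forall x, (m1 (g @^-1` [set g x]) <= m2 (g @^-1` [set g x]))%E) ->
  forall S : set J, (m1 (g @^-1` S) <= m2 (g @^-1` S))%E.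
Proof.
move=> m12 S.
pose F k := [set x | S (g x) /\ pickle (g x) = k].
have FE : g @^-1` S = \bigcup_k F k.
  apply/seteqP; split=> [x Sx|x [k _ []]]//; by exists (pickle (g x)).
have mF k : measurable (F k).
  exact: (measurable_countable_fibers [set j | S j /\ pickle j = k]).
have tF : trivIset setT F.
  by move=> i j _ _ [x [[_ <-] [_ <-]]].
rewrite FE !measure_semi_bigcup//; try exact: bigcupT_measurable.
apply: lee_nneseries => [k _ _|k _]; first exact: measure_ge0.
have [[x Fx]|F0] := pselect (F k !=set0).
  suff -> : F k = g @^-1` [set g x] by exact: m12.
  case: Fx => Sx xk; apply/seteqP; split=> y /=.
    by move=> [_]; rewrite -xk => /(pcan_inj pickleK).
  by rewrite /F/= => ->.
by move/nonemptyPn : F0 => ->; rewrite !measure0.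
Qed.

End countable_fibers.

Section grids.
Context {R : realType} {d : nat}.
Local Notation Rd := 'rV[R]_d.
Implicit Types (x y : Rd) (A : set Rd) (s : R).

(** Indices live in a countable type, so any union of cells is the preimage of an arbitrary set of
    indices and is measurable, as is any function of the index. *)
Definition gidx s x : 'rV[int]_d := \row_i Num.floor (x 0 i / s).

Definition gcell s x : set Rd := gidx s @^-1` [set gidx s x].

Lemma gcell_refl s x : gcell s x x. Proof. by []. Qed.

Lemma gcellE s x y : gcell s x y -> gcell s x = gcell s y.
Proof. by rewrite /gcell /= => ->. Qed.

Lemma measurable_gcell_fiber s (j : 'rV[int]_d) :
  measurable (gidx s @^-1` [set j]).
Proof.
rewrite (_ : _ @^-1` _ = \bigcap_(i in [set: 'I_d])
    ((fun x : Rd => x 0 i / s) @^-1` `[(j 0 i)%:~R, (j 0 i + 1)%:~R[)).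
  apply: fin_bigcap_measurable => // i _.
  rewrite -[X in measurable X]setTI; apply: measurable_funM => //.
  exact: measurable_coord.
apply/seteqP; split=> x /=.
  move=> <- i _ /=; rewrite in_itv/= mxE; exact: floor_itv.
move=> H; apply/rowP => i; rewrite mxE; apply: floor_def.
by have := H i I; rewrite /= in_itv.
Qed.

Lemma measurable_level s (S : set 'rV[int]_d) : measurable (gidx s @^-1` S).
Proof. apply: measurable_countable_fibers; exact: measurable_gcell_fiber. Qed.

Lemma measurable_gcell s x : measurable (gcell s x).
Proof. exact: measurable_level. Qed.

Lemma measurable_fun_level dU (U : measurableType dU) s (f : 'rV[int]_d -> U) :
  measurable_fun setT (fun x : Rd => f (gidx s x)).
Proof.
by move=> _ B _; rewrite setTI; exact: (measurable_level s (f @^-1` B)).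
Qed.

Lemma gcell_bounds s x y i : 0 < s -> gcell s x y -> `|y 0 i - x 0 i| <= s.
Proof.
move=> s0 /rowP/(_ i); rewrite !mxE => fE.
have /andP[y1 y2] := floor_itv (y 0 i / s).
have /andP[x1 x2] := floor_itv (x 0 i / s).
move: y1 y2 x1 x2; rewrite fE intrD /= !ler_pdivlMr// !ltr_pdivrMr//.
move=> *; rewrite ler_norml; lra.
Qed.

Definition side (n : nat) : R := 2 ^- n.

Lemma side_gt0 n : 0 < side n. Proof. by rewrite invr_gt0 exprn_gt0. Qed.

(** Halving the side once uses that the floor of [y] is the floor of half the floor of [2 * y]. The
    function [h] turns a union of coarse cells into a union of fine ones by taking a preimage. *)
Lemma gidx_refine n k : exists h, forall x, gidx (side n) x = h (gidx (side (n + k)) x).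
Proof.
elim: k => [|k [h hE]]; first by exists id => x; rewrite addn0.
exists (fun j => h (\row_i Num.floor ((j 0 i)%:~R / 2 : R))) => x.
rewrite hE; congr h; apply/rowP => i; rewrite !mxE.
rewrite /side !invrK addnS exprSr mulrA.
set y := x 0 i * 2 ^+ (n + k); symmetry; apply: floor_def.
have /andP[y1 y2] := floor_itv y.
have /andP[z1 z2] := floor_itv (y * 2).
have : Num.floor y * 2 <= Num.floor (y * 2).
  by rewrite floor_ge_int intrM ler_wpM2r.
rewrite -(ler_int R) intrM => h1; rewrite intrD in y2 *.
apply/andP; split; rewrite ?ler_pdivlMr// ?ltr_pdivrMr//; lra.
Qed.

Definition level (n : nat) (A : set Rd) := exists S, A = gidx (side n) @^-1` S.

Lemma levelS n m A : (n <= m)%N -> level n A -> level m A.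
Proof.
move=> nm [S ->]; have [h hE] := gidx_refine n (m - n).
exists (h @^-1` S); apply/seteqP; rewrite -(subnKC nm).
by split=> x /=; rewrite hE subnKC.
Qed.

Lemma level_measurable n A : level n A -> measurable A.
Proof. by move=> [S ->]; exact: measurable_level. Qed.

(* The sets for which this holds form a sigma-algebra containing the
   half-spaces. *)
Lemma level_approx (m : {measure set Rd -> \bar R}) (N : nat) A :
  (m setT < +oo)%E -> measurable A -> forall e : R, 0 < e ->
  exists n U, [/\ (N <= n)%N, level n U &
    (m ((A `\` U) `|` (U `\` A)) <= e%:E)%E].
Proof.
move=> mfin; move: A.
pose ap A (e : R) := exists n U, [/\ (N <= n)%N, level n U &
    (m ((A `\` U) `|` (U `\` A)) <= e%:E)%E].
pose C : set (set Rd) := [set A | measurable A /\ forall e, 0 < e -> ap A e].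
have mD A U : measurable A -> measurable U ->
    measurable ((A `\` U) `|` (U `\` A)).
  by move=> mA mU; apply: measurableU; exact: measurableD.
have C0 n U : level n U -> C U.
  move=> lU; split; first exact: level_measurable lU.
  move=> e e0; exists (maxn n N), U; split; first exact: leq_maxr.
    exact: levelS (leq_maxl _ _) lU.
  by rewrite setDv setU0 measure0 lee_fin ltW.
have CC B : C B -> C (~` B).
  move=> [mB aB]; split; first exact: measurableC.
  move=> e /aB[n [U [Nn lU mU]]]; exists n, (~` U); split => //.
    by case: lU => S ->; exists (~` S).
  by rewrite !setDE !setCK setUC (setIC (~` U)) (setIC (~` B)) -!setDE.
have CU B1 B2 : C B1 -> C B2 -> C (B1 `|` B2).
  move=> [mB1 aB1] [mB2 aB2]; split; first exact: measurableU.
  move=> e e0; have e20 : 0 < e / 2 by rewrite divr_gt0.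
  have [n1 [U1 [Nn1 lU1 mU1]]] := aB1 _ e20.
  have [n2 [U2 [Nn2 lU2 mU2]]] := aB2 _ e20.
  exists (maxn n1 n2), (U1 `|` U2); split.
  - exact: leq_trans Nn1 (leq_maxl _ _).
  - have [S1 ->] := levelS (leq_maxl n1 n2) lU1.
    have [S2 ->] := levelS (leq_maxr n1 n2) lU2.
    by exists (S1 `|` S2).
  have mm1 := level_measurable lU1; have mm2 := level_measurable lU2.
  rewrite [e]splitr EFinD; apply: le_trans (leeD mU1 mU2).
  apply: le_trans (measureU2 _ _ _); try exact: mD.
  apply: le_measure; rewrite ?inE; first by apply: mD; exact: measurableU.
    by apply: measurableU; exact: mD.
  move=> x /= [[[b1|b2] nU]|[[u1|u2] nB]].
  - by left; left; split=> // ?; apply: nU; left.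
  - by right; left; split=> // ?; apply: nU; right.
  - by left; right; split=> // ?; apply: nB; left.
  - by right; right; split=> // ?; apply: nB; right.
have Csig : sigma_algebra setT C.
  split.
  - by apply: (C0 N); exists set0.
  - by move=> B CB; rewrite setTD; exact: CC.
  move=> F CF; split; first by apply: bigcupT_measurable => k; have [] := CF k.
  move=> e e0; have e20 : 0 < e / 2 by rewrite divr_gt0.
  (* Finite unions are already in [C]. As [m] is finite, the measures of the remainders [H n], which
     decrease to the empty set, tend to 0, so a finite union is close enough. *)
  pose G n := \big[setU/set0]_(k < n) F k.
  have CG n : C (G n).
    rewrite /G; elim: n => [|n IH]; last by rewrite big_ord_recr; exact: CU.
    by rewrite big_ord0; apply: (C0 N); exists set0.
  have mG n : measurable (G n) by have [] := CG n.
  have mF : measurable (\bigcup_n F n).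
    by apply: bigcupT_measurable => k; have [] := CF k.
  pose H n := (\bigcup_n F n) `\` G n.
  have mH n : measurable (H n) by exact: measurableD.
  have H0 : \bigcap_n H n = set0.
    apply/seteqP; split => // x Hx; have [[k _ Fk] _] := Hx 0%N I.
    have [_] := Hx k.+1 I; apply; rewrite /G big_ord_recr; by right.
  have [n Hn] : exists n, (m (H n) <= (e / 2)%:E)%E.
    apply: contrapT => /forallNP nH.
    have cH : m (H n) @[n --> \oo] --> 0%E.
      rewrite -(@measure0 _ _ _ m) -H0; apply: nonincreasing_cvg_mu => //.
      - by apply: le_lt_trans mfin; apply: le_measure; rewrite ?inE.
      - by rewrite H0.
      move=> i j ij; apply/subsetPset; apply: setDS.
      rewrite /G -!bigcup_mkord => x [k /= ki Fk]; exists k => //=.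
      exact: leq_trans ki ij.
    have : ((e / 2)%:E <= lim (m (H n) @[n --> \oo]))%E.
      apply: lime_ge; first by apply/cvg_ex; exists 0%E.
      by apply: nearW => n; rewrite ltW// ltNge; exact/negP/nH.
    by rewrite (cvg_lim _ cH)// lee_fin leNgt e20.
  have [_ /(_ _ e20)[p [U [Np lU mU]]]] := CG n.
  exists p, U; split => //.
  have mmU := level_measurable lU.
  rewrite [e]splitr EFinD; apply: le_trans (leeD Hn mU).
  apply: le_trans (measureU2 _ _ _) => //; last exact: mD.
  apply: le_measure; rewrite ?inE; first exact: mD.
    by apply: measurableU => //; exact: mD.
  move=> x /= [[Fx nU]|[Ux nF]].
    by have [Gx|nG] := pselect (G n x); [right; left|left].
  right; right; split => // Gx; apply: nF.
  move: Gx; rewrite /G -bigcup_mkord => -[k _ Fk]; by exists k.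
suff : measurable `<=` C by move=> MC A /MC[].
apply: sub_measurable_rV => // i t; rewrite -[X in C X]setCK; apply: (CC).
(* If [x 0 i < t], a grid of side at most [t - x 0 i] gives [x] an index strictly below that of [t];
   conversely a strictly smaller floor forces [x 0 i < t]. *)
have -> : ~` [set x : Rd | t <= x 0 i] =
    \bigcup_n (gidx (side n) @^-1` [set j | j 0 i < Num.floor (t / side n)]).
  apply/seteqP; split => x /=.
    move=> /negP; rewrite -ltNge => xt.
    have [n hn] : exists n : nat, 1 <= (t - x 0 i) * 2 ^+ n.
      exists (Num.truncn (t - x 0 i)^-1).+1.
      rewrite -ler_pdivrMl ?subr_gt0// mulr1.
      apply: le_trans (ltW (truncnS_gt _)) _.
      by rewrite -natrX ler_nat ltnW// ltn_expl.
    exists n => //=; rewrite mxE -lezD1 /side invrK floor_ge_int intrD.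
    by have := floor_le (x 0 i * 2 ^+ n); lra.
  move=> [n _ /=]; rewrite mxE => ft; apply/negP; rewrite -ltNge ltNge.
  apply/negP => tx; move: ft; rewrite ltNge => /negP; apply; apply: le_floor.
  by rewrite ler_pM2r// invr_gt0 side_gt0.
by case: Csig => _ _; apply => n; apply: (C0 n); eexists.
Qed.

Lemma le_measure_level (m1 m2 : {measure set Rd -> \bar R}) s :
  (forall x, (m1 (gcell s x) <= m2 (gcell s x))%E) ->
  forall S, (m1 (gidx s @^-1` S) <= m2 (gidx s @^-1` S))%E.
Proof.
move=> m12 S; apply: le_measure_fibers => //; exact: measurable_gcell_fiber.
Qed.

(** Approximating [A] by a union of small cells for the sum of [m1] and [m2] lets a single
    approximation serve both measures. *)
Lemma le_measure_gcell (m1 m2 : {measure set Rd -> \bar R}) (N : nat) :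
  (m1 setT < +oo)%E -> (m2 setT < +oo)%E ->
  (forall n x, (N <= n)%N ->
    (m1 (gcell (side n) x) <= m2 (gcell (side n) x))%E) ->
  forall A, measurable A -> (m1 A <= m2 A)%E.
Proof.
move=> fin1 fin2 m12 A mA; apply/lee_addgt0Pr => e e0.
have fin : (measure_add m1 m2 setT < +oo)%E.
  by rewrite measure_addE lte_add_pinfty.
have e20 : 0 < e / 2 by rewrite divr_gt0.
have [n [U [Nn lU]]] := @level_approx _ N A fin mA _ e20.
move=> mAU0; have mU := level_measurable lU.
have mAU : (m1 ((A `\` U) `|` (U `\` A)) + m2 ((A `\` U) `|` (U `\` A))
    <= (e / 2)%:E)%E by rewrite -measure_addE.
have mD : measurable ((A `\` U) `|` (U `\` A)).
  by apply: measurableU; exact: measurableD.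
have h1 : (m1 ((A `\` U) `|` (U `\` A)) <= (e / 2)%:E)%E.
  by apply: le_trans mAU; rewrite leeDl.
have h2 : (m2 ((A `\` U) `|` (U `\` A)) <= (e / 2)%:E)%E.
  by apply: le_trans mAU; rewrite leeDr.
have AU : (m1 A <= m1 U + (e / 2)%:E)%E.
  apply: le_trans (leeD (lexx _) h1); apply: le_trans (measureU2 _ _ _) => //.
  apply: le_measure; rewrite ?inE//; first exact: measurableU.
  by move=> x Ax; have [Ux|nU] := pselect (U x); [left|right; left].
have UA : (m2 U <= m2 A + (e / 2)%:E)%E.
  apply: le_trans (leeD (lexx _) h2); apply: le_trans (measureU2 _ _ _) => //.
  apply: le_measure; rewrite ?inE//; first exact: measurableU.
  by move=> x Ux; have [Ax|nA] := pselect (A x); [left|right; right].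
apply: (le_trans AU); rewrite [e in leRHS]splitr EFinD addeA leeD//.
apply: le_trans UA; case: lU => S ->.
by apply: le_measure_level => x; exact: m12.
Qed.

End grids.

(** * Cubes and mean oscillation *)

Section density.
Local Open Scope ereal_scope.
Context {dT : measure_display} {T : measurableType dT} {R : realType}.
Variables (mu : {measure set T -> \bar R}) (h : T -> \bar R).
Variables (mh : measurable_fun setT h) (h0 : forall x, 0 <= h x).

(** The proofs about [h] are arguments, so that the measure structure can be attached to the set
    function itself. *)
Definition density of measurable_fun setT h & (forall x, 0 <= h x) :
  set T -> \bar R := fun A => \int[mu]_(x in A) h x.

Let density0 : density mh h0 set0 = 0.
Proof. exact: integral_set0. Qed.

Let density_ge0 A : 0 <= density mh h0 A.
Proof. exact: integral_ge0. Qed.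

Let density_sigma_additive : semi_sigma_additive (density mh h0).
Proof.
move=> F mF tF mUF; rewrite /density ge0_integral_bigcup//; last first.
  exact: measurable_funTS.
by apply: is_cvg_ereal_nneg_natsum => n _; exact: integral_ge0.
Qed.

HB.instance Definition _ := isMeasure.Build _ _ _ (density mh h0)
  density0 density_ge0 density_sigma_additive.

End density.

Section cubes.
Context {R : realType} {d : nat}.
Local Notation Rd := 'rV[R]_d.
Local Notation mu := (@lebesgue_rV R d).
Implicit Types (x y : Rd) (A B : set Rd) (s r : R) (u : Rd -> R).

Definition cube x r : set Rd := [set y | forall i, `|y 0 i - x 0 i| <= r].

Lemma cube_box x r : cube x r = box (x - const_mx r) (x + const_mx r).
Proof.
by apply/seteqP; split => y /= H i; have := H i; rewrite !mxE ler_distl.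
Qed.

Lemma measurable_cube x r : measurable (cube x r).
Proof. by rewrite cube_box; exact: measurable_box. Qed.

Lemma mu_cube x r : 0 <= r -> mu (cube x r) = ((2 * r) ^+ d)%:E.
Proof.
move=> r0; rewrite cube_box mu_box; last by move=> i; rewrite !mxE; lra.
congr EFin; rewrite (eq_bigr (fun=> 2 * r)); last by move=> i _; rewrite !mxE; lra.
by rewrite prodr_const card_ord.
Qed.

Lemma cube_sub x y r s : (forall i, `|x 0 i - y 0 i| + r <= s) ->
  cube x r `<=` cube y s.
Proof.
move=> H z zx i; rewrite -(subrKA (x 0 i)); apply: le_trans (ler_normD _ _) _.
by apply: le_trans (H i); rewrite addrC lerD2l.
Qed.

Lemma cube_center x r : 0 <= r -> cube x r x.
Proof. by move=> r0 i; rewrite subrr normr0. Qed.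

Lemma fin_mu_sub A x r : A `<=` cube x r -> measurable A -> (mu A < +oo)%E.
Proof.
move=> Ax mA; have r0 : 0 <= Num.max r 0 by rewrite le_max lexx orbT.
apply: le_lt_trans (ltry ((2 * Num.max r 0) ^+ d)); rewrite -(mu_cube x)//.
apply: le_measure; rewrite ?inE//; first exact: measurable_cube.
by move=> y /Ax yx i; rewrite le_max yx.
Qed.

Lemma gcell_sub_cube s x : 0 < s -> gcell s x `<=` cube x s.
Proof. by move=> s0 y xy i; exact: gcell_bounds. Qed.

Lemma cube_sub_gcell s x : 0 < s -> exists c, cube c (s / 4) `<=` gcell s x.
Proof.
move=> s0; exists (\row_i (s * ((Num.floor (x 0 i / s))%:~R + 2^-1))) => y yc.
apply/rowP => i; have := yc i; rewrite !mxE ler_distl => /andP[h1 h2].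
apply: floor_def; rewrite ler_pdivlMr// ltr_pdivrMr// intrD.
by apply/andP; split; nra.
Qed.

(** A closed cube around the centre of the half-open cell, with half side a quarter of [s], lies
    inside it. With the enclosing cube of half side [s], this fixes the volume of the cell up to a
    factor [4 ^+ d], precise enough for all the estimates. *)
Lemma mu_gcell_ge s x : 0 < s -> (((s / 2) ^+ d)%:E <= mu (gcell s x))%E.
Proof.
move=> s0; have [c cg] := cube_sub_gcell x s0.
rewrite (_ : s / 2 = 2 * (s / 4)); last by lra.
rewrite -(mu_cube c); last by lra.
by apply: le_measure; rewrite ?inE; [exact: measurable_cube|
  exact: measurable_gcell|].
Qed.

Lemma mu_gcell_fin s x : 0 < s -> mu (gcell s x) = (fine (mu (gcell s x)))%:E.
Proof.
move=> s0; rewrite fineK// ge0_fin_numE//.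
exact: fin_mu_sub (gcell_sub_cube s0) (measurable_gcell _ _).
Qed.

Lemma fine_mu_gcell_ge s x : 0 < s -> (s / 2) ^+ d <= fine (mu (gcell s x)).
Proof. by move=> s0; rewrite -lee_fin -mu_gcell_fin//; exact: mu_gcell_ge. Qed.

Definition locint u := measurable_fun setT u /\
  forall x r, mu.-integrable (cube x r) (EFin \o u).

Definition mean A u := (fine (mu A))^-1 * \int[mu]_(y in A) u y.

Section local.
Variables (u : Rd -> R) (lu : locint u).
Variables (x : Rd) (r : R).

Lemma locint_int A : measurable A -> A `<=` cube x r ->
  mu.-integrable A (EFin \o u).
Proof. by move=> mA Ax; apply: integrableS (lu.2 x r) => //; exact: measurable_cube. Qed.

Lemma cst_int A (c : R) : measurable A -> A `<=` cube x r ->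
  mu.-integrable A (EFin \o cst c).
Proof.
move=> mA Ax; apply/integrableP; split.
  by apply/measurable_EFinP; exact: measurable_cst.
under eq_integral do rewrite /=.
rewrite integral_cst//= lte_mul_pinfty ?lee_fin//.
exact: fin_mu_sub Ax mA.
Qed.

Lemma locint_subc A (c : R) : measurable A -> A `<=` cube x r ->
  mu.-integrable A (EFin \o (fun y => u y - c)).
Proof.
move=> mA Ax.
by have := integrableB mA (locint_int mA Ax) (cst_int c mA Ax).
Qed.

Lemma locint_dist A (c : R) : measurable A -> A `<=` cube x r ->
  mu.-integrable A (EFin \o (fun y => `|u y - c|)).
Proof. by move=> mA Ax; exact: integrable_norm (locint_subc c mA Ax). Qed.

Lemma mean_subc A (c : R) : measurable A -> A `<=` cube x r ->
  0 < fine (mu A) -> fine (mu A) * (mean A u - c) = \int[mu]_(y in A) (u y - c).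
Proof.
move=> mA Ax A0; rewrite RintegralB//; last 2 first.
- exact: locint_int.
- exact: cst_int.
rewrite Rintegral_cst// mulrBr /mean mulrA divff ?gt_eqF// mul1r.
by rewrite (mulrC c).
Qed.

Lemma mean_dist A (c : R) : measurable A -> A `<=` cube x r ->
  0 < fine (mu A) ->
  fine (mu A) * `|mean A u - c| <= \int[mu]_(y in A) `|u y - c|.
Proof.
move=> mA Ax A0; rewrite -[X in X * _](ger0_norm (ltW A0)) -normrM mean_subc//.
by apply: le_normr_Rintegral => //; exact: locint_subc.
Qed.

Lemma osc_le A (c c' : R) : measurable A -> A `<=` cube x r ->
  \int[mu]_(y in A) `|u y - c| <=
  \int[mu]_(y in A) `|u y - c'| + fine (mu A) * `|c' - c|.
Proof.
move=> mA Ax; rewrite (mulrC (fine _)) -Rintegral_cst// -RintegralD//; last 2 first.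
- exact: locint_dist.
- exact: cst_int.
apply: le_Rintegral => //; first exact: locint_dist.
  have := integrableD mA (locint_dist c' mA Ax) (cst_int (`|c' - c|) mA Ax).
  exact.
by move=> y _; rewrite -(subrKA c'); exact: ler_normD.
Qed.

(** The mean is no farther from [c] than the average of [|u - c|], so replacing [c] by the mean
    costs at most that average once more. *)
Lemma osc_mean_le A (c : R) : measurable A -> A `<=` cube x r ->
  0 < fine (mu A) ->
  \int[mu]_(y in A) `|u y - mean A u| <= 2 * \int[mu]_(y in A) `|u y - c|.
Proof.
move=> mA Ax A0; apply: le_trans (osc_le _ c mA Ax) _.
by have := mean_dist c mA Ax A0; rewrite distrC; lra.
Qed.

Lemma le_dist_subset A B (c : R) : measurable A -> measurable B -> A `<=` B ->
  B `<=` cube x r ->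
  \int[mu]_(y in A) `|u y - c| <= \int[mu]_(y in B) `|u y - c|.
Proof.
move=> mA mB AB Bx; apply: fine_le.
- apply: integrable_fin_num => //; apply: locint_dist => //.
  exact: subset_trans Bx.
- by apply: integrable_fin_num => //; exact: locint_dist.
apply: ge0_subset_integral => //.
by have /integrableP[] := locint_dist c mB Bx.
Qed.

End local.

End cubes.

(** * Campanato's characterization of Hoelder continuity *)

Section campanato.
Context {R : realType} {d : nat}.
Local Notation Rd := 'rV[R]_d.
Local Notation mu := (@lebesgue_rV R d).
Variables (u : Rd -> R) (lu : locint u) (M alpha : R).
Hypotheses (M0 : 0 <= M) (alpha0 : 0 < alpha).
Hypothesis osc : forall x r, 0 < r ->
  \int[mu]_(y in cube x r) `|u y - mean (cube x r) u| <=
    M * r `^ alpha * (2 * r) ^+ d.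
Implicit Types (x y : Rd) (s t r : R).

(** Means over grid cells are constant on each cell, which makes them measurable at once and
    comparable at all points of a cell. The side [s] need not be dyadic. *)
Let cmean s x := mean (gcell s x) u.

Let fmu_gt0 s x : 0 < s -> 0 < fine (mu (gcell s x)).
Proof.
move=> s0; apply: lt_le_trans (fine_mu_gcell_ge x s0).
by rewrite exprn_gt0// divr_gt0.
Qed.

(** The factor is the ratio of the volume [(2 * r) ^+ d] of the cube to the lower bound
    [(s / 2) ^+ d] for the cell. *)
Let cmean_cube s x y r : 0 < s -> 0 < r -> gcell s x `<=` cube y r ->
  `|cmean s x - mean (cube y r) u| <= (4 * (r / s)) ^+ d * (M * r `^ alpha).
Proof.
move=> s0 r0 sr.
have sd0 : 0 < (s / 2) ^+ d by rewrite exprn_gt0// divr_gt0.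
rewrite -(ler_pM2l sd0); apply: (@le_trans _ _ (M * r `^ alpha * (2 * r) ^+ d)).
  apply: le_trans (osc y r0).
  apply: le_trans (le_dist_subset lu _ _ _ sr (@subset_refl _ _)); last first.
  - exact: measurable_cube.
  - exact: measurable_gcell.
  apply: le_trans (mean_dist lu _ _ sr (fmu_gt0 x s0)); last exact: measurable_gcell.
  by rewrite ler_wpM2r//; exact: fine_mu_gcell_ge.
rewrite [leRHS]mulrA -exprMn (_ : s / 2 * (4 * (r / s)) = 2 * r); first by rewrite mulrC.
by field; rewrite gt_eqF.
Qed.

Let cmean_near s t x : 0 < t -> t / 2 <= s -> s <= t ->
  `|cmean s x - cmean t x| <= 2 * 8 ^+ d * (M * t `^ alpha).
Proof.
move=> t0 ts st; have s0 : 0 < s by lra.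
have Mt : 0 <= M * t `^ alpha by rewrite mulr_ge0 ?powR_ge0.
have cs : gcell s x `<=` cube x t.
  apply: subset_trans (gcell_sub_cube s0) _; apply: cube_sub => i.
  by rewrite subrr normr0 add0r.
have ct := gcell_sub_cube (x := x) t0.
have le8 q : 0 < q -> t / 2 <= q ->
    (4 * (t / q)) ^+ d * (M * t `^ alpha) <= 8 ^+ d * (M * t `^ alpha).
  move=> q0 tq; rewrite ler_wpM2r//; apply: lerXn2r; rewrite ?nnegrE//.
    by rewrite mulr_ge0// divr_ge0 ?ltW.
  by rewrite mulrA ler_pdivrMr//; lra.
have h1 := le_trans (cmean_cube s0 t0 cs) (le8 _ s0 ts).
have h2 := le_trans (cmean_cube t0 t0 ct) (le8 _ t0 ltac:(lra)).
rewrite -(subrKA (mean (cube x t) u)); apply: le_trans (ler_normD _ _) _.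
by rewrite distrC in h2; lra.
Qed.

(** Sum of the geometric series of ratio 2^(-alpha) whose first term is the constant of
    [cmean_near]; each term accounts for one halving of the side. *)
Let L := 2 * 8 ^+ d * M / (1 - 2 `^ (- alpha)).

Let geo_gt0 : 0 < 1 - 2 `^ (- alpha) :> R.
Proof.
rewrite subr_gt0 powRN invf_lt1 ?powR_gt0//.
suff : 1 `^ alpha < 2 `^ alpha :> R by rewrite powR1.
apply: gt0_ltr_powR => //.
- by rewrite nnegrE.
- by rewrite nnegrE.
- by rewrite ltr1n.
Qed.

Let L0 : 0 <= L.
Proof. by apply: divr_ge0; [rewrite !mulr_ge0// exprn_ge0|exact: ltW]. Qed.

Let cmean_le s t x : 0 < s -> s <= t -> `|cmean s x - cmean t x| <= L * t `^ alpha.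
Proof.
move=> s0 st.
have [k hk] : exists k, t <= s * 2 ^+ k.
  exists (Num.truncn (t / s)).+1; rewrite -ler_pdivrMl// mulrC.
  apply: le_trans (ltW (truncnS_gt _)) _.
  by rewrite -natrX ler_nat ltnW// ltn_expl.
elim: k t st hk => [|k IH] t st hk.
  have -> : s = t by apply/eqP; rewrite eq_le st -[X in _ <= X]mulr1.
  by rewrite subrr normr0 mulr_ge0// powR_ge0.
have t0 : 0 < t by apply: lt_le_trans st.
(* This identity closes the induction on the number of halvings: the step from [t] to [t / 2] plus
   the bound at [t / 2] is again the bound at [t]. *)
have LE : 2 * 8 ^+ d * M + L * 2 `^ (- alpha) = L.
  by rewrite /L; field; exact: lt0r_neq0 geo_gt0.
have [ts|ts] := leP (t / 2) s.
  apply: le_trans (cmean_near x t0 ts st) _.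
  rewrite mulrA ler_wpM2r ?powR_ge0// -LE lerDl.
  by rewrite mulr_ge0// powR_ge0.
have st2 : s <= t / 2 by exact: ltW.
rewrite -(subrKA (cmean (t / 2) x)); apply: le_trans (ler_normD _ _) _.
rewrite -LE mulrDl addrC lerD//.
  rewrite -mulrA; apply: cmean_near => //; lra.
apply: le_trans (IH _ st2 _) _; first by rewrite exprSr in hk; lra.
rewrite -mulrA ler_wpM2l// powRM ?(ltW t0)// mulrC.
by rewrite -(@powR_inv1 _ 2)// -powRrM mulN1r.
Qed.

(* u' x is the limit of the means over the cells around x, obtained without
   limits as the supremum of the lower bounds that cmean_le provides. *)
Let u' x := sup [set cmean s x - L * s `^ alpha | s in [set s | 0 < s]].

(** By [cmean_le], every lower bound, taken at any side, is below every upper bound, taken at any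
    other; the supremum of the lower ones is therefore caught between the two bounds at [t]. *)
Let u'_near t x : 0 < t -> `|u' x - cmean t x| <= L * t `^ alpha.
Proof.
move=> t0.
have ub s r : 0 < s -> 0 < r ->
    cmean s x - L * s `^ alpha <= cmean r x + L * r `^ alpha.
  have pw q : 0 <= L * q `^ alpha by rewrite mulr_ge0// powR_ge0.
  move=> s0 r0; have [sr|rs] := leP s r.
    have := cmean_le x s0 sr; rewrite ler_norml => /andP[_ h].
    by have := pw s; lra.
  have := cmean_le x r0 (ltW rs); rewrite ler_norml => /andP[h _].
  by have := pw r; lra.
have hs : has_sup [set cmean s x - L * s `^ alpha | s in [set s | 0 < s]].
  split; first by exists (cmean t x - L * t `^ alpha), t.
  by exists (cmean t x + L * t `^ alpha) => _ [s /= s0 <-]; exact: ub.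
have h1 : cmean t x - L * t `^ alpha <= u' x.
  by apply: sup_upper_bound => //; exists t.
have h2 : u' x <= cmean t x + L * t `^ alpha.
  by apply: ge_sup; [case: hs|move=> _ [s /= s0 <-]; exact: ub].
by rewrite ler_norml; apply/andP; split; lra.
Qed.

(** The cells of side [t] at [x] and at [y] both lie in the cube of half side [2 * t] at [y], whose
    mean is the intermediate value. *)
Let u'_holder x y t : 0 < t -> (forall i, `|x 0 i - y 0 i| <= t) ->
  `|u' x - u' y| <= 2 * (L + 8 ^+ d * M * 2 `^ alpha) * t `^ alpha.
Proof.
move=> t0 xy.
have cx : gcell t x `<=` cube y (2 * t).
  apply: subset_trans (gcell_sub_cube t0) _; apply: cube_sub => i.
  by have := xy i; lra.
have cy : gcell t y `<=` cube y (2 * t).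
  apply: subset_trans (gcell_sub_cube t0) _; apply: cube_sub => i.
  by rewrite subrr normr0; lra.
have t20 : 0 < 2 * t by lra.
have hx := cmean_cube t0 t20 cx; have hy := cmean_cube t0 t20 cy.
have E : (4 * (2 * t / t)) ^+ d * (M * (2 * t) `^ alpha) =
    8 ^+ d * M * 2 `^ alpha * t `^ alpha.
  rewrite powRM// ?(ltW t0)// (_ : 4 * (2 * t / t) = 8) ?mulrA//.
  by field; rewrite gt_eqF.
rewrite {}E in hx hy.
have ux := u'_near x t0; have uy := u'_near y t0.
move: hx hy ux uy; rewrite !ler_norml => /andP[? ?] /andP[? ?] /andP[? ?] /andP[? ?].
by apply/andP; split; lra.
Qed.

Lemma powR_side_cvg0 : @side R n `^ alpha @[n --> \oo] --> (0 : R).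
Proof.
have -> : (fun n => @side R n `^ alpha) = (fun n => (2 `^ (- alpha)) ^+ n).
  apply/funext => n; rewrite /side -powR_invn// -powRrM.
  by rewrite -powR_mulrn ?powR_ge0// -powRrM !mulNr mulrC.
apply: cvg_expr; rewrite ger0_norm ?powR_ge0//.
by rewrite -subr_gt0.
Qed.

Let u'_meas : measurable_fun setT u'.
Proof.
apply: (measurable_fun_cvg (h := fun n x => cmean (@side R n) x)).
  move=> n; have -> : cmean (@side R n) = fun x =>
      mean (gidx (@side R n) @^-1` [set gidx (@side R n) x]) u by [].
  exact: (measurable_fun_level (@side R n) (fun j =>
    mean (gidx (@side R n) @^-1` [set j]) u)).
move=> x _; apply/cvgrPdist_le => e e0.
have : L * @side R n `^ alpha @[n --> \oo] --> L * 0.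
  by apply: cvgM; [exact: cvg_cst|exact: powR_side_cvg0].
rewrite mulr0 => /cvgrPdist_le /(_ _ e0); apply: filterS => n.
rewrite sub0r normrN ger0_norm; last by rewrite mulr_ge0// powR_ge0.
by apply: le_trans; apply: u'_near; exact: side_gt0.
Qed.

Let mdist : measurable_fun setT (fun x => `|u x - u' x|%:E).
Proof.
apply/measurable_EFinP; apply: measurableT_comp => //.
by apply: measurable_funB => //; exact: lu.1.
Qed.

Let dist0 x : (0 <= `|u x - u' x|%:E)%E. Proof. by rewrite lee_fin. Qed.

(** That [u] and [u'] agree almost everywhere will follow from the vanishing of this measure on unit
    cells. *)
Let nu : {measure set Rd -> \bar R} := density mu mdist dist0.

Let nu_cell s x : 0 < s -> (nu (gcell s x) <=
  ((2 * 4 ^+ d * M + L) * s `^ alpha)%:E * mu (gcell s x))%E.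
Proof.
move=> s0; set P := gcell s x.
have mP : measurable P := measurable_gcell s x.
have PQ : P `<=` cube x s := gcell_sub_cube s0.
have int1 : mu.-integrable P (EFin \o (fun y => `|u y - cmean s x|)).
  exact: locint_dist lu _ _ _ _ mP PQ.
have int2 := cst_int (L * s `^ alpha) mP PQ.
have int3 := integrableD mP int1 int2.
apply: (@le_trans _ _ (\int[mu]_(y in P) (`|u y - cmean s x| + L * s `^ alpha)%:E)%E).
  apply: ge0_le_integral => //.
  - exact: measurable_funTS.
  - by have /integrableP[] := int3.
  - move=> y Py; rewrite lee_fin -(subrKA (cmean s x)).
    apply: le_trans (ler_normD _ _) _; rewrite lerD2l distrC.
    (* Since [x] and [y] share a cell, [u'_near] at [y] compares [u' y] with the mean attached to
       [x]. *)
    have -> : cmean s x = cmean s y by rewrite /cmean (gcellE Py).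
    exact: u'_near.
have -> : (\int[mu]_(y in P) (`|u y - cmean s x| + L * s `^ alpha)%:E)%E =
    (\int[mu]_(y in P) (`|u y - cmean s x| + L * s `^ alpha)%R)%:E.
  by rewrite fineK//; exact: integrable_fin_num int3.
rewrite RintegralD// Rintegral_cst// /P mu_gcell_fin// -EFinM lee_fin.
rewrite mulrDl [X in _ <= X]mulrDl lerD2r.
have Q0 : 0 < fine (mu P) := fmu_gt0 x s0.
apply: le_trans (osc_mean_le lu (mean (cube x s) u) mP PQ Q0) _.
rewrite -!mulrA ler_pM2l//.
apply: le_trans (le_dist_subset lu (mean (cube x s) u) mP _ PQ (@subset_refl _ _)) _.
  exact: measurable_cube.
apply: le_trans (osc _ s0) _.
have -> : M * s `^ alpha * (2 * s) ^+ d = 4 ^+ d * (M * (s `^ alpha * (s / 2) ^+ d)).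
  rewrite (_ : 2 * s = 4 * (s / 2)); last by lra.
  by rewrite exprMn; ring.
rewrite ler_pM2l ?exprn_gt0// ler_wpM2l// ler_wpM2l ?powR_ge0//.
exact: fine_mu_gcell_ge.
Qed.

(** The unit cell is a union of cells of side [2 ^- n], on each of which [nu_cell] bounds [nu] by a
    small multiple of [mu]; the multiple tends to 0 with the side. *)
Let nu0 x : nu (gcell 1 x) = 0%E.
Proof.
apply/eqP; rewrite eq_le measure_ge0 andbT.
have le n : (nu (gcell 1 x) <= ((2 * 4 ^+ d * M + L) * @side R n `^ alpha
    * fine (mu (gcell 1 x)))%:E)%E.
  have K0 : 0 <= (2 * 4 ^+ d * M + L) * @side R n `^ alpha.
    by rewrite mulr_ge0 ?powR_ge0// addr_ge0// mulr_ge0// mulr_ge0// exprn_ge0.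
  have [h hE] := @gidx_refine R d 0 n.
  have E : gcell 1 x = gidx (@side R n) @^-1` (h @^-1` [set gidx 1 x]).
    have E1 y : gidx 1 y = h (gidx (@side R n) y).
      by rewrite -hE /side expr0 invr1.
    by apply/seteqP; split => y; rewrite /gcell /= !E1.
  rewrite EFinM -mu_gcell_fin// E.
  apply: (@le_measure_level _ _ nu (mscale (NngNum K0) mu)) => y.
  exact: nu_cell (side_gt0 n).
suff : (nu (gcell 1 x) <= 0%:E)%E by [].
have cv : ((2 * 4 ^+ d * M + L) * @side R n `^ alpha
    * fine (mu (gcell 1 x))) @[n --> \oo] --> (0 : R).
  rewrite -(mul0r (fine (mu (gcell 1 x)))) -(mulr0 (2 * 4 ^+ d * M + L)).
  apply: cvgM; last exact: cvg_cst.
  by apply: cvgM; [exact: cvg_cst|exact: powR_side_cvg0].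
have cvE : ((2 * 4 ^+ d * M + L) * @side R n `^ alpha
    * fine (mu (gcell 1 x)))%:E @[n --> \oo] --> 0%:E.
  by apply: cvg_EFin => //; exact: nearW.
rewrite -(cvg_lim _ cvE)//; apply: lime_ge; first by apply/cvg_ex; exists 0%:E.
exact: nearW.
Qed.

Lemma campanato_ex : exists u'' : Rd -> R, u = u'' %[ae mu] /\
  forall x y t, 0 < t -> (forall i, `|x 0 i - y 0 i| <= t) ->
  `|u'' x - u'' y| <= (2 * (2 * 8 ^+ d / (1 - 2 `^ (- alpha)) + 8 ^+ d * 2 `^ alpha))
     * M * t `^ alpha.
Proof.
exists u'; split; last first.
  move=> x y t t0 xy; apply: le_trans (u'_holder t0 xy) _.
  by rewrite le_eqVlt; apply/orP; left; apply/eqP; rewrite /L; ring.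
pose N := [set x | u x != u' x].
have mN : measurable N.
  rewrite (_ : N = (fun x => `|u x - u' x|) @^-1` `]0, +oo[).
    rewrite -[X in measurable X]setTI.
    by apply: measurableT_comp => //; apply: measurable_funB u'_meas => //; exact: lu.1.
  by apply/seteqP; split => x /=; rewrite in_itv/= andbT normr_gt0 subr_eq0.
exists N; split => //; last by move=> x /= /not_implyP[_ /eqP].
(* Comparison with the zero measure on the unit grid: it is enough that [N] meets each unit cell in
   a null set. *)
have := @le_measure_level _ _ (mrestr mu mN) mzero 1 _ setT.
rewrite /= /mrestr preimage_setT setTI => H.
apply/eqP; rewrite eq_le measure_ge0 andbT; apply: H => x.
have nu0x : (\int[mu]_(y in gcell 1 x) `|(u y - u' y)%:E|)%E = 0%E.
  exact: nu0 x.
have mP := measurable_gcell (1 : R) x.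
have mP' : measurable (gcell 1 x `&` N) by exact: measurableI.
rewrite le_eqVlt; apply/orP; left; apply/eqP.
apply: (measure_negligible mP').
move/ae_eq_integral_abs : nu0x => /(_ mP) H0.
have [|Z [mZ Z0 ZP]] := H0.
  apply/measurable_EFinP/measurable_funTS.
  by apply: measurable_funB u'_meas; exact: lu.1.
exists Z; split => // y [Py /= Ny]; apply: ZP => /= /(_ Py)[] /eqP.
by rewrite subr_eq0; exact/negP.
Qed.

End campanato.

(** * The commutator on products of test functions *)

Section normc_bounds.
Context {R : realType}.
Implicit Types z : R[i].

Lemma normc_le z : normc z <= `|Re z| + `|Im z|.
Proof.
case: z => a b /=; rewrite -(@ger0_norm _ (`|a| + `|b|)) ?addr_ge0//.
rewrite -sqrtr_sqr ler_wsqrtr// sqrrD !real_normK ?num_real//.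
by rewrite [leRHS]addrAC lerDl mulrn_wge0// mulr_ge0.
Qed.

Lemma Re_le_normc z : `|Re z| <= normc z.
Proof.
by case: z => a b /=; rewrite -sqrtr_sqr ler_wsqrtr// lerDl sqr_ge0.
Qed.

Lemma Im_le_normc z : `|Im z| <= normc z.
Proof.
by case: z => a b /=; rewrite -sqrtr_sqr ler_wsqrtr// lerDr sqr_ge0.
Qed.

Lemma normc_ge0 z : 0 <= normc z.
Proof. by case: z => a b; exact: sqrtr_ge0. Qed.

End normc_bounds.

Section product_integral.
Context {d1 d2 : measure_display} {T1 : measurableType d1}
  {T2 : measurableType d2} {R : realType}.
Variables (m1 : {sigma_finite_measure set T1 -> \bar R})
  (m2 : {sigma_finite_measure set T2 -> \bar R}).
Variables (phi : T1 -> R) (psi : T2 -> R).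
Hypotheses (iphi : m1.-integrable setT (EFin \o phi))
  (ipsi : m2.-integrable setT (EFin \o psi)).

Lemma integrable_prodM : (m1 \x m2)%E.-integrable setT
  (EFin \o (fun z => phi z.1 * psi z.2)).
Proof.
have /integrableP[/measurable_EFinP mphi fphi] := iphi.
have /integrableP[/measurable_EFinP mpsi fpsi] := ipsi.
apply/integrable12ltyP.
  apply/measurable_EFinP; apply: measurable_funM.
    exact: measurableT_comp mphi measurable_fst.
  exact: measurableT_comp mpsi measurable_snd.
under eq_integral => x _.
  under eq_integral do rewrite /= normrM EFinM.
  rewrite ge0_integralZl//; last exact/measurable_EFinP/measurableT_comp.
  over.
rewrite /= ge0_integralZr//.
- by rewrite lte_mul_pinfty//; [exact: integral_ge0|
    rewrite ge0_fin_numE//; exact: integral_ge0].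
- exact/measurable_EFinP/measurableT_comp.
- exact: integral_ge0.
Qed.

Lemma Rintegral_prodM : \int[(m1 \x m2)%E]_z (phi z.1 * psi z.2) =
  (\int[m1]_x phi x) * (\int[m2]_y psi y).
Proof.
rewrite -RintegralZr// {1}/Rintegral -(integral12_prod_meas1 integrable_prodM).
congr fine; apply: eq_integral => x _.
rewrite -RintegralZl// [RHS]fineK//; apply: integrable_fin_num => //.
exact: (integrableZl measurableT (phi x) ipsi).
Qed.

End product_integral.

Section ae_product.
Context {d1 d2 : measure_display} {T1 : measurableType d1}
  {T2 : measurableType d2} {R : realType}.
Variables (m1 : {sigma_finite_measure set T1 -> \bar R})
  (m2 : {sigma_finite_measure set T2 -> \bar R}).

(** The cylinder over a null set is null even if the other factor has infinite measure, the product
    of 0 and infinity being 0. *)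
Lemma ae_fst (P : T1 -> Prop) : {ae m1, forall x, P x} ->
  {ae (m1 \x m2)%E, forall z, P z.1}.
Proof.
move=> [N [mN N0 sN]]; exists (N `*` setT); split; first exact: measurableX.
  apply: etrans (product_measure1E _ _ mN measurableT) _.
  transitivity (0 * m2 setT)%E; [congr (_ * _)%E; exact: N0|exact: mul0e].
by move=> z /= nP; split => //; exact: sN.
Qed.

Lemma ae_snd (P : T2 -> Prop) : {ae m2, forall x, P x} ->
  {ae (m1 \x m2)%E, forall z, P z.2}.
Proof.
move=> [N [mN N0 sN]]; exists (setT `*` N); split; first exact: measurableX.
  apply: etrans (product_measure1E _ _ measurableT mN) _.
  transitivity (m1 setT * 0)%E; [congr (_ * _)%E; exact: N0|exact: mule0].
by move=> z /= nP; split => //; exact: sN.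
Qed.

End ae_product.

Section commutator_estimate.
Context {R : realType} {d : nat}.
Local Notation Rd := 'rV[R]_d.
Local Notation mu := (@lebesgue_rV R d).
Local Notation mu2 := (mu \x mu)%E.

Lemma locint_test (u g : Rd -> R) x r : locint u -> measurable_fun setT g ->
  (forall y, `|g y| <= \1_(cube x r) y) ->
  mu.-integrable setT (EFin \o (fun y => u y * g y)).
Proof.
move=> lu mg g1.
have mQ := measurable_cube x r.
have iu := (integrable_mkcond (EFin \o u) mQ).1 (lu.2 x r).
apply: le_integrable iu => //.
  by apply/measurable_EFinP/measurable_funM => //; exact: lu.1.
move=> y _ /=; rewrite normrM patchE.
have := g1 y; rewrite indicE; case: ifPn => yQ /= g1y; rewrite lee_fin.
  by rewrite ler_piMr.
by rewrite normr0 (le_trans (ler_wpM2l _ g1y))// mulr0.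
Qed.

Variables (b : Rd -> R[i]) (K : Rd -> Rd -> R[i]) (p q : Rd -> R).
Hypotheses (lp : locint p) (lq : locint q).
Hypothesis bE : b = (fun x => Complex (p x) (q x)) %[ae mu].
Variables (x0 y0 : Rd) (r : R).
Let Q := cube y0 r.
Let Q' := cube x0 r.
Variables (G1 G2 : Rd * Rd -> R) (K0 : R[i]) (e : R).
Hypotheses (mG1 : measurable_fun setT G1) (mG2 : measurable_fun setT G2).
Hypothesis GE : {ae mu2, forall z, Q' z.1 -> Q z.2 ->
  K z.1 z.2 = Complex (G1 z) (G2 z)}.
Let N z := `|G1 z - Re K0| + `|G2 z - Im K0|.
Hypothesis e0 : 0 <= e.
Hypothesis Nx : forall x, Q' x -> (\int[mu]_(y in Q) (N (x, y))%:E <= e%:E)%E.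
Hypothesis Ny : forall y, Q y -> (\int[mu]_(x in Q') (N (x, y))%:E <= e%:E)%E.
Variables (a1 a2 : R).
Let w x := `|p x - a1| + `|q x - a2|.

Let mQ : measurable Q. Proof. exact: measurable_cube. Qed.
Let mQ' : measurable Q'. Proof. exact: measurable_cube. Qed.

Let mw : measurable_fun setT w.
Proof.
apply: measurable_funD; apply: measurableT_comp => //;
  by apply: measurable_funB => //; [exact: lp.1 || exact: lq.1].
Qed.

Let mN : measurable_fun setT N.
Proof.
by apply: measurable_funD; apply: measurableT_comp => //; apply: measurable_funB.
Qed.

Let w0 x : 0 <= w x. Proof. by rewrite addr_ge0. Qed.
Let N0 z : 0 <= N z. Proof. by rewrite addr_ge0. Qed.

Let iw x r' : mu.-integrable (cube x r') (EFin \o w).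
Proof.
have mc := measurable_cube x r'.
exact: (integrableD mc (locint_dist lp a1 mc (@subset_refl _ _))
  (locint_dist lq a2 mc (@subset_refl _ _))).
Qed.

Let H z := \1_Q' z.1 * \1_Q z.2 * (N z * (w z.1 + w z.2)).

Let mind1 : measurable_fun setT (fun z : Rd * Rd => \1_Q' z.1 : R).
Proof. exact: (measurableT_comp (measurable_indic mQ') measurable_fst). Qed.
Let mind2 : measurable_fun setT (fun z : Rd * Rd => \1_Q z.2 : R).
Proof. exact: (measurableT_comp (measurable_indic mQ) measurable_snd). Qed.

(** The error is split so that the weight [w] depends on one variable only; the kernel error is then
    integrated over the other variable first. [H1] calls for the slice bound [Nx], [H2] for [Ny]. *)
Let H1 z := (\1_Q' z.1 * w z.1) * (\1_Q z.2 * N z).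
Let H2 z := (\1_Q z.2 * w z.2) * (\1_Q' z.1 * N z).

Let mH1 : measurable_fun setT H1.
Proof.
apply: measurable_funM; apply: measurable_funM => //.
exact: (measurableT_comp mw measurable_fst).
Qed.

Let mH2 : measurable_fun setT H2.
Proof.
apply: measurable_funM; apply: measurable_funM => //.
exact: (measurableT_comp mw measurable_snd).
Qed.

Let HE z : H z = H1 z + H2 z. Proof. by rewrite /H /H1 /H2; ring. Qed.
Let H10 z : 0 <= H1 z. Proof. by rewrite !mulr_ge0. Qed.
Let H20 z : 0 <= H2 z. Proof. by rewrite !mulr_ge0. Qed.

Let int_indic A (h : Rd -> R) : measurable A ->
  (\int[mu]_x (\1_A x * h x)%:E = \int[mu]_(x in A) (h x)%:E)%E.
Proof.
move=> mA; rewrite [RHS]integral_mkcond; apply: eq_integral => x _.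
by rewrite patchE indicE; case: ifP => _ /=; rewrite ?mul1r ?mul0r.
Qed.

Let intw A x r' : A = cube x r' ->
  (\int[mu]_(x in A) (w x)%:E = (\int[mu]_(x in A) w x)%:E)%E.
Proof.
move=> ->; rewrite fineK//; apply: integrable_fin_num (iw _ _).
exact: measurable_cube.
Qed.

Let intH1 : (\int[mu2]_z (H1 z)%:E <= (e * \int[mu]_(x in Q') w x)%:E)%E.
Proof.
rewrite fubini_tonelli1//; last exact/measurable_EFinP.
rewrite EFinM -(@intw _ x0 r)// -ge0_integralZl//; last 2 first.
  by apply/measurable_EFinP/measurable_funTS.
  by move=> x _; rewrite lee_fin.
rewrite /fubini_F -[leRHS](@int_indic _ (fun x => e * w x))//.
apply: ge0_le_integral => //.
- by move=> x _; apply: integral_ge0 => y _; rewrite lee_fin.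
- have mf : measurable_fun setT (EFin \o H1) by exact/measurable_EFinP.
  by apply: (measurable_fun_fubini_tonelli_F (EFin \o H1) mf) => z; exact: H10.
- apply/measurable_EFinP/measurable_funM; first exact: measurable_indic.
  exact: measurable_funM.
move=> x _; rewrite /H1 /=; under eq_integral do rewrite EFinM.
rewrite ge0_integralZl//; last 3 first.
- apply/measurable_EFinP/measurable_funM; first exact: measurable_indic.
  exact: (measurableT_comp mN (pair1_measurable x)).
- by move=> y _; rewrite lee_fin mulr_ge0.
- by rewrite lee_fin mulr_ge0.
rewrite int_indic// indicE; have [/set_mem xQ|_] := boolP (x \in Q').
  rewrite !mul1r (mulrC e) EFinM lee_wpmul2l ?lee_fin//; exact: Nx.
by rewrite !mul0r mul0e.
Qed.

Let intH2 : (\int[mu2]_z (H2 z)%:E <= (e * \int[mu]_(y in Q) w y)%:E)%E.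
Proof.
rewrite fubini_tonelli2//; last exact/measurable_EFinP.
rewrite EFinM -(@intw _ y0 r)// -ge0_integralZl//; last 2 first.
  by apply/measurable_EFinP/measurable_funTS.
  by move=> x _; rewrite lee_fin.
rewrite /fubini_G -[leRHS](@int_indic _ (fun x => e * w x))//.
apply: ge0_le_integral => //.
- by move=> x _; apply: integral_ge0 => y _; rewrite lee_fin.
- have mf : measurable_fun setT (EFin \o H2) by exact/measurable_EFinP.
  by apply: (measurable_fun_fubini_tonelli_G (EFin \o H2) mf) => z; exact: H20.
- apply/measurable_EFinP/measurable_funM; first exact: measurable_indic.
  exact: measurable_funM.
move=> y _; rewrite /H2 /=; under eq_integral do rewrite EFinM.
rewrite ge0_integralZl//; last 3 first.
- apply/measurable_EFinP/measurable_funM; first exact: measurable_indic.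
  exact: (measurableT_comp mN (pair2_measurable y)).
- by move=> x _; rewrite lee_fin mulr_ge0.
- by rewrite lee_fin mulr_ge0.
rewrite int_indic// indicE; have [/set_mem yQ|_] := boolP (y \in Q).
  rewrite !mul1r (mulrC e) EFinM lee_wpmul2l ?lee_fin//; exact: Ny.
by rewrite !mul0r mul0e.
Qed.

Let Hbound := e * (\int[mu]_(x in Q') w x + \int[mu]_(y in Q) w y).

Let intH : (\int[mu2]_z (H z)%:E <= Hbound%:E)%E.
Proof.
under eq_integral do rewrite HE EFinD.
rewrite ge0_integralD//; last 4 first.
- by move=> z _; rewrite lee_fin.
- exact/measurable_EFinP.
- by move=> z _; rewrite lee_fin.
- exact/measurable_EFinP.
by rewrite /Hbound mulrDr EFinD leeD.
Qed.

Let iH : mu2.-integrable setT (EFin \o H).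
Proof.
apply/integrableP; split.
  apply/measurable_EFinP; rewrite (_ : H = H1 \+ H2); last exact/funext.
  exact: measurable_funD.
apply: le_lt_trans (ltry Hbound); apply: le_trans intH.
rewrite le_eqVlt; apply/orP; left; apply/eqP; apply: eq_integral => z _ /=.
by rewrite ger0_norm// HE addr_ge0.
Qed.

(** As [f] and [g] are real, the main term is [K0] times the complex number whose parts are the
    integrals for [p] and [q], and its modulus dominates each part. Each of the two parts of the
    error is at most [Hbound], hence the factor 2. *)
Lemma commutator_test (f g : Rd -> R) (Theta : R) (u : Rd -> R) :
  measurable_fun setT f -> measurable_fun setT g ->
  (forall y, `|f y| <= \1_Q y) -> (forall x, `|g x| <= \1_Q' x) ->
  normc (commutator_form b K (fun y => Complex (f y) 0) (fun x => Complex (g x) 0))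
    <= Theta ->
  u = p \/ u = q ->
  normc K0 * `|(\int[mu]_x (u x * g x)) * (\int[mu]_y f y) -
               (\int[mu]_y (u y * f y)) * (\int[mu]_x g x)|
  <= Theta + 2 * Hbound.
Proof.
move=> mf mg f1 g1 hT hu.
have one_li : locint (cst 1 : Rd -> R).
  split => // x r'; apply: (cst_int _ _ (@subset_refl _ _)).
  exact: measurable_cube.
have iF : mu.-integrable setT (EFin \o f).
  have := locint_test one_li mf f1.
  by apply: eq_integrable => // x _ /=; rewrite mul1r.
have iG : mu.-integrable setT (EFin \o g).
  have := locint_test one_li mg g1.
  by apply: eq_integrable => // x _ /=; rewrite mul1r.
pose W (v : Rd -> R) z := (v z.1 - v z.2) * f z.2 * g z.1.
have Wint v : locint v -> mu2.-integrable setT (EFin \o W v) /\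
   \int[mu2]_z W v z = (\int[mu]_x (v x * g x)) * (\int[mu]_y f y) -
               (\int[mu]_y (v y * f y)) * (\int[mu]_x g x).
  move=> lv; have i1 := locint_test lv mg g1; have i2 := locint_test lv mf f1.
  have j1 := integrable_prodM i1 iF; have j2 := integrable_prodM iG i2.
  have WE z : W v z = v z.1 * g z.1 * f z.2 - g z.1 * (v z.2 * f z.2).
    by rewrite /W; ring.
  split.
    have := integrableB measurableT j1 j2.
    by apply: eq_integrable => // z _ /=; rewrite WE EFinB.
  under eq_Rintegral do rewrite WE.
  rewrite RintegralB//; congr (_ - _); first exact: Rintegral_prodM i1 iF.
  by rewrite mulrC; exact: Rintegral_prodM iG i2.
have [iWp Wp] := Wint _ lp; have [iWq Wq] := Wint _ lq.
have Wsum z : `|W p z| + `|W q z| <= \1_Q' z.1 * \1_Q z.2 * (w z.1 + w z.2).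
  have h1 : `|p z.1 - p z.2| + `|q z.1 - q z.2| <= w z.1 + w z.2.
    rewrite /w addrACA lerD//.
      by rewrite -(subrKA a1) (distrC (p z.2)); exact: ler_normD.
    by rewrite -(subrKA a2) (distrC (q z.2)); exact: ler_normD.
  rewrite /W !normrM -!mulrDl -mulrA mulrC.
  apply: ler_pM; rewrite ?mulr_ge0 ?addr_ge0//.
  by rewrite mulrC; apply: ler_pM.
pose D1 z := G1 z - Re K0; pose D2 z := G2 z - Im K0.
have D1N z : `|D1 z| <= N z by rewrite lerDl.
have D2N z : `|D2 z| <= N z by rewrite lerDr.
have mW v : locint v -> measurable_fun setT (W v).
  by move=> /Wint[/integrableP[/measurable_EFinP]].
have mD1 : measurable_fun setT D1 by exact: measurable_funB.
have mD2 : measurable_fun setT D2 by exact: measurable_funB.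
have WDle (s t : R) z : `|s| <= N z -> `|t| <= N z ->
    `|W p z * s + W q z * t| <= H z.
  move=> h1 h2; apply: le_trans (ler_normD _ _) _.
  rewrite (normrM (W p z)) (normrM (W q z)).
  apply: (@le_trans _ _ ((`|W p z| + `|W q z|) * N z)).
    by rewrite [leRHS]mulrDl; apply: lerD; apply: ler_wpM2l.
  have -> : H z = \1_Q' z.1 * \1_Q z.2 * (w z.1 + w z.2) * N z.
    by rewrite /H; ring.
  exact: ler_wpM2r.
have errP (S T : Rd * Rd -> R) : measurable_fun setT S -> measurable_fun setT T ->
    (forall z, `|S z| <= N z) -> (forall z, `|T z| <= N z) ->
    mu2.-integrable setT (EFin \o (fun z => W p z * S z + W q z * T z)) /\
    `|\int[mu2]_z (W p z * S z + W q z * T z)| <= Hbound.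
  move=> mS mT SN TN.
  have iST : mu2.-integrable setT (EFin \o (fun z => W p z * S z + W q z * T z)).
    apply: le_integrable iH => //.
      by apply/measurable_EFinP/measurable_funD; apply: measurable_funM => //;
        exact: mW.
    move=> z _ /=; rewrite lee_fin; apply: le_trans (ler_norm (H z)).
    exact: WDle.
  split => //; apply: le_trans (le_normr_Rintegral _ iST) _ => //.
  rewrite -lee_fin; apply: le_trans intH.
  rewrite -[leRHS]fineK; last exact: (integrable_fin_num measurableT iH).
  rewrite lee_fin; apply: le_Rintegral => //; first exact: integrable_norm.
  by move=> z _; exact: WDle.
have mD2N : measurable_fun setT (\- D2) by exact: measurableT_comp.
have D2NN z : `|(\- D2) z| <= N z by rewrite normrN.
have [iE1 hE1] := errP D1 (\- D2) mD1 mD2N D1N D2NN.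
have [iE2 hE2] := errP D2 D1 mD2 mD1 D2N D1N.
set I1 := \int[mu2]_z W p z in Wp; set I2 := \int[mu2]_z W q z in Wq.
set E1 := Rintegral _ _ _ in hE1; set E2 := Rintegral _ _ _ in hE2.
have CE : commutator_form b K (fun y => Complex (f y) 0) (fun x => Complex (g x) 0)
    = K0 * Complex I1 I2 + Complex E1 E2.
  have FE : (fun z => (b z.1 - b z.2) * K z.1 z.2 * Complex (f z.2) 0 *
      Complex (g z.1) 0) = (fun z => Complex (W p z) (W q z) *
        (K0 + Complex (D1 z) (D2 z))) %[ae mu2].
    have b1 := @ae_fst _ _ _ _ _ mu mu _ bE.
    have b2 := @ae_snd _ _ _ _ _ mu mu _ bE.
    apply: filterS3 b1 b2 GE => z hb1 hb2 hG _.
    rewrite hb1// hb2//.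
    have KE : K0 + Complex (D1 z) (D2 z) = Complex (G1 z) (G2 z).
      by rewrite /D1 /D2; case: K0 => k1 k2; apply/eqP; rewrite eq_complex /=
        [k1 + _]addrC [k2 + _]addrC !subrK !eqxx.
    (* Outside [Q'] times [Q] nothing is known of [K], but there [g] or [f] vanishes and both sides
       are 0. *)
    have [zQ'|zQ'] := pselect (Q' z.1); last first.
      have g0 : g z.1 = 0.
        by apply/eqP; rewrite -normr_le0; have := g1 z.1; rewrite indicE memNset.
      case: (K _ _) => s t; apply/eqP; rewrite eq_complex /W g0 /D1 /D2.
      case: K0 => k1 k2 /=.
      by apply/andP; split; apply/eqP; ring.
    have [zQ|zQ] := pselect (Q z.2); last first.
      have f0 : f z.2 = 0.
        by apply/eqP; rewrite -normr_le0; have := f1 z.2; rewrite indicE memNset.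
      case: (K _ _) => s t; apply/eqP; rewrite eq_complex /W f0 /D1 /D2.
      case: K0 => k1 k2 /=.
      by apply/andP; split; apply/eqP; ring.
    rewrite KE hG//; apply/eqP; rewrite eq_complex /W /=.
    by apply/andP; split; apply/eqP; ring.
  have ReE z : Re (Complex (W p z) (W q z) * (K0 + Complex (D1 z) (D2 z))) =
      (Re K0 * W p z - Im K0 * W q z) + (W p z * D1 z + W q z * (\- D2) z).
    by rewrite /D1 /D2; case: K0 => k1 k2 /=; ring.
  have ImE z : Im (Complex (W p z) (W q z) * (K0 + Complex (D1 z) (D2 z))) =
      (Im K0 * W p z + Re K0 * W q z) + (W p z * D2 z + W q z * D1 z).
    by rewrite /D1 /D2; case: K0 => k1 k2 /=; ring.
  have iZ v c : locint v -> mu2.-integrable setT (EFin \o (fun z => c * W v z)).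
    by move=> /Wint[iv _]; exact: (integrableZl measurableT c iv).
  have iB := integrableB measurableT (iZ _ (Re K0) lp) (iZ _ (Im K0) lq).
  have iD := integrableD measurableT (iZ _ (Im K0) lp) (iZ _ (Re K0) lq).
  rewrite /commutator_form /cintegral.
  rewrite (ae_eq_Rintegral (g := fun z =>
    (Re K0 * W p z - Im K0 * W q z) + (W p z * D1 z + W q z * (\- D2) z))); last first.
    by apply: filterS FE => z /(_ I) E _; rewrite -ReE -E.
  rewrite [X in Complex _ X](ae_eq_Rintegral (g := fun z =>
    (Im K0 * W p z + Re K0 * W q z) + (W p z * D2 z + W q z * D1 z))); last first.
    by apply: filterS FE => z /(_ I) E _; rewrite -ImE -E.
  rewrite (RintegralD measurableT iB iE1) (RintegralD measurableT iD iE2).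
  rewrite (RintegralB measurableT (iZ _ _ lp) (iZ _ _ lq)).
  rewrite (RintegralD measurableT (iZ _ _ lp) (iZ _ _ lq)).
  rewrite !(RintegralZl _ measurableT iWp) !(RintegralZl _ measurableT iWq).
  case: (K0) => k1 k2; apply/eqP; rewrite eq_complex /= -/I1 -/I2 -/E1 -/E2.
  by apply/andP; split; apply/eqP; ring.
have hI : normc K0 * normc (Complex I1 I2) <= Theta + 2 * Hbound.
  rewrite -Normc.normcM -(addrK (Complex E1 E2) (K0 * _)) -CE.
  apply: le_trans (le_normcD _ _) _; rewrite normcN lerD//.
  by apply: le_trans (normc_le _) _; rewrite mulr2n mulrDl mul1r lerD.
apply: le_trans hI; rewrite ler_wpM2l ?normc_ge0//.
case: hu => ->; rewrite -?Wp -?Wq; first exact: (Re_le_normc (Complex I1 I2)).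
exact: (Im_le_normc (Complex I1 I2)).
Qed.

End commutator_estimate.

(** * Sign tests and absorption of the kernel error *)

Section absorption.
Context {R : realType} {d : nat}.
Local Notation Rd := 'rV[R]_d.
Local Notation mu := (@lebesgue_rV R d).
Implicit Types (u : Rd -> R) (x y : Rd).

Definition sign_test (A : set Rd) u (c : R) : Rd -> R :=
  fun y => \1_A y * (if c <= u y then 1 else -1).

Lemma measurable_sign_test A u c : measurable A -> measurable_fun setT u ->
  measurable_fun setT (sign_test A u c).
Proof.
move=> mA mu_; apply: measurable_funM; first exact: measurable_indic.
by apply: measurable_fun_ifT => //; exact: measurable_fun_ler.
Qed.

Lemma sign_test_le A u c y : `|sign_test A u c y| <= \1_A y.
Proof.
rewrite /sign_test normrM ger0_norm//.
by case: ifP => _; rewrite ?normrN normr1 mulr1.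
Qed.

Lemma Rintegral_indicM A (h : Rd -> R) :
  \int[mu]_x (\1_A x * h x) = \int[mu]_(x in A) h x.
Proof.
rewrite [RHS]Rintegral_mkcond; apply: eq_Rintegral => x _.
by rewrite patchE indicE; case: ifP => _ /=; rewrite ?mul1r ?mul0r.
Qed.

Lemma sign_test_int x r u (c : R) : locint u ->
  \int[mu]_y (u y * sign_test (cube x r) u c y) -
    c * \int[mu]_y (sign_test (cube x r) u c y) =
  \int[mu]_(y in cube x r) `|u y - c|.
Proof.
move=> lu; set A := cube x r; have mA : measurable A := measurable_cube x r.
have mt := measurable_sign_test c mA lu.1.
have one_li : locint (cst 1 : Rd -> R).
  split => // z r'; apply: (cst_int _ _ (@subset_refl _ _)).
  exact: measurable_cube.
have i1 := locint_test lu mt (sign_test_le A u c).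
have i2 : mu.-integrable setT (EFin \o sign_test A u c).
  have := locint_test one_li mt (sign_test_le A u c).
  by apply: eq_integrable => // z _ /=; rewrite mul1r.
have i3 : mu.-integrable setT (EFin \o (fun y => c * sign_test A u c y)).
  exact: (integrableZl measurableT c i2).
rewrite -RintegralZl// -RintegralB// -[RHS]Rintegral_indicM.
apply: eq_Rintegral => y _; rewrite -mulrBl /sign_test mulrCA; congr (_ * _).
case: leP => cu; first by rewrite mulr1 ger0_norm ?subr_ge0.
by rewrite mulrN1 ltr0_norm ?subr_lt0.
Qed.

(** Four inequalities, for [p] and [q] on both cubes, are added. Each cross oscillation then carries
    on the right the coefficient 2/12 from its own cube and 4/12 from the other, that is 1/2 in all.
    The sum of the four, times [k * V], is thus at most [8 * Theta], and a last factor 2 passes to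
    the oscillation about the mean over the cube itself. *)
Lemma osc_absorb (p q : Rd -> R) x0 y0 r (k Theta : R) :
  0 < r -> 0 < k -> locint p -> locint q ->
  let V := (2 * r) ^+ d in
  (forall (f g u : Rd -> R) (a1 a2 : R),
    measurable_fun setT f -> measurable_fun setT g ->
    (forall y, `|f y| <= \1_(cube y0 r) y) ->
    (forall x, `|g x| <= \1_(cube x0 r) x) ->
    u = p \/ u = q ->
    k * `|(\int[mu]_x (u x * g x)) * (\int[mu]_y f y) -
          (\int[mu]_y (u y * f y)) * (\int[mu]_x g x)| <=
    Theta + 2 * (k * V / 24 *
      (\int[mu]_(x in cube x0 r) (`|p x - a1| + `|q x - a2|) +
       \int[mu]_(x in cube y0 r) (`|p x - a1| + `|q x - a2|)))) ->
  forall u, u = p \/ u = q ->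
  k * V * \int[mu]_(y in cube y0 r) `|u y - mean (cube y0 r) u| <= 16 * Theta.
Proof.
move=> r0 k0 lp lq V H u hu.
set Q := cube y0 r; set Q' := cube x0 r.
have mQ : measurable Q := measurable_cube y0 r.
have mQ' : measurable Q' := measurable_cube x0 r.
have V0 : 0 < V by rewrite exprn_gt0// mulr_gt0.
have VQ : fine (mu Q) = V by rewrite mu_cube ?ltW.
have VQ' : fine (mu Q') = V by rewrite mu_cube ?ltW.
have meanE x v : fine (mu (cube x r)) = V ->
    \int[mu]_(y in cube x r) v y = V * mean (cube x r) v.
  by move=> E; rewrite /mean E mulrA divff ?mul1r// gt_eqF.
have indE x v : fine (mu (cube x r)) = V ->
    \int[mu]_y (v y * \1_(cube x r) y) = V * mean (cube x r) v.
  move=> E; rewrite -meanE// -[RHS]Rintegral_indicM.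
  by apply: eq_Rintegral => y _; rewrite mulrC.
have int1 x : fine (mu (cube x r)) = V -> \int[mu]_y (\1_(cube x r) y) = V.
  move=> E; transitivity (\int[mu]_(y in cube x r) (1 : R)).
    rewrite -[RHS]Rintegral_indicM; apply: eq_Rintegral => y _.
    by rewrite mulr1.
  by rewrite Rintegral_cst ?mul1r//; exact: measurable_cube.
have ind1 x : measurable_fun setT (\1_(cube x r) : Rd -> R).
  by apply: measurable_indic; exact: measurable_cube.
have indle x y : `|\1_(cube x r) y : R| <= \1_(cube x r) y.
  by rewrite ger0_norm// indicE.
have wsum (A : set Rd) x a1 a2 : A = cube x r ->
    \int[mu]_(x in A) (`|p x - a1| + `|q x - a2|) =
    \int[mu]_(x in A) `|p x - a1| + \int[mu]_(x in A) `|q x - a2|.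
  move=> ->; have mc := measurable_cube x r.
  by rewrite RintegralD//; [exact: (locint_dist lp _ _ (@subset_refl _ _))|
                            exact: (locint_dist lq _ _ (@subset_refl _ _))].
(* The mean is taken over the opposite cube: this is what pairing an indicator with a sign produces
   exactly, up to the factor [V]. *)
pose X v := \int[mu]_(x in Q') `|v x - mean Q v|.
pose Y v := \int[mu]_(x in Q) `|v x - mean Q' v|.
have X0 v : 0 <= X v by exact: Rintegral_ge0.
have Y0 v : 0 <= Y v by exact: Rintegral_ge0.
have V0Q : 0 < fine (mu Q) by rewrite VQ.
have V0Q' : 0 < fine (mu Q') by rewrite VQ'.
have oQ v : locint v -> \int[mu]_(x in Q) `|v x - mean Q v| <= 2 * Y v.
  by move=> lv; exact: (osc_mean_le lv _ mQ (@subset_refl _ _) V0Q).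
have oQ' v : locint v -> \int[mu]_(x in Q') `|v x - mean Q' v| <= 2 * X v.
  by move=> lv; exact: (osc_mean_le lv _ mQ' (@subset_refl _ _) V0Q').
have lin v : v = p \/ v = q -> locint v by case=> ->.
have kV0 : 0 < k * V by rewrite mulr_gt0.
have hX v : v = p \/ v = q ->
    k * V * X v <= Theta + k * V / 12 * (X p + X q + 2 * (Y p + Y q)).
  move=> hv; have lv := lin _ hv.
  have := H (\1_Q) (sign_test Q' v (mean Q v)) v (mean Q p) (mean Q q)
    (ind1 y0) (measurable_sign_test _ mQ' lv.1) (indle y0)
    (sign_test_le _ _ _) hv.
  rewrite (int1 _ VQ) (indE _ v VQ) (wsum Q' x0 _ _ erefl) (wsum Q y0 _ _ erefl).
  rewrite [X in `|X|](_ : _ = V * X v); last first.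
    by rewrite /X -(sign_test_int x0 r (mean Q v) lv); ring.
  rewrite (ger0_norm (mulr_ge0 (ltW V0) (X0 v))) [leLHS]mulrA => h.
  have {}h : k * V * X v <= Theta + 2 * (k * V / 24 * (X p + X q +
      (\int[mu]_(x in Q) `|p x - mean Q p| + \int[mu]_(x in Q) `|q x - mean Q q|))) := h.
  apply: le_trans h _.
  rewrite lerD2l mulrA; have -> : 2 * (k * V / 24) = k * V / 12 by field.
  apply: ler_wpM2l; first by rewrite divr_ge0// ltW.
  by rewrite lerD2l mulrDr lerD// oQ.
have hY v : v = p \/ v = q ->
    k * V * Y v <= Theta + k * V / 12 * (Y p + Y q + 2 * (X p + X q)).
  move=> hv; have lv := lin _ hv.
  have := H (sign_test Q v (mean Q' v)) (\1_Q') v (mean Q' p) (mean Q' q)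
    (measurable_sign_test _ mQ lv.1) (ind1 x0) (sign_test_le _ _ _)
    (indle x0) hv.
  rewrite (int1 _ VQ') (indE _ v VQ') (wsum Q' x0 _ _ erefl) (wsum Q y0 _ _ erefl).
  rewrite [X in `|X|](_ : _ = - (V * Y v)); last first.
    by rewrite /Y -(sign_test_int y0 r (mean Q' v) lv); ring.
  rewrite normrN (ger0_norm (mulr_ge0 (ltW V0) (Y0 v))) [leLHS]mulrA => h.
  have {}h : k * V * Y v <= Theta + 2 * (k * V / 24 * ((\int[mu]_(x in Q') `|p x - mean Q' p|
      + \int[mu]_(x in Q') `|q x - mean Q' q|) + (Y p + Y q))) := h.
  apply: le_trans h _.
  rewrite lerD2l mulrA; have -> : 2 * (k * V / 24) = k * V / 12 by field.
  apply: ler_wpM2l; first by rewrite divr_ge0// ltW.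
  by rewrite addrC lerD2l mulrDr lerD// oQ'.
have p1 := hX p (or_introl erefl); have p2 := hX q (or_intror erefl).
have p3 := hY p (or_introl erefl); have p4 := hY q (or_intror erefl).
have YuE : Y u <= Y p + Y q.
  by case: hu => ->; [rewrite lerDl; exact: Y0|rewrite lerDr; exact: Y0].
have oQu := ler_wpM2l (ltW kV0) (oQ u (lin u hu)).
apply: le_trans oQu _.
have := X0 p; have := X0 q; have := Y0 p; have := Y0 q.
move: (X p) (X q) (Y p) (Y q) (Y u) YuE p1 p2 p3 p4.
move=> a b c e yu hyu p1 p2 p3 p4 e0 c0 b0 a0.
have ha : 0 <= k * V * a by rewrite mulr_ge0// ltW.
have hb : 0 <= k * V * b by rewrite mulr_ge0// ltW.
have hyu2 := ler_wpM2l (ltW kV0) hyu.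
lra.
Qed.

(** The norm is finite, so [fine] returns its true value and not the default 0; being at most 1, it
    drops out of the bound on the commutator. *)
Lemma test_Linfty (A B : set Rd) (f : Rd -> R) : measurable_fun setT f ->
  A `<=` B -> (forall y, `|f y| <= \1_A y) ->
  let F := fun y => Complex (f y) 0 in
  [/\ Linfty_on B F, 0 <= fine (Linfty_norm F) & fine (Linfty_norm F) <= 1].
Proof.
move=> mf AB f1 F.
have nF y : normc (F y) = `|f y| by rewrite /F /= expr0n addr0 sqrtr_sqr.
have n0 : (0 <= Linfty_norm F)%E by exact: Lnorm_ge0.
have n1 : (Linfty_norm F <= 1%:E)%E.
  rewrite /Linfty_norm unlock /=; case: ifPn => // _.
  apply/ess_supP; apply: aeW => y.
  rewrite -[X in (X <= _)%E]/((`|normc (F y)|)%:E) lee_fin nF normr_id.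
  by apply: le_trans (f1 y) _; rewrite indicE; case: (_ \in _).
have nfin : Linfty_norm F \is a fin_num.
  by rewrite ge0_fin_numE//; apply: le_lt_trans n1 (ltry _).
split; last 2 first.
- by rewrite fine_ge0.
- by rewrite -lee_fin fineK.
split.
- by exists F; split => //; exact: aeW.
- exact: le_lt_trans n1 (ltry _).
apply: aeW => y _; rewrite indicE; have [yB|nB] := boolP (y \in B).
  by rewrite mul1r.
have f0 : f y = 0.
  apply/eqP; rewrite -normr_le0; have := f1 y; rewrite indicE memNset//.
  by move=> /AB /mem_set; exact/negP.
by rewrite /F f0 mul0r.
Qed.

End absorption.

(** * Kernels that are nearly constant on a product of cubes *)

Section enorm_sup.
Context {R : realType} {d : nat}.
Local Notation Rd := 'rV[R]_d.
Implicit Types (x y : Rd).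

Lemma enorm_ge0 x : 0 <= enorm x. Proof. exact: sqrtr_ge0. Qed.

Lemma coord_le_enorm x i : `|x 0 i| <= enorm x.
Proof.
rewrite -sqrtr_sqr ler_wsqrtr// (bigD1 i)//= lerDl.
by apply: sumr_ge0 => j _; exact: sqr_ge0.
Qed.

Lemma enorm_le x r : 0 <= r -> (forall i, `|x 0 i| <= r) -> enorm x <= d%:R * r.
Proof.
move=> r0 xr; rewrite -(@ger0_norm _ (d%:R * r)) ?mulr_ge0//.
rewrite -sqrtr_sqr ler_wsqrtr//.
apply: (@le_trans _ _ (\sum_(i < d) r ^+ 2)).
  apply: ler_sum => i _; rewrite -real_normK ?num_real//.
  by rewrite lerXn2r ?nnegrE.
rewrite sumr_const card_ord -[leLHS]mulr_natl exprMn.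
apply: ler_wpM2r; first exact: sqr_ge0.
by case: d => [|n]; rewrite ?expr0n// expr2 ler_peMr// ler1n.
Qed.

(** A coordinate of largest absolute value works. Separation of cubes is always measured along such
    a coordinate. *)
Lemma enorm_le_coord x : (0 < d)%N -> exists i, enorm x <= d%:R * `|x 0 i|.
Proof.
move=> d0; pose i0 : 'I_d := Ordinal d0.
case: (@arg_maxP _ _ _ i0 xpredT (fun i => `|x 0 i|)%R) => // i _ mi.
by exists i; apply: enorm_le => // j; exact: mi.
Qed.

Lemma enormN x : enorm (- x) = enorm x.
Proof. by congr Num.sqrt; apply: eq_bigr => i _; rewrite mxE sqrrN. Qed.

Lemma enormB x y : enorm (x - y) = enorm (y - x).
Proof. by rewrite -enormN opprB. Qed.

Lemma enormZ (t : R) x : enorm (t *: x) = `|t| * enorm x.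
Proof.
rewrite /enorm (eq_bigr (fun i => t ^+ 2 * x 0 i ^+ 2)); last first.
  by move=> i _; rewrite mxE exprMn.
by rewrite -mulr_sumr sqrtrM ?sqr_ge0// sqrtr_sqr.
Qed.

End enorm_sup.

Section approx_kernel.
Context {R : realType} {d : nat}.
Local Notation Rd := 'rV[R]_d.
Local Notation mu := (@lebesgue_rV R d).
Implicit Types (K : Rd -> Rd -> R[i]).

(* K is close to K0 on cube x0 r `*` cube y0 r only in L^1 on every slice, which
   is all that rough kernels satisfy; the factor 24 is the margin with which
   osc_absorb absorbs the resulting error. *)
Definition approx_kernel K (A c : R) := forall (y0 : Rd) (r : R), 0 < r ->
  exists (x0 : Rd) (K0 : R[i]) (G1 G2 : Rd * Rd -> R),
  let N z := `|G1 z - Re K0| + `|G2 z - Im K0| in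
  let e := normc K0 * (2 * r) ^+ d / 24 in
  [/\ measurable_fun setT G1 /\ measurable_fun setT G2,
    {ae (mu \x mu)%E, forall z, cube x0 r z.1 -> cube y0 r z.2 ->
      K z.1 z.2 = Complex (G1 z) (G2 z)},
    exists i, A * r <= `|x0 0 i - y0 0 i|,
    c * r ^- d <= normc K0 &
    (forall x, cube x0 r x -> (\int[mu]_(y in cube y0 r) (N (x, y))%:E <= e%:E)%E) /\
    (forall y, cube y0 r y -> (\int[mu]_(x in cube x0 r) (N (x, y))%:E <= e%:E)%E)].

Lemma const_le_integral (f : Rd -> R) (x : Rd) (r c : R) : 0 < r ->
  (forall y, 0 <= f y) ->  (forall y, f y <= c) ->
  (\int[mu]_(y in cube x r) (f y)%:E <= (c * (2 * r) ^+ d)%:E)%E.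
Proof.
move=> r0 f0 fc; apply: (@le_trans _ _ (\int[mu]_(y in cube x r) (cst c%:E) y)%E); last first.
  rewrite EFinM -(mu_cube x (ltW r0)) le_eqVlt; apply/orP; left; apply/eqP.
  apply: integral_cst; exact: measurable_cube.
rewrite integral_mkcond [X in (_ <= X)%E]integral_mkcond.
apply: ge0_ae_le_integral.
- by move=> y; rewrite patchE; case: ifP; rewrite // lee_fin.
- move=> y; rewrite patchE; case: ifP; rewrite // lee_fin => _.
  exact: le_trans (fc y).
apply: aeW => y; rewrite !patchE; case: ifP => // _.
by rewrite lee_fin.
Qed.

(** The companion cube is centred at the point that non-degeneracy provides at distance at least
    [A' * r] from [y0]. For large [A'] the displacements inside the cubes are small fractions of
    that distance, and [K x y] is reached from [K0] in two moves, first in [y], then in [x]. *)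
Lemma smooth_approx_kernel K (omega : R -> R) (c0 A : R) : (0 < d)%N ->
  (forall t, 0 <= t < 1 -> 0 <= omega t) ->
  (forall s t, 0 <= s -> s <= t -> t < 1 -> omega s <= omega t) ->
  omega t @[t --> 0^'+] --> (0 : R) -> CZ_kernel omega K -> 0 < c0 ->
  (forall y r, 0 < r ->
     exists2 x, ~ eball y r x & (c0 * r ^+ d)^-1 <= normc (K x y)) ->
  exists2 c, 0 < c & approx_kernel K A c.
Proof.
move=> d0 om0 omle omcvg [mK _ Kom] c00 nd.
pose m : R := d%:R; have m1 : 1 <= m by rewrite ler1n.
have m0 : 0 < m by lra.
(* [B] is the total factor of [omega t] relative to [normc K0]: [D ^- d] is at most [c0 * normc K0],
   and the second move starts from a distance that may have shrunk to [D / (2 * m)]. The target 1/48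
   is for each of the real and imaginary parts, 1/24 together. *)
pose B := c0 * (1 + (2 * m) ^+ d).
have B0 : 0 < B by rewrite mulr_gt0// addr_gt0// exprn_gt0// mulr_gt0.
have [t [t0 t12 omt]] : exists t : R, [/\ 0 < t, t < 2^-1 & B * omega t <= 48^-1].
  have e0 : 0 < (48 * B)^-1 by rewrite invr_gt0 mulr_gt0.
  move/cvgrPdist_le : omcvg => /(_ _ e0) [del /= del0 H].
  exists (Num.min (del / 2) 4^-1); split.
  - by rewrite lt_min divr_gt0//= invr_gt0.
  - by rewrite gt_min; apply/orP; right; lra.
  have := H (Num.min (del / 2) 4^-1).
  have h0 : 0 < Num.min (del / 2) 4^-1 by rewrite lt_min divr_gt0//= invr_gt0.
  have h1 : Num.min (del / 2) 4^-1 < del by rewrite gt_min; apply/orP; left; lra.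
  rewrite /= !sub0r !normrN (gtr0_norm h0) => /(_ h1 h0) h2.
  rewrite mulrC -ler_pdivlMr// -invfM; apply: le_trans (ler_norm _) _.
  by apply: le_trans h2 _; rewrite mulrC.
(* The first entry yields the separation [A * r] along a coordinate, the second keeps both relative
   displacements at most [t]. *)
pose A' := Num.max (A * m) (2 * m ^+ 2 / t).
have A'A : A * m <= A' by rewrite le_max lexx.
have A't : 2 * m ^+ 2 / t <= A' by rewrite le_max lexx orbT.
have A't2 : 2 * m ^+ 2 <= A' * t by rewrite -ler_pdivrMr.
have mm : m <= m ^+ 2 by rewrite expr2 ler_peMr// ltW.
have A'm : 4 * m < A'.
  have A'0 : 0 < A' by apply: lt_le_trans A't; rewrite divr_gt0// mulr_gt0// exprn_gt0.
  nra.
have A'0 : 0 < A' by lra.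
exists (c0 * A' ^+ d)^-1; first by rewrite invr_gt0 mulr_gt0// exprn_gt0.
move=> y0 r r0.
have [x0 nball K0ge] := nd y0 (A' * r) (mulr_gt0 A'0 r0).
pose D := enorm (x0 - y0).
have DA : A' * r <= D by rewrite leNgt; apply/negP => h; apply: nball.
have D0 : 0 < D by apply: lt_le_trans DA; rewrite mulr_gt0.
have [i iD] := enorm_le_coord (x0 - y0) d0; rewrite !mxE -/D -/m in iD.
pose K0 := K x0 y0.
have K00 : 0 < normc K0.
  by apply: lt_le_trans K0ge; rewrite invr_gt0 mulr_gt0// exprn_gt0// mulr_gt0.
have near x y : cube x0 r x -> cube y0 r y ->
    normc (K x y - K0) <= normc K0 / 48.
  move=> xQ yQ.
  have e1 : enorm (y0 - y) <= m * r.
    by apply: enorm_le (ltW r0) _ => j; rewrite !mxE distrC.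
  have e2 : enorm (x0 - x) <= m * r.
    by apply: enorm_le (ltW r0) _ => j; rewrite !mxE distrC.
  (* Along the coordinate [i] the centres are at least [D / m] apart, while [y] is within
     [r <= D / (4 * m)] of [y0]. *)
  have e3 : D / (2 * m) <= enorm (x0 - y).
    have := coord_le_enorm (x0 - y) i; rewrite !mxE => h; apply: le_trans h.
    rewrite ler_pdivrMr; last by lra.
    have h2 := yQ i.
    have h3 : `|x0 0 i - y0 0 i| <= `|x0 0 i - y 0 i| + r.
      by rewrite -(subrKA (y 0 i)); apply: le_trans (ler_normD _ _) _; rewrite lerD2l.
    have : m * `|x0 0 i - y0 0 i| <= m * (`|x0 0 i - y 0 i| + r).
      by rewrite ler_pM2l.
    have : 4 * m * r <= A' * r by rewrite ler_pM2r// ltW.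
    lra.
  have D'0 : 0 < enorm (x0 - y) by apply: lt_le_trans e3; rewrite divr_gt0// mulr_gt0.
  have mrt : m * r <= t * (D / (2 * m)).
    have : 2 * m ^+ 2 * r <= t * D.
      apply: (@le_trans _ _ (A' * t * r)); first by rewrite ler_pM2r.
      by rewrite mulrAC mulrC ler_pM2l.
    by rewrite mulrA ler_pdivlMr; [lra|lra].
  have DD : D / (2 * m) <= D by rewrite ler_pdivrMr; [nra|lra].
  have q1 : enorm (y0 - y) / D <= t by rewrite ler_pdivrMr//; nra.
  have q2 : enorm (x0 - x) / enorm (x0 - y) <= t by rewrite ler_pdivrMr//; nra.
  have h1 : normc (K0 - K x0 y) <= D ^- d * omega t.
    have H := Kom y0 y x0; rewrite (enormB y0 x0) -/D in H.
    have {}H : normc (K y0 x0 - K y x0) + normc (K x0 y0 - K x0 y) <=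
        D ^- d * omega (enorm (y0 - y) / D).
      by apply: H; move: q1; rewrite ler_pdivrMr//; nra.
    apply: (@le_trans _ _ (D ^- d * omega (enorm (y0 - y) / D))).
      by apply: le_trans H; rewrite lerDr normc_ge0.
    rewrite ler_pM2l ?invr_gt0 ?exprn_gt0//; apply: omle => //; last by lra.
    by rewrite divr_ge0 ?enorm_ge0// ltW.
  have h2 : normc (K x0 y - K x y) <= (2 * m) ^+ d * D ^- d * omega t.
    have H := Kom x0 x y.
    have {}H : normc (K x0 y - K x y) + normc (K y x0 - K y x) <=
        enorm (x0 - y) ^- d * omega (enorm (x0 - x) / enorm (x0 - y)).
      by apply: H; move: q2; rewrite ler_pdivrMr//; nra.
    apply: (@le_trans _ _ (enorm (x0 - y) ^- d * omega (enorm (x0 - x) / enorm (x0 - y)))).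
      by apply: le_trans H; rewrite lerDl normc_ge0.
    apply: ler_pM.
    - by rewrite invr_ge0 exprn_ge0// ltW.
    - apply: om0; apply/andP; split; first by rewrite divr_ge0 ?enorm_ge0// ltW.
      by apply: le_lt_trans q2 _; lra.
    - rewrite -!exprVn -exprMn.
      have DV : (enorm (x0 - y))^-1 <= 2 * m * D^-1.
        rewrite (_ : 2 * m * D^-1 = (D / (2 * m))^-1); last by rewrite invf_div.
        by rewrite lef_pV2 ?posrE// divr_gt0// mulr_gt0.
      by apply: lerXn2r => //; rewrite nnegrE ?invr_ge0 ?mulr_ge0 ?invr_ge0
        ?(ltW D0) ?(ltW D'0) ?(ltW m0).
    - apply: omle => //; last by lra.
      by rewrite divr_ge0 ?enorm_ge0// ltW.
  have Dd : D ^- d <= c0 * normc K0.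
    apply: (@le_trans _ _ ((A' * r) ^- d)).
      rewrite lef_pV2 ?posrE ?exprn_gt0 ?mulr_gt0//.
      by rewrite lerXn2r ?nnegrE// ltW// mulr_gt0.
    by rewrite -ler_pdivrMl// -invfM.
  have tr : normc (K x y - K0) <= normc (K0 - K x0 y) + normc (K x0 y - K x y).
    rewrite -(normcN (K0 - K x0 y)) -(normcN (K x0 y - K x y)) !opprB [leRHS]addrC.
    rewrite -(subrKA (K x0 y) (K x y) (- K0)).
    exact: le_normcD.
  apply: le_trans tr _; apply: le_trans (lerD h1 h2) _.
  have omt0 : 0 <= omega t by apply: om0; lra.
  have -> : D ^- d * omega t + (2 * m) ^+ d * D ^- d * omega t =
    D ^- d * ((1 + (2 * m) ^+ d) * omega t) by ring.
  have T0 : 0 <= (1 + (2 * m) ^+ d) * omega t.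
    by rewrite mulr_ge0// addr_ge0// exprn_ge0// mulr_ge0// ltW.
  apply: le_trans (ler_wpM2r T0 Dd) _.
  rewrite (_ : c0 * normc K0 * _ = normc K0 * (B * omega t)); last first.
    by rewrite /B; ring.
  by rewrite ler_pM2l.
case: mK => g [mg1 mg2 gE].
pose N' z := `|Re (g z) - Re K0| + `|Im (g z) - Im K0|.
pose e := normc K0 / 24.
have mN' : measurable_fun setT N'.
  by apply: measurable_funD; apply: measurableT_comp => //; apply: measurable_funB.
(* Slice bounds are demanded for every [x] and every [y], but [g] equals [K] only almost everywhere.
   Where [g] is too far from [K0] it is reset to [K0], which alters it only on a null part of the
   product of cubes. *)
pose G1 z := if N' z <= e then Re (g z) else Re K0.
pose G2 z := if N' z <= e then Im (g z) else Im K0.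
exists x0, K0, G1, G2 => N e'.
have Ne z : N z <= e.
  rewrite /N /G1 /G2; case: ifP => // _; rewrite !subrr normr0 addr0.
  by rewrite divr_ge0// normc_ge0.
have N0 z : 0 <= N z by rewrite addr_ge0.
have mle : measurable_fun setT (fun z => N' z <= e) by exact: measurable_fun_ler.
split.
- by split; apply: measurable_fun_ifT.
- apply: filterS gE => -[x y] /= gE xQ yQ.
  have KE : K x y = g (x, y).
    apply: gE => xy; have := xQ i; have := yQ i; rewrite -xy => h1 h2.
    have h3 : `|x0 0 i - y0 0 i| <= 2 * r.
      rewrite -(subrKA (x 0 i)); apply: le_trans (ler_normD _ _) _.
      by rewrite (distrC (x0 0 i)); lra.
    have : m * `|x0 0 i - y0 0 i| <= m * (2 * r) by rewrite ler_pM2l.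
    have : 4 * m * r < A' * r by rewrite ltr_pM2r.
    have : 0 < m * r by rewrite mulr_gt0.
    lra.
  have Nle : N' (x, y) <= e.
    have nxy := near x y xQ yQ; rewrite KE in nxy.
    have := Re_le_normc (g (x, y) - K0); have := Im_le_normc (g (x, y) - K0).
    rewrite /N' /e; case: (g (x, y)) (K0) nxy => [a1 a2] [k1 k2] /= *.
    lra.
  by rewrite /G1 /G2 Nle KE; case: (g (x, y)).
- exists i; rewrite -(ler_pM2l m0); apply: le_trans iD; apply: le_trans DA.
  by rewrite mulrA ler_pM2r// mulrC.
- by rewrite -[leLHS]invfM -mulrA -exprMn.
- by split=> *; rewrite /e' (_ : _ * _ / 24 = e * (2 * r) ^+ d) ?const_le_integral//;
    rewrite /e; ring.
Qed.

End approx_kernel.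

(** * Cells on which a function is nearly constant in mean *)

Section lebesgue_cell.
Context {R : realType} {d : nat}.
Local Notation Rd := 'rV[R]_d.
Local Notation mu := (@lebesgue_rV R d).
Implicit Types (x y : Rd) (a b : R).

Lemma gcell_refine n m x y : (n <= m)%N -> gcell (side n) x y ->
  gcell (side m) y `<=` gcell (@side R n) x.
Proof.
move=> nm xy z yz; have [h hE] := @gidx_refine R d n (m - n).
rewrite subnKC// in hE; rewrite /gcell /= in xy yz *.
by rewrite -xy !hE yz.
Qed.

Variables (k1 k2 : Rd -> R).
Hypotheses (mk1 : measurable_fun setT k1) (mk2 : measurable_fun setT k2).
Variables (eta : R) (good : nat -> Rd -> Prop) (P : set Rd).
Hypothesis eta0 : 0 < eta.
Hypothesis good_refine : forall n m x y, (n <= m)%N ->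
  gcell (side n) x y -> good n x -> good m y.
Hypothesis good_int : forall n x, good n x ->
  (\int[mu]_(y in gcell (side n) x) (`|k1 y| + `|k2 y|)%:E < +oo)%E.
Hypothesis P_good : forall x, P x -> exists n, good n x.
Hypothesis P_neq0 : forall x, P x -> 0 < `|k1 x| + `|k2 x|.

Let h a b x := `|k1 x - a| + `|k2 x - b|.

Let mh a b : measurable_fun setT (h a b).
Proof.
by apply: measurable_funD; apply: measurableT_comp => //; apply: measurable_funB.
Qed.

Let Ec a b : set Rd := [set x | h a b x <= eta * (`|a| + `|b|) / 2].

Let mEc a b : measurable (Ec a b).
Proof.
rewrite (_ : Ec a b = h a b @^-1` `]-oo, eta * (`|a| + `|b|) / 2]).
  by rewrite -[X in measurable X]setTI; exact: mh.
by apply/seteqP; split => x /=; rewrite in_itv.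
Qed.

(** Inside the cell the measure of density [h a b] dominates [c * mu] on all finer cells, hence on
    all measurable sets. On [Ec a b] the density is at most [c / 2], so that part of the cell is
    null. *)
Let null_cell a b n x : 0 < `|a| + `|b| -> good n x ->
  (forall m y, good m y -> ((eta * (`|a| + `|b|))%:E * mu (gcell (side m) y) <=
    \int[mu]_(z in gcell (side m) y) (h a b z)%:E)%E) ->
  mu (Ec a b `&` gcell (side n) x) = 0%E.
Proof.
move=> ab gx H; set c := eta * (`|a| + `|b|) in H *.
have c0 : 0 < c by rewrite mulr_gt0.
set Q := gcell (side n) x.
have mQ : measurable Q := measurable_gcell _ _.
have muQ : (mu Q < +oo)%E.
  exact: fin_mu_sub (gcell_sub_cube (side_gt0 n)) mQ.
pose hq y := (\1_Q y * h a b y)%:E.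
have mhq : measurable_fun setT hq.
  by apply/measurable_EFinP/measurable_funM => //; exact: measurable_indic.
have hq0 y : (0 <= hq y)%E.
  by rewrite lee_fin mulr_ge0 ?indicE// addr_ge0.
have hqE A : measurable A ->
    (\int[mu]_(y in A) hq y = \int[mu]_(y in A `&` Q) (h a b y)%:E)%E.
  move=> mA; rewrite integral_mkcond [RHS]integral_mkcond.
  apply: eq_integral => y _; rewrite !patchE in_setI /hq indicE.
  by case: (y \in A); case: (y \in Q); rewrite /= ?mul1r ?mul0r.
pose m1 := mscale (NngNum (ltW c0)) (mrestr mu mQ).
pose m2 := density mu mhq hq0.
have fin1 : (m1 setT < +oo)%E.
  rewrite /m1 /= /mscale /= /mrestr setTI.
  by rewrite lte_mul_pinfty// lee_fin ltW.
have fin2 : (m2 setT < +oo)%E.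
  rewrite /m2 /= /density hqE// setTI.
  apply: (@le_lt_trans _ _ (\int[mu]_(y in Q) ((`|k1 y| + `|k2 y|)%:E
      + (cst (`|a| + `|b|)%:E y)))%E).
    apply: ge0_le_integral => //.
    - by move=> y _; rewrite lee_fin addr_ge0.
    - by apply/measurable_EFinP; exact: measurable_funTS (mh a b).
    - apply/measurable_EFinP; apply: measurable_funTS.
      by apply: measurable_funD => //; apply: measurable_funD; apply: measurableT_comp.
    - move=> y _; rewrite lee_fin /h addrACA; apply: lerD; exact: ler_normB.
  rewrite ge0_integralD//.
  - rewrite integral_cst//= lte_add_pinfty//; first exact: good_int.
    by rewrite lte_mul_pinfty// lee_fin addr_ge0.
  - apply/measurable_EFinP; apply: measurable_funTS.
    by apply: measurable_funD; apply: measurableT_comp.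
  - by move=> z _; rewrite lee_fin addr_ge0.
have m12 m y : (n <= m)%N -> (m1 (gcell (side m) y) <= m2 (gcell (side m) y))%E.
  move=> nm; have mG : measurable (gcell (side m) y) := measurable_gcell _ _.
  rewrite /m1 /m2 /= /mscale /= /mrestr /density hqE//.
  have [[z [yz xz]]|/nonemptyPn ->] := pselect (gcell (side m) y `&` Q !=set0).
    have sub : gcell (side m) y `<=` Q.
      by rewrite (gcellE yz); exact: gcell_refine.
    rewrite (setIidl sub); apply: H.
    apply: good_refine nm _ gx; apply: sub; exact: gcell_refl.
  by rewrite measure0 mule0 integral_set0.
have mEQ : measurable (Ec a b `&` Q) by exact: measurableI.
have := le_measure_gcell fin1 fin2 m12 mEQ.
rewrite /m1 /m2 /= /mscale /= /mrestr /density hqE// -setIA setIid => le1.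
have le2 : (\int[mu]_(y in Ec a b `&` Q) (h a b y)%:E <=
    (c / 2)%:E * mu (Ec a b `&` Q))%E.
  apply: (@le_trans _ _ (\int[mu]_(y in Ec a b `&` Q) (cst (c / 2)%:E y))%E).
    apply: ge0_le_integral => //.
    - by move=> y _; rewrite lee_fin addr_ge0.
    - by apply/measurable_EFinP; exact: measurable_funTS (mh a b).
    - by move=> y [Ey _]; rewrite lee_fin.
  by rewrite integral_cst.
have fEQ : mu (Ec a b `&` Q) \is a fin_num.
  rewrite ge0_fin_numE//; apply: le_lt_trans muQ.
  by apply: le_measure; rewrite ?inE.
have := le_trans le1 le2; rewrite -(fineK fEQ) -!EFinM lee_fin => le3.
apply/eqP; rewrite eqe eq_le fine_ge0// andbT.
have : c / 2 * fine (mu (Ec a b `&` Q)) <= 0 by lra.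
by rewrite pmulr_rle0// divr_gt0.
Qed.

(** Otherwise [null_cell] applies to all nonzero pairs of constants. The rational pairs are
    countably many, and their sets [Ec] cover [P], since the nonzero value of [(k1, k2)] at a point
    of [P] has rational approximations within a small fraction of its size. *)
Lemma lebesgue_cell : measurable P -> mu P != 0%E -> exists a b n x,
  [/\ 0 < `|a| + `|b|, good n x &
   (\int[mu]_(y in gcell (side n) x) (h a b y)%:E <
    (eta * (`|a| + `|b|))%:E * mu (gcell (side n) x))%E].
Proof.
move=> mP muP; apply: contrapT => noex; move/negP : muP; apply; apply/eqP.
have H a b : 0 < `|a| + `|b| -> forall m y, good m y ->
   ((eta * (`|a| + `|b|))%:E * mu (gcell (side m) y) <=
    \int[mu]_(z in gcell (side m) y) (h a b z)%:E)%E.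
  move=> ab m y gy; rewrite leNgt; apply/negP => lt; apply: noex.
  by exists a, b, m, y.
pose U n a b := [set x | good n x /\ 0 < `|a| + `|b|] `&` Ec a b.
have goodE n x y : gcell (side n) x y -> good n x -> good n y.
  by move=> xy; exact: good_refine.
have mU n a b : measurable (U n a b).
  apply: measurableI => //.
  rewrite (_ : [set x | _] = gidx (side n) @^-1`
    [set j | exists x, [/\ gidx (side n) x = j, good n x & 0 < `|a| + `|b|]]).
    exact: measurable_level.
  apply/seteqP; split => x /=; first by move=> [gx ab]; exists x.
  by move=> [y [xy gy ab]]; split => //; apply: goodE gy; rewrite /gcell /= -xy.
have U0 n a b : mu (U n a b) = 0%E.
  have := @le_measure_level _ _ (mrestr mu (mU n a b)) mzero (side n) _ setT.
  rewrite /= /mrestr preimage_setT setTI => L.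
  apply/eqP; rewrite eq_le measure_ge0 andbT; apply: L => x.
  have [[y [xy [[gy ab] _]]]|/nonemptyPn ->] :=
    pselect (gcell (side n) x `&` U n a b !=set0); last by rewrite measure0.
  have mG : measurable (gcell (side n) x) := measurable_gcell _ _.
  have gx : good n x by apply: goodE gy; rewrite /gcell /= xy.
  have := null_cell ab gx (H a b ab) => N0.
  apply: (@le_trans _ _ (mu (Ec a b `&` gcell (side n) x))); last by rewrite N0.
  apply: le_measure; rewrite ?inE; [exact: measurableI|exact: measurableI|].
  by move=> z [xz [_ Ez]].
(* Rational constants are enumerated by their codes, a number that codes none standing for 0; the
   pair (0, 0) contributes an empty set because [U] contains the condition on [a] and [b]. *)
pose W := \bigcup_n \bigcup_k \bigcup_l
  U n (odflt 0 (omap ratr (unpickle k : option rat)))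
      (odflt 0 (omap ratr (unpickle l : option rat))).
have nW : mu.-negligible W.
  apply: negligible_bigcup => n; apply: negligible_bigcup => k.
  apply: negligible_bigcup => l.
  exact: (negligibleP _ (mU _ _ _)).2 (U0 _ _ _).
suff PW : P `<=` W by apply: (measure_negligible mP); exact: negligibleS PW nW.
move=> x Px; have [n gx] := P_good Px; have S0 := P_neq0 Px.
set S := `|k1 x| + `|k2 x| in S0.
(* With constants within [t] of the values at [x], [h] is at most [2 * t] there and their absolute
   values add up to at least [S - 2 * t]. The eighth puts [2 * t] below half of [eta * (S - 2 * t)];
   the minimum with 1 keeps [S - 2 * t] positive. *)
pose t := Num.min eta 1 * S / 8.
have m0 : 0 < Num.min eta 1 by rewrite lt_min eta0 ltr01.
have m1 : Num.min eta 1 <= 1 by rewrite ge_min lexx orbT.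
have m2 : Num.min eta 1 <= eta by rewrite ge_min lexx.
have t0 : 0 < t by rewrite divr_gt0// mulr_gt0.
have tS : t <= S / 8 by rewrite ler_pM2r// ler_piMl// ltW.
have tS2 : t <= eta * S / 8 by rewrite ler_pM2r// ler_pM2r.
have appr (v : R) : exists q : rat, `|v - ratr q| <= t.
  have /rat_in_itvoo[q /=] : v - t < v + t by lra.
  rewrite in_itv/= => /andP[q1 q2]; exists q; rewrite ler_norml.
  by apply/andP; split; lra.
have [q hq] := appr (k1 x); have [r hr] := appr (k2 x).
have qr : S - 2 * t <= `|ratr q| + `|ratr r|.
  have h1 (v w : R) : `|v| <= `|v - w| + `|w|.
    by rewrite -{1}(subrK w v) ler_normD.
  have := h1 (k1 x) (ratr q); have := h1 (k2 x) (ratr r).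
  by rewrite /S => *; lra.
exists n => //; exists (pickle q) => //; exists (pickle r) => //.
rewrite !pickleK /=; split; first by split => //; lra.
rewrite /Ec /= /h.
have : eta * (S - 2 * t) <= eta * (`|ratr q| + `|ratr r|) by rewrite ler_pM2l.
have : eta * t <= eta * (S / 8) by rewrite ler_pM2l.
lra.
Qed.

End lebesgue_cell.

Section affine_integral.
Context {R : realType} {d : nat}.
Local Notation Rd := 'rV[R]_d.
Local Notation mu := (@lebesgue_rV R d).

Lemma ge0_integral_affine (a : Rd) (t : R) (f : Rd -> \bar R) : t != 0 ->
  measurable_fun setT f -> (forall x, 0 <= f x)%E ->
  (\int[mu]_y f (a + t *: y)%R = (`|t| ^- d)%:E * \int[mu]_y f y)%E.
Proof.
move=> t0 mf f0; pose phi := fun y : Rd => a + t *: y.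
have mphi : measurable_fun setT phi := measurable_rV_affine a t.
have td0 : 0 <= `|t| ^- d by rewrite invr_ge0 exprn_ge0.
have := @ge0_integral_pushforward _ _ _ _ _ phi mphi mu setT f measurableT mf
  (fun y _ => f0 y).
rewrite preimage_setT => <-.
have := @ge0_integral_mscale _ _ _ mu setT measurableT (NngNum td0) f mf
  (fun y _ => f0 y).
move=> <-; apply: eq_measure_integral => A mA _.
exact: lebesgue_rV_affine.
Qed.

End affine_integral.

Section rough.
Context {R : realType} {d : nat}.
Local Notation Rd := 'rV[R]_d.
Local Notation mu := (@lebesgue_rV R d).
Hypothesis d0 : (0 < d)%N.
Implicit Types (x y z : Rd).

Lemma enorm_gt0 x i : 0 < `|x 0 i| -> 0 < enorm x.
Proof. by move=> h; apply: lt_le_trans h (coord_le_enorm _ _). Qed.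

Lemma measurable_enorm_lt (s : R) : measurable [set x : Rd | enorm x < s].
Proof.
rewrite (_ : [set _ | _] = enorm @^-1` `]-oo, s[).
  by rewrite -[X in measurable X]setTI; exact: measurable_enorm.
by apply/seteqP; split => x /=; rewrite in_itv.
Qed.

Lemma measurable_enorm_gt0 : measurable [set x : Rd | 0 < enorm x].
Proof.
rewrite (_ : [set _ | _] = enorm @^-1` `]0, +oo[).
  by rewrite -[X in measurable X]setTI; exact: measurable_enorm.
by apply/seteqP; split => x /=; rewrite in_itv/= andbT.
Qed.

Lemma radial_projZ (t : R) x : 0 < t -> radial_proj (t *: x) = radial_proj x.
Proof.
move=> t0; rewrite /radial_proj enormZ (gtr0_norm t0) scalerA invfM.
by rewrite mulrAC mulVf ?mul1r// gt_eqF.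
Qed.

Lemma radial_proj_sphere x : 0 < enorm x -> sphere (radial_proj x).
Proof.
move=> x0; rewrite /sphere /= /radial_proj enormZ gtr0_norm ?invr_gt0//.
by rewrite mulVf// gt_eqF.
Qed.

(** The surface measure is [d] times the volume of the cone inside the punctured unit ball, and [d]
    is positive. Dilates of that part by the positive integers cover the whole cone. *)
Lemma null_cone (N : set Rd) : measurable N -> surface_measure N = 0%E ->
  mu (radial_proj @^-1` N `&` [set x | 0 < enorm x]) = 0%E.
Proof.
move=> mN N0.
have mC : measurable (radial_proj @^-1` N).
  by rewrite -[X in measurable X]setTI; exact: measurable_radial_proj.
have mP := @measurable_punctured_ball R d.
have N0' : mu (radial_proj @^-1` N `&` punctured_ball) = 0%E.
  move: N0; rewrite /surface_measure => /eqP; rewrite mule_eq0 => /orP[|/eqP//].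
  by rewrite eqe pnatr_eq0 -leqn0 leqNgt d0.
have mZ : measurable (radial_proj @^-1` N `&` [set x | 0 < enorm x]).
  by apply: measurableI => //; exact: measurable_enorm_gt0.
apply: (measure_negligible mZ).
pose F n := (fun x : Rd => 0 + n.+1%:R^-1 *: x) @^-1`
  (radial_proj @^-1` N `&` punctured_ball).
have nF n : mu.-negligible (F n).
  apply: (negligibleP _ _).2.
    by rewrite -[X in measurable X]setTI; apply: measurable_rV_affine => //;
      exact: measurableI.
  have nz : n.+1%:R^-1 != 0 :> R by rewrite invr_eq0 pnatr_eq0.
  apply: etrans (lebesgue_rV_affine 0 nz (measurableI _ _ mC mP)) _.
  by rewrite N0' mule0.
apply: negligibleS (negligible_bigcup nF) => x [Nx x0].
exists (Num.truncn (enorm x)) => //.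
have n0 : 0 < (Num.truncn (enorm x)).+1%:R^-1 :> R by rewrite invr_gt0.
rewrite /F /= add0r /punctured_ball /= radial_projZ// enormZ (gtr0_norm n0).
split => //; rewrite mulr_gt0//= mulrC ltr_pdivrMr// mul1r.
exact: truncnS_gt.
Qed.

Lemma side_small (e : R) : 0 < e -> exists n, side n <= e.
Proof.
move=> e0; exists (Num.truncn e^-1).+1; rewrite /side.
rewrite -[leRHS]invrK lef_pV2 ?posrE ?invr_gt0 ?exprn_gt0//.
apply: le_trans (ltW (truncnS_gt _)) _.
by rewrite -natrX ler_nat ltnW// ltn_expl.
Qed.

(** Lying in the unit ball brings the cell under the integrability of [Omega]. Being far from the
    origin relative to the side keeps away from the singularity and becomes, after dilation, the
    separation of the two cubes. *)
Definition good_cell (A : R) n x := gcell (@side R n) x `<=`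
  [set z | enorm z < 1 /\ exists i, A * side n <= `|z 0 i|].

Lemma good_cell_refine (A : R) n m x y : 0 <= A -> (n <= m)%N ->
  gcell (side n) x y -> good_cell A n x -> good_cell A m y.
Proof.
move=> A0 nm xy gx z yz; have [z1 [i zi]] := gx z (gcell_refine nm xy yz).
split => //; exists i; apply: le_trans zi; rewrite ler_wpM2l//.
by rewrite /side lef_pV2 ?posrE ?exprn_gt0// ler_eXn2l// ltr1n.
Qed.

Lemma good_cell_ex (A : R) x : 0 <= A -> punctured_ball x ->
  exists n, good_cell A n x.
Proof.
move=> A0 /andP[x0 x1].
have [i iD] := enorm_le_coord x d0.
have xi0 : 0 < `|x 0 i|.
  by rewrite normr_gt0; apply/eqP => E; move: iD; rewrite E normr0 mulr0 leNgt x0.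
have dR : 0 < d%:R :> R by rewrite ltr0n.
have s2 : 0 < 1 - enorm x ^+ 2.
  by rewrite subr_gt0 expr_lt1// ltW.
(* For a side [s] at most [e], coordinate [i] stays above [|x 0 i| - s >= A * s], and each squared
   coordinate grows by at most [2 * s + s ^+ 2 <= 3 * s], which keeps the norm below 1. *)
pose e := Num.min 1 (Num.min (`|x 0 i| / (A + 1)) ((1 - enorm x ^+ 2) / (4 * d%:R))).
have e0 : 0 < e.
  rewrite !lt_min ltr01 /= divr_gt0//=; first by rewrite divr_gt0// mulr_gt0.
  by lra.
have [n ne] := side_small e0; exists n => z xz.
set s := side n in ne xz *; have s0 : 0 < s := side_gt0 n.
move: ne; rewrite !le_min => /and3P[s1 sA sd].
have zs j : `|z 0 j - x 0 j| <= s by exact: gcell_bounds xz.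
split.
  have zx j : z 0 j ^+ 2 <= x 0 j ^+ 2 + 3 * s.
    have h := zs j; have xj : `|x 0 j| <= 1.
      by apply: le_trans (coord_le_enorm x j) (ltW x1).
    have zj : `|z 0 j| <= `|x 0 j| + s.
      have := ler_normD (z 0 j - x 0 j) (x 0 j); rewrite subrK; lra.
    rewrite -[z 0 j ^+ 2]real_normK ?num_real// -[x 0 j ^+ 2]real_normK ?num_real//.
    have := normr_ge0 (z 0 j); have := normr_ge0 (x 0 j).
    by move: (`|z 0 j|) (`|x 0 j|) zj xj => a b; nra.
  rewrite /= -(@sqrtr1 R) ltr_sqrt//.
  apply: (@le_lt_trans _ _ (\sum_(j < d) (x 0 j ^+ 2 + 3 * s))).
    by apply: ler_sum.
  rewrite big_split/= sumr_const card_ord -[X in _ + X]mulr_natl.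
  have -> : \sum_(j < d) x 0 j ^+ 2 = enorm x ^+ 2.
    by rewrite sqr_sqrtr//; apply: sumr_ge0 => j _; exact: sqr_ge0.
  move: sd; rewrite ler_pdivlMr ?mulr_gt0//.
  have : 0 < s * d%:R by rewrite mulr_gt0.
  lra.
exists i; have := zs i; move: sA; rewrite ler_pdivlMr; last by lra.
have : `|x 0 i| <= `|z 0 i| + `|z 0 i - x 0 i|.
  by rewrite -{1}(subKr (z 0 i) (x 0 i)); exact: ler_normB.
lra.
Qed.

End rough.

(** * Rough homogeneous kernels *)

Section rough_kernel.
Context {R : realType} {d : nat}.
Local Notation Rd := 'rV[R]_d.
Local Notation mu := (@lebesgue_rV R d).
Hypothesis d0 : (0 < d)%N.
Implicit Types (x y z : Rd).

Lemma measurable_subrV :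
  measurable_fun setT (fun z : Rd * Rd => z.1 - z.2).
Proof.
apply/measurable_fun_rVP => i; under eq_fun do rewrite !mxE.
apply: measurable_funB.
  exact: (measurableT_comp (measurable_coord i) measurable_fst).
exact: (measurableT_comp (measurable_coord i) measurable_snd).
Qed.

(** For each [x], the set of [y] with [x - y] in [Z] is a reflected translate of [Z], hence null. *)
Lemma null_diff (Z : set Rd) : measurable Z -> mu Z = 0%E ->
  {ae (mu \x mu)%E, forall z : Rd * Rd, ~ Z (z.1 - z.2)}.
Proof.
move=> mZ Z0; pose W := (fun z : Rd * Rd => z.1 - z.2) @^-1` Z.
have mW : measurable W by rewrite -[W]setTI; exact: measurable_subrV.
exists W; split => //; last by move=> z /= /contrapT.
rewrite /product_measure1; apply: integral0_eq => x _ /=.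
rewrite (_ : xsection W x = (fun y => x + (-1) *: y) @^-1` Z).
  have n1 : -1 != 0 :> R by rewrite oppr_eq0 oner_eq0.
  by apply: etrans (lebesgue_rV_affine x n1 mZ) _; rewrite Z0 mule0.
apply/seteqP; split => y; rewrite /xsection /= ?inE /W /= scaleN1r//.
Qed.

(** The Jacobian factor [t ^+ d] cancels the weight [t ^- d]. Slices of the kernel error at any
    position and scale are thus bounded by an integral over one fixed cube. *)
Lemma integral_affine_cube (h : Rd -> R) (z0 v0 a : Rd) (s r t c : R) :
  0 < t -> measurable_fun setT h -> (forall z, 0 <= h z) ->
  `|c| = t^-1 ->
  (forall v, cube v0 r v -> cube z0 s (a + c *: v)) ->
  (\int[mu]_(v in cube v0 r) (t ^- d * h (a + c *: v))%:E <=
   \int[mu]_(z in cube z0 s) (h z)%:E)%E.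
Proof.
move=> t0 mh h0 ct sub.
have mz := measurable_cube z0 s.
pose H z := (t ^- d * (\1_(cube z0 s) z * h z))%:E.
have mH : measurable_fun setT H.
  by apply/measurable_EFinP/measurable_funM => //; apply: measurable_funM.
have td : 0 <= t ^- d by rewrite invr_ge0 exprn_ge0// ltW.
have H0 z : (0 <= H z)%E by rewrite lee_fin !mulr_ge0// indicE.
have c0 : c != 0 by rewrite -normr_gt0 ct invr_gt0.
have le1 : (\int[mu]_(v in cube v0 r) (t ^- d * h (a + c *: v))%:E <=
    \int[mu]_v H (a + c *: v)%R)%E.
  rewrite integral_mkcond; apply: ge0_ae_le_integral.
  - by move=> v; rewrite patchE; case: ifP => // _; rewrite lee_fin mulr_ge0.
  - by move=> v; exact: H0.
  - apply: aeW => v; rewrite patchE; case: ifPn => [/set_mem Qv|_]; last exact: H0.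
    by rewrite /H indicE mem_set ?mul1r//; exact: sub.
apply: (le_trans le1).
rewrite ge0_integral_affine// ct.
rewrite /H; under eq_integral do rewrite EFinM.
rewrite ge0_integralZl//; last first.
- by move=> z _; rewrite lee_fin mulr_ge0// indicE.
- by apply/measurable_EFinP; apply: measurable_funM => //; exact: measurable_indic.
rewrite muleA -EFinM exprVn invrK mulfV ?gt_eqF ?exprn_gt0// mul1e.
rewrite [leRHS]integral_mkcond le_eqVlt; apply/orP; left; apply/eqP.
apply: eq_integral => z _; rewrite patchE indicE.
by case: ifP => _ /=; rewrite ?mul1r ?mul0r.
Qed.

Variables (K : Rd -> Rd -> R[i]) (Omega g : Rd -> R[i]).
Hypothesis Omega_hom : forall (t : R) x, 0 < t -> Omega (t *: x) = Omega x.
Hypotheses (mg1 : measurable_fun setT (fun x => Re (g x)))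
  (mg2 : measurable_fun setT (fun x => Im (g x))).
Hypothesis Omega_g : Omega = g %[ae (@surface_measure R d) in sphere].
Hypothesis Omega_int :
  (\int[surface_measure]_(x in sphere) (normc (Omega x))%:E < +oo)%E.
Hypothesis Omega_neq0 : ~ (Omega = cst 0 %[ae surface_measure in sphere]).
Hypothesis KE : forall x y, x <> y ->
  K x y = Omega (x - y) * Complex (enorm (x - y) ^- d) 0.

(** With [k2], the kernel as a function of the difference [x - y], built on the representative [g]
    so as to be measurable everywhere and exactly homogeneous of degree [- d] under positive
    dilations. *)
Let k1 z := Re (g (radial_proj z)) * enorm z ^- d.
Let k2 z := Im (g (radial_proj z)) * enorm z ^- d.

Let menorm : measurable_fun setT (fun z : Rd => enorm z ^- d).
Proof.
rewrite (_ : (fun _ => _) = fun z : Rd => enorm z `^ (- d%:R)).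
  exact: (measurableT_comp (measurable_powR _) measurable_enorm).
by apply/funext => z; rewrite powR_invn// enorm_ge0.
Qed.

Let mk1 : measurable_fun setT k1.
Proof.
apply: measurable_funM => //.
exact: (measurableT_comp mg1 measurable_radial_proj).
Qed.

Let mk2 : measurable_fun setT k2.
Proof.
apply: measurable_funM => //.
exact: (measurableT_comp mg2 measurable_radial_proj).
Qed.

Let k1Z t z : 0 < t -> k1 (t *: z) = t ^- d * k1 z.
Proof.
move=> t0; rewrite /k1 radial_projZ// enormZ (gtr0_norm t0) exprMn invfM.
by ring.
Qed.

Let k2Z t z : 0 < t -> k2 (t *: z) = t ^- d * k2 z.
Proof.
move=> t0; rewrite /k2 radial_projZ// enormZ (gtr0_norm t0) exprMn invfM.
by ring.
Qed.

Let mpunct := @measurable_punctured_ball R d.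

(** The weight [enorm z ^- d], singular at the origin, is left aside here and bounded later on good
    cells. The surface measure is the image under [radial_proj] of [d] times Lebesgue measure on the
    punctured ball, so the integral over the sphere is pulled back to the ball. *)
Let g_int : (\int[mu]_(z in punctured_ball)
  (`|Re (g (radial_proj z))| + `|Im (g (radial_proj z))|)%:E < +oo)%E.
Proof.
pose S : {measure set Rd -> \bar R} := surface_measure.
have msph : measurable (sphere : set Rd).
  rewrite (_ : sphere = enorm @^-1` [set 1]); last by [].
  by rewrite -[X in measurable X]setTI; exact: measurable_enorm.
pose G z := (`|Re (g z)| + `|Im (g z)|)%:E.
have mG : measurable_fun setT G.
  by apply/measurable_EFinP; apply: measurable_funD; apply: measurableT_comp.
have G0 z : (0 <= G z)%E by rewrite lee_fin addr_ge0.
have step1 : (\int[S]_(x in sphere) G x < +oo)%E.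
  have E : (\int[S]_(x in sphere) (normc (g x))%:E < +oo)%E.
    rewrite -(@ae_eq_integral_nonmeas _ _ _ S sphere (fun x => (normc (Omega x))%:E))//.
    by apply: filterS Omega_g => x H sx; rewrite H.
  have le (f : Rd -> R) : (forall x, 0 <= f x <= normc (g x)) ->
     (\int[S]_(x in sphere) (f x)%:E <= \int[S]_(x in sphere) (normc (g x))%:E)%E.
    move=> fg; rewrite integral_mkcond [leRHS]integral_mkcond.
    apply: ge0_ae_le_integral.
    - by move=> v; rewrite patchE; case: ifP => // _; have /andP[] := fg v.
    - by move=> v; rewrite patchE; case: ifP => // _; rewrite lee_fin normc_ge0.
    - apply: aeW => v; rewrite !patchE; case: ifP => // _; rewrite lee_fin.
      by have /andP[] := fg v.
  rewrite /G; under eq_integral do rewrite EFinD.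
  rewrite ge0_integralD//; last 2 first.
  - by apply/measurable_EFinP; apply: measurable_funTS; apply: measurableT_comp.
  - by apply/measurable_EFinP; apply: measurable_funTS; apply: measurableT_comp.
  rewrite lte_add_pinfty//; apply: le_lt_trans E; apply: le => x.
    by rewrite normr_ge0 Re_le_normc.
  by rewrite normr_ge0 Im_le_normc.
pose m := mscale (NngNum (ler0n R d)) (mrestr mu mpunct).
have mrp := @measurable_radial_proj R d.
have mrs : measurable (radial_proj @^-1` (sphere : set Rd)).
  by rewrite -[X in measurable X]setTI; exact: mrp.
have step2 : (\int[m]_(z in radial_proj @^-1` sphere) G (radial_proj z) < +oo)%E.
  have := @ge0_integral_pushforward _ _ _ _ _ _ mrp m sphere G msph
    (measurable_funTS mG) (fun y _ => G0 y).
  by move=> <-; apply: le_lt_trans step1; rewrite le_eqVlt; apply/orP; left;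
    apply/eqP; apply: eq_measure_integral.
have mGr : measurable_fun setT (G \o radial_proj) by exact: measurableT_comp mG mrp.
rewrite ge0_integral_mscale// in step2; last exact: measurable_funTS.
have dR : (0 < d%:R%:E :> \bar R)%E by rewrite lte_fin ltr0n.
have step3 : (\int[mrestr mu mpunct]_(z in radial_proj @^-1` sphere)
    G (radial_proj z) < +oo)%E.
  move: step2; rewrite ltey_eq => step2.
  rewrite ltNge leye_eq; apply/negP => /eqP E; move: step2.
  by rewrite E gt0_muley.
apply: le_lt_trans step3.
rewrite -(@eq_measure_integral _ _ _ punctured_ball mu (mrestr mu mpunct)); last first.
  by move=> A mA Ap; rewrite /= /mrestr (setIidl Ap).
apply: ge0_subset_integral => //; first exact: measurable_funTS.
by move=> z /andP[z0 _]; exact: radial_proj_sphere.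
Qed.

Let P : set Rd := punctured_ball `&` [set z | 0 < `|k1 z| + `|k2 z|].

Let mP : measurable P.
Proof.
apply: measurableI => //.
rewrite (_ : [set _ | _] = (fun z => `|k1 z| + `|k2 z|) @^-1` `]0, +oo[).
  rewrite -[X in measurable X]setTI.
  have : measurable_fun setT (fun z => `|k1 z| + `|k2 z|).
    by apply: measurable_funD; apply: measurableT_comp.
  by apply.
by apply/seteqP; split => x /=; rewrite in_itv/= andbT.
Qed.

(** The part in the punctured ball of the cone over the directions where [g] is nonzero lies in [P];
    were [P] null, [Omega] would vanish almost everywhere on the sphere. *)
Let muP : mu P != 0%E.
Proof.
apply/eqP => P0; apply: Omega_neq0.
pose E : set Rd := [set z | 0 < `|Re (g z)| + `|Im (g z)|].
have mE : measurable E.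
  rewrite (_ : E = (fun z => `|Re (g z)| + `|Im (g z)|) @^-1` `]0, +oo[).
    rewrite -[X in measurable X]setTI.
    have : measurable_fun setT (fun z => `|Re (g z)| + `|Im (g z)|).
      by apply: measurable_funD; apply: measurableT_comp.
    by apply.
  by apply/seteqP; split => x /=; rewrite in_itv/= andbT.
have sE : surface_measure E = 0%E.
  rewrite /surface_measure (_ : mu _ = 0%E) ?mule0//.
  apply: (@subset_measure0 _ _ _ mu _ P) => //.
    apply: measurableI => //.
    by rewrite -[X in measurable X]setTI; exact: measurable_radial_proj.
  move=> z [Ez pz]; split => //=; have /andP[z0 _] := pz.
  rewrite /k1 /k2 !normrM -mulrDl mulr_gt0//.
  by rewrite normr_gt0 invr_eq0 expf_eq0 gt_eqF// andbF.
have nE : {ae surface_measure, forall z, ~ E z}.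
  by exists E; split => // z /= /contrapT.
apply: filterS2 Omega_g nE => z Og nz sz; rewrite Og// /cst.
apply/eqP; rewrite eq_complex /=; apply/andP.
have : `|Re (g z)| + `|Im (g z)| <= 0 by rewrite leNgt; exact/negP.
rewrite -!normr_le0; have := normr_ge0 (Re (g z)); have := normr_ge0 (Im (g z)).
by move=> *; split; lra.
Qed.

(** For [x] and [y] in cubes of half side [r], the difference stays in a cube of half side [2 * r],
    the dilate by [t] of the fixed cube of half side [sg] around [z0]. Freezing [x] or [y] leaves an
    affine change of variable, so both slice bounds come from the integral over that one cube. *)
Lemma rough_approx_kernel_aux (A : R) : exists2 c, 0 < c & approx_kernel K A c.
Proof.
(* The 3 keeps the two cubes disjoint even if [A] is small, so that [KE] applies on their
   product. *)
pose A1 := Num.max A 3; have A13 : 3 <= A1 by rewrite le_max lexx orbT.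
have A1A : A <= A1 by rewrite le_max lexx.
have A10 : 0 <= A1 by lra.
(* The selected cell has volume at most [(8 * sg) ^+ d], and [|a| + |b|] is at most [2 * normc k0];
   this [eta] makes the error on the inner cube at most [normc k0 * sg ^+ d / 24]. *)
pose eta : R := (48 * 8 ^+ d)^-1.
have p8 : 0 < 8 ^+ d :> R by rewrite exprn_gt0.
have eta0 : 0 < eta by rewrite invr_gt0 mulr_gt0.
have good_int n x : good_cell A1 n x ->
    (\int[mu]_(y in gcell (side n) x) (`|k1 y| + `|k2 y|)%:E < +oo)%E.
  move=> gx; set C := (A1 * side n) ^- d.
  have s0 : 0 < A1 * side n by rewrite mulr_gt0 ?side_gt0//; lra.
  have C0 : 0 <= C by rewrite invr_ge0 exprn_ge0// ltW.
  pose G z : \bar R := (`|Re (g (radial_proj z))| + `|Im (g (radial_proj z))|)%:E.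
  have mG : measurable_fun setT G.
    apply/measurable_EFinP; apply: measurable_funD; apply: measurableT_comp => //.
      exact: (measurableT_comp mg1 measurable_radial_proj).
    exact: (measurableT_comp mg2 measurable_radial_proj).
  have mc := measurable_gcell (@side R n) x.
  apply: (@le_lt_trans _ _ (C%:E * \int[mu]_(z in punctured_ball) G z)%E); last first.
    by rewrite lte_mul_pinfty// lee_fin.
  apply: (@le_trans _ _ (C%:E * \int[mu]_(z in gcell (side n) x) G z)%E); last first.
    apply: lee_wpmul2l; rewrite ?lee_fin//; apply: ge0_subset_integral => //.
    - exact: measurable_funTS.
    - by move=> z _; rewrite lee_fin addr_ge0.
    - move=> z /gx[z1 [i zi]]; apply/andP; split => //.
      by apply: (@enorm_gt0 _ _ _ i); apply: lt_le_trans zi.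
  rewrite -ge0_integralZl//; last 2 first.
  - exact: measurable_funTS.
  - by move=> z _; rewrite lee_fin addr_ge0.
  apply: ge0_le_integral => //.
  - apply/measurable_EFinP; apply: measurable_funTS.
    by apply: measurable_funD; apply: measurableT_comp.
  - by apply: measurable_funTS; apply: measurable_funeM.
  move=> z /gx[z1 [i zi]]; rewrite lee_fin /k1 /k2 !normrM -mulrDl mulrC.
  apply: ler_wpM2r; first by rewrite addr_ge0.
  have ez : A1 * side n <= enorm z by apply: le_trans zi (coord_le_enorm z i).
  have z0 : 0 < enorm z by apply: lt_le_trans ez.
  rewrite ger0_norm ?invr_ge0 ?exprn_ge0 ?enorm_ge0//.
  rewrite lef_pV2 ?posrE ?exprn_gt0// lerXn2r ?nnegrE// ltW//.
have P_good x : P x -> exists n, good_cell A1 n x.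
  by move=> [px _]; exact: good_cell_ex.
have P_neq0 x : P x -> 0 < `|k1 x| + `|k2 x| by case.
have good_ref n m x y (nm : (n <= m)%N) (xy : gcell (side n) x y) gx :=
  good_cell_refine A10 nm xy gx.
have [a [b [n [w [ab gw lt]]]]] := lebesgue_cell mk1 mk2 eta0 good_ref good_int
  P_good P_neq0 mP muP.
set s := @side R n in lt; have s0 : 0 < s := side_gt0 n.
have [z0 z0w] := cube_sub_gcell w s0.
pose sg := s / 4; have sg0 : 0 < sg by rewrite divr_gt0.
pose h z := `|k1 z - a| + `|k2 z - b|.
have mh : measurable_fun setT h.
  by apply: measurable_funD; apply: measurableT_comp => //; apply: measurable_funB.
have h0 z : 0 <= h z by rewrite addr_ge0.
pose k0 : R[i] := Complex a b.
have abk : `|a| + `|b| <= 2 * normc k0.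
  have := Re_le_normc k0; have := Im_le_normc k0; rewrite /=; lra.
have k00 : 0 < normc k0 by lra.
have hint : (\int[mu]_(z in cube z0 sg) (h z)%:E <=
    (normc k0 * sg ^+ d / 24)%:E)%E.
  apply: (@le_trans _ _ (\int[mu]_(z in gcell s w) (h z)%:E)%E).
    apply: ge0_subset_integral => //.
    - exact: measurable_cube.
    - exact: measurable_gcell.
    - by apply/measurable_EFinP; exact: measurable_funTS.
    - by move=> z _; rewrite lee_fin.
  apply: (le_trans (ltW lt)).
  have muc : (mu (gcell s w) <= ((8 * sg) ^+ d)%:E)%E.
    rewrite (_ : 8 * sg = 2 * s); last by rewrite /sg; lra.
    rewrite -(mu_cube w (ltW s0)); apply: le_measure; rewrite ?inE.
    - exact: measurable_gcell.
    - exact: measurable_cube.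
    - exact: gcell_sub_cube.
  apply: (@le_trans _ _ ((eta * (`|a| + `|b|))%:E * ((8 * sg) ^+ d)%:E)%E).
    by apply: lee_wpmul2l => //; rewrite lee_fin mulr_ge0// ltW.
  rewrite -EFinM lee_fin exprMn /eta.
  have -> : (48 * 8 ^+ d)^-1 * (`|a| + `|b|) * (8 ^+ d * sg ^+ d) =
      (`|a| + `|b|) * (sg ^+ d / 48) by field; rewrite gt_eqF.
  have sd : 0 <= sg ^+ d / 48 by rewrite divr_ge0// exprn_ge0// ltW.
  have := ler_wpM2r sd abk; lra.
have z0in : gcell s w z0 by apply: z0w; apply: cube_center; exact: ltW.
have [_ [i zi]] := gw _ z0in.
(* With the dilation factor [t = 2 * r / sg], homogeneity gives [normc K0 = t ^- d * normc k0],
   which is this constant times [r ^- d]. *)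
exists ((sg / 2) ^+ d * normc k0); first by rewrite mulr_gt0// exprn_gt0// divr_gt0.
move=> y0 r r0; pose t := 2 * r / sg.
have t0 : 0 < t by rewrite divr_gt0// mulr_gt0.
have td0 : 0 < t ^- d by rewrite invr_gt0 exprn_gt0.
have tsg : t * sg = 2 * r by rewrite /t divfK// gt_eqF.
pose x0 := y0 + t *: z0; pose K0 : R[i] := Complex (t ^- d * a) (t ^- d * b).
have nK0 : normc K0 = t ^- d * normc k0.
  rewrite (_ : K0 = Complex (t ^- d) 0 * k0); last first.
    by apply/eqP; rewrite eq_complex /=; apply/andP; split; apply/eqP; ring.
  by rewrite Normc.normcM /= expr0n/= addr0 sqrtr_sqr gtr0_norm.
have sep : 24 * r <= `|x0 0 i - y0 0 i| /\ A * r <= `|x0 0 i - y0 0 i|.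
  rewrite /x0 !mxE addrAC subrr add0r normrM (gtr0_norm t0).
  have h1 : t * (A1 * s) <= t * `|z0 0 i| by rewrite ler_pM2l.
  have E : t * (A1 * s) = 8 * (A1 * r).
    have -> : s = 4 * sg by rewrite /sg; lra.
    have -> : t * (A1 * (4 * sg)) = 4 * A1 * (t * sg) by ring.
    by rewrite tsg; ring.
  have h2 : 3 * r <= A1 * r by rewrite ler_pM2r.
  have h3 : A * r <= A1 * r by rewrite ler_pM2r.
  by split; lra.
exists x0, K0, (fun z : Rd * Rd => k1 (z.1 - z.2)),
  (fun z : Rd * Rd => k2 (z.1 - z.2)) => N e.
have NE x y (c : Rd) : x - y = t *: c -> N (x, y) = t ^- d * h c.
  move=> xy; rewrite /N /= xy k1Z// k2Z// -!mulrBr !normrM (gtr0_norm td0).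
  by rewrite -mulrDr.
have eE : e = normc k0 * sg ^+ d / 24.
  have T0 : t ^+ d != 0 by rewrite expf_neq0// gt_eqF.
  rewrite /e nK0 -tsg (exprMn d t sg); move: T0; move: (t ^+ d) (sg ^+ d) => T S T0.
  by field.
have incube x y : cube x0 r x -> cube y0 r y -> cube z0 sg (t^-1 *: (x - y)).
  move=> xQ yQ j; rewrite !mxE.
  have -> : t^-1 * (x 0 j - y 0 j) - z0 0 j =
      t^-1 * ((x 0 j - x0 0 j) - (y 0 j - y0 0 j)).
    by rewrite /x0 !mxE; field; rewrite gt_eqF.
  rewrite normrM gtr0_norm ?invr_gt0// mulrC ler_pdivrMr// mulrC tsg.
  by apply: le_trans (ler_normB _ _) _; have := xQ j; have := yQ j; lra.
split.
- split; exact: (measurableT_comp _ measurable_subrV).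
(* The directions where [Omega] and [g] differ span a null cone, and [x - y] avoids it for almost
   every pair. *)
- have [ZN [mN N0 sN]] := Omega_g.
  have mZ : measurable (radial_proj @^-1` ZN `&` [set x : Rd | 0 < enorm x]).
    apply: measurableI; last exact: measurable_enorm_gt0.
    by rewrite -[X in measurable X]setTI; exact: measurable_radial_proj.
  apply: filterS (null_diff mZ (null_cone d0 mN N0)) => -[x y] /= nZ xQ yQ.
  have xyi : 0 < `|(x - y) 0 i|.
    rewrite !mxE; have := xQ i; have := yQ i; have := sep.1.
    have : `|x0 0 i - y0 0 i| <= `|x 0 i - y 0 i| + `|x 0 i - x0 0 i| + `|y 0 i - y0 0 i|.
      have -> : x0 0 i - y0 0 i = (x 0 i - y 0 i) - (x 0 i - x0 0 i) + (y 0 i - y0 0 i).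
        by ring.
      by apply: le_trans (ler_normD _ _) _; rewrite lerD2r ler_normB.
    lra.
  have xy0 := enorm_gt0 xyi.
  have xy : x <> y by move=> E; move: xyi; rewrite E subrr mxE normr0 ltxx.
  rewrite KE//.
  have -> : Omega (x - y) = g (radial_proj (x - y)).
    rewrite -(Omega_hom (x - y) (t := (enorm (x - y))^-1)) ?invr_gt0//.
    apply: contrapT => ne; apply: nZ; split => //; apply: sN => /=.
    by move=> /(_ (radial_proj_sphere xy0)).
  rewrite /k1 /k2; case: (g _) => u v; apply/eqP; rewrite eq_complex /=.
  by apply/andP; split; apply/eqP; ring.
- by exists i; case: sep.
- rewrite nK0 le_eqVlt; apply/orP; left; apply/eqP.
  have E : t^-1 = sg / 2 * r^-1.
    by rewrite /t; field; rewrite !gt_eqF.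
  by rewrite -[t ^- d]exprVn E (exprMn d (sg / 2)) exprVn mulrAC.
split=> [x xQ|y yQ]; rewrite eE; apply: le_trans hint.
- apply: le_trans (integral_affine_cube (a := t^-1 *: x) (c := - t^-1) t0 mh h0 _ _).
  + rewrite le_eqVlt; apply/orP; left; apply/eqP; apply: eq_integral => y _.
    by congr EFin; apply: NE; rewrite scaleNr -scalerBr scalerA mulfV ?scale1r// gt_eqF.
  + by rewrite normrN gtr0_norm// invr_gt0.
  + by move=> y yQ; rewrite scaleNr -scalerBr; exact: incube.
- apply: le_trans (integral_affine_cube (a := - (t^-1 *: y)) (c := t^-1) t0 mh h0 _ _).
  + rewrite le_eqVlt; apply/orP; left; apply/eqP; apply: eq_integral => x _.
    congr EFin; apply: NE; rewrite [_ + t^-1 *: x]addrC -scalerBr scalerA.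
    by rewrite mulfV ?scale1r// gt_eqF.
  + by rewrite gtr0_norm// invr_gt0.
  + by move=> x xQ; rewrite [_ + t^-1 *: x]addrC -scalerBr; exact: incube.
Qed.

End rough_kernel.

(** * The oscillation estimate and its consequences *)

Section assembly.
Context {R : realType} {d : nat}.
Local Notation Rd := 'rV[R]_d.
Local Notation mu := (@lebesgue_rV R d).
Hypothesis d0 : (0 < d)%N.
Implicit Types (x y z : Rd).

Lemma nondegenerate_approx_kernel (K : Rd -> Rd -> R[i]) (A : R) :
  nondegenerate_CZ_kernel K -> exists2 c, 0 < c & approx_kernel K A c.
Proof.
case=> [[omega]|[Om]].
  by case=> om0 omle omcvg CZ [c0 c00 nd]; exact: smooth_approx_kernel omcvg CZ c00 nd.
case=> Ohom [g [mg1 mg2 Og]] Oint Oneq KE.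
exact: rough_approx_kernel_aux Ohom mg1 mg2 Og Oint Oneq KE A.
Qed.

(** Going through the midpoint replaces one increment by two of half the length, which multiplies
    the bound by [g], twice 2^(-alpha) and so less than 1; iteration drives the bound to 0. *)
Lemma holder_gt1_const (u : Rd -> R) (C alpha : R) : 1 < alpha ->
  (forall x y t, 0 < t -> (forall i, `|x 0 i - y 0 i| <= t) ->
    `|u x - u y| <= C * t `^ alpha) -> forall x y, u x = u y.
Proof.
move=> alpha1 H x y; pose g : R := 2 * 2 `^ (- alpha).
have g0 : 0 <= g by rewrite mulr_ge0 ?powR_ge0.
have g1 : g < 1.
  have a0 : 0 < alpha by lra.
  have h : 1 `^ (alpha - 1) < 2 `^ (alpha - 1) :> R.
    by apply: gt0_ltr_powR; rewrite ?nnegrE ?subr_gt0 ?ltr1n.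
  rewrite powR1 in h.
  rewrite /g powRN ltr_pdivrMr ?powR_gt0// mul1r -(mulr_powRB1 _ a0)//.
  by rewrite ltr_pMr.
have Hn n : forall x y t, 0 < t -> (forall i, `|x 0 i - y 0 i| <= t) ->
    `|u x - u y| <= g ^+ n * C * t `^ alpha.
  elim: n => [|n IH] v w t t0 vw; first by rewrite expr0 mul1r; exact: H.
  pose m : Rd := 2^-1 *: (v + w).
  have t20 : 0 < t / 2 by rewrite divr_gt0.
  have h1 : `|u v - u m| <= g ^+ n * C * (t / 2) `^ alpha.
    apply: IH => // i; rewrite !mxE.
    have -> : v 0 i - 2^-1 * (v 0 i + w 0 i) = (v 0 i - w 0 i) * 2^-1 by field.
    by rewrite normrM (@ger0_norm _ 2^-1)// ler_pM2r.
  have h2 : `|u m - u w| <= g ^+ n * C * (t / 2) `^ alpha.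
    apply: IH => // i; rewrite !mxE.
    have -> : 2^-1 * (v 0 i + w 0 i) - w 0 i = (v 0 i - w 0 i) * 2^-1 by field.
    by rewrite normrM (@ger0_norm _ 2^-1)// ler_pM2r.
  have E : (t / 2) `^ alpha = 2 `^ (- alpha) * t `^ alpha.
    by rewrite powRM ?(ltW t0)// mulrC -(@powR_inv1 _ 2)// -powRrM mulN1r.
  rewrite -(subrKA (u m)); apply: le_trans (ler_normD _ _) _.
  apply: le_trans (lerD h1 h2) _; rewrite E exprSr /g.
  by rewrite le_eqVlt; apply/orP; left; apply/eqP; ring.
pose t := enorm (x - y) + 1.
have t0 : 0 < t by rewrite ltr_wpDl// enorm_ge0.
have xyt i : `|x 0 i - y 0 i| <= t.
  have := coord_le_enorm (x - y) i; rewrite !mxE => h.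
  by apply: le_trans h _; rewrite lerDl.
apply/eqP; rewrite -subr_eq0 -normr_le0 leNgt; apply/negP => e0.
have cv : g ^+ n * (C * t `^ alpha) @[n --> \oo] --> 0 * (C * t `^ alpha).
  apply: cvgM; last exact: cvg_cst.
  by apply: cvg_expr; rewrite ger0_norm.
rewrite mul0r in cv; move/cvgrPdist_lt : cv => /(_ _ e0)[n _ /(_ n (leqnn n))].
rewrite /= sub0r normrN ltNge => /negP; apply.
by apply: le_trans (ler_norm _); rewrite mulrA; exact: Hn.
Qed.

Lemma measurable_eball x r : measurable (eball x r).
Proof.
rewrite (_ : eball x r = (fun y : Rd => - x + 1 *: y) @^-1` [set z | enorm z < r]).
  rewrite -[X in measurable X]setTI; apply: measurable_rV_affine => //.
  exact: measurable_enorm_lt.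
by apply/seteqP; split => y /=; rewrite /eball /= scale1r addrC.
Qed.

Lemma eball_sub_cube x r : eball x r `<=` cube x r.
Proof.
move=> y yx i; have := coord_le_enorm (y - x) i; rewrite !mxE => h.
exact: le_trans h (ltW yx).
Qed.

Lemma cube_sub_eball x r s : 0 < r -> d%:R * r < s -> cube x r `<=` eball x s.
Proof.
move=> r0 rs y yx; apply: le_lt_trans rs.
by apply: enorm_le (ltW r0) _ => i; rewrite !mxE; exact: yx.
Qed.

Lemma compact_cube x r : compact (cube x r).
Proof.
rewrite (_ : cube x r = [set v : Rd | forall i,
    `[x 0 i - r, x 0 i + r]%classic (v ord0 i)]).
  apply: (@rV_compact _ _ (fun i => `[x 0 i - r, x 0 i + r]%classic)) => i.
  exact: segment_compact.
apply/seteqP; split => y /= H i; have := H i; rewrite in_itv/= ler_distl//.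
Qed.

(** Along the single coordinate [i], the 2 in [k + 2] pays for the two radii. *)
Lemma set_dist_eball x0 y0 r (k : R) i : 0 < r ->
  (k + 2) * r <= `|x0 0 i - y0 0 i| ->
  k * r <= set_dist (eball y0 r) (eball x0 r).
Proof.
move=> r0 xy; apply: lb_le_inf.
  exists (enorm (y0 - x0)), y0; last exists x0 => //.
    by rewrite /eball /= subrr -(scale0r (0 : Rd)) enormZ normr0 mul0r.
  by rewrite /eball /= subrr -(scale0r (0 : Rd)) enormZ normr0 mul0r.
move=> _ [z zB [w wB <-]].
have hz := eball_sub_cube zB i; have hw := eball_sub_cube wB i.
have := coord_le_enorm (z - w) i; rewrite !mxE.
have : `|x0 0 i - y0 0 i| <= `|z 0 i - w 0 i| + `|z 0 i - y0 0 i| + `|w 0 i - x0 0 i|.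
  have -> : x0 0 i - y0 0 i = - (z 0 i - w 0 i) + (z 0 i - y0 0 i) - (w 0 i - x0 0 i).
    by ring.
  apply: le_trans (ler_normB _ _) _; rewrite lerD2r.
  by apply: le_trans (ler_normD _ _) _; rewrite normrN.
by rewrite mulrDl in xy; lra.
Qed.

Lemma L1loc_parts (b : Rd -> R[i]) : L1loc b -> exists p q : Rd -> R,
  [/\ locint p, locint q & b = (fun x => Complex (p x) (q x)) %[ae mu]].
Proof.
move=> [[g [mg1 mg2 bg]] bint].
exists (fun x => Re (g x)), (fun x => Im (g x)).
have int x r : (\int[mu]_(y in cube x r) (normc (g y))%:E < +oo)%E.
  have := bint _ (@compact_cube x r); apply: le_lt_trans.
  rewrite le_eqVlt; apply/orP; left; apply/eqP; apply: ae_eq_integral_nonmeas.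
  by apply: filterS bg => y H _; rewrite H.
have part (f : Rd -> R) : measurable_fun setT f ->
    (forall x, `|f x| <= normc (g x)) -> locint f.
  move=> mf fg; split => // x r; apply/integrableP; split.
    by apply/measurable_EFinP; exact: measurable_funTS.
  apply: le_lt_trans (int x r); rewrite integral_mkcond [leRHS]integral_mkcond.
  apply: ge0_ae_le_integral.
  - by move=> v; rewrite patchE; case: ifP.
  - by move=> v; rewrite patchE; case: ifP => // _; rewrite lee_fin normc_ge0.
  - apply: aeW => v; rewrite !patchE; case: ifP => // _; rewrite lee_fin.
    exact: fg.
split.
- by apply: part => // x; exact: Re_le_normc.
- by apply: part => // x; exact: Im_le_normc.
- by apply: filterS bg => x H _; rewrite H//; case: (g x).
Qed.

Section key.
Variables (K : Rd -> Rd -> R[i]) (p q kappa c : R).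
Hypotheses (p1 : 1 < p) (pq : p <= q) (c0 : 0 < c).
Hypothesis Kapprox : approx_kernel K ((kappa + 2) * (d%:R + 1)) c.
Let q' := q / (q - 1).
Let alpha := d%:R * (p^-1 - q^-1).

(** The 16 is that of [osc_absorb]; [(2 * (d + 1)) ^+ d] bounds the volume of a ball of radius
    [(d + 1) * r] in units of [r ^+ d]. In [4 ^+ d], one [2 ^+ d] comes from the volume on the left
    of the absorbed estimate, the other from the factor [(2 * r) ^+ d] kept in the conclusion. *)
Definition osc_const : R :=
  16 * ((2 * (d%:R + 1)) ^+ d * ((2 * (d%:R + 1)) ^+ d) `^ (p^-1 - q^-1)) / (c * 4 ^+ d).

Lemma osc_const_ge0 : 0 <= osc_const.
Proof.
have h : 0 <= (2 * (d%:R + 1)) ^+ d :> R by rewrite exprn_ge0// mulr_ge0// addr_ge0.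
apply: divr_ge0; first by rewrite !mulr_ge0// powR_ge0.
by rewrite mulr_ge0 ?exprn_ge0// ltW.
Qed.

Lemma key_osc (b : Rd -> R[i]) (Theta : R) (u v w : Rd -> R) :
  0 <= Theta -> locint u -> locint v ->
  b = (fun x => Complex (u x) (v x)) %[ae mu] ->
  (forall (x0 y0 : Rd) (r : R), 0 < r ->
    kappa * r <= set_dist (eball x0 r) (eball y0 r) ->
    forall f g : Rd -> R[i], Linfty_on (eball x0 r) f -> Linfty_on (eball y0 r) g ->
    normc (commutator_form b K f g) <=
      Theta * (fine (Linfty_norm f) * fine (mu (eball x0 r)) `^ p^-1 *
        (fine (Linfty_norm g) * fine (mu (eball y0 r)) `^ q'^-1))) ->
  w = u \/ w = v -> forall y0 r, 0 < r ->
  \int[mu]_(y in cube y0 r) `|w y - mean (cube y0 r) w| <=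
    osc_const * Theta * r `^ alpha * (2 * r) ^+ d.
Proof.
move=> Th0 lu lv bE H hw y0 r r0.
have [x0 [K0 [G1 [G2 [[mG1 mG2] GE [i sep] K0c [Nx Ny]]]]]] := Kapprox y0 r0.
have dR : 0 <= d%:R :> R by [].
set s := (d%:R + 1) * r; have s0 : 0 < s by rewrite mulr_gt0// ltr_wpDl.
have Qs x : cube x r `<=` eball x s.
  by apply: cube_sub_eball => //; rewrite /s ltr_pM2r// ltrDl.
have dist : kappa * s <= set_dist (eball y0 s) (eball x0 s).
  by apply: (@set_dist_eball _ _ _ _ i) => //; rewrite /s mulrA.
pose E : R := (2 * s) ^+ d.
have E0 : 0 < E by rewrite exprn_gt0// mulr_gt0.
have muE x : 0 <= fine (mu (eball x s)) <= E.
  have mB := measurable_eball x s.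
  have fB : mu (eball x s) \is a fin_num.
    rewrite ge0_fin_numE//; exact: fin_mu_sub (eball_sub_cube (x := x) (r := s)) mB.
  rewrite fine_ge0//= -lee_fin fineK// -(mu_cube x (ltW s0)).
  apply: le_measure; rewrite ?inE//; first exact: measurable_cube.
  exact: eball_sub_cube.
have p0 : 0 < p := lt_trans ltr01 p1.
have q1 : 1 < q := lt_le_trans p1 pq.
have q0 : 0 < q := lt_trans ltr01 q1.
have q'E : q'^-1 = 1 - q^-1.
  by rewrite /q' invf_div; field; rewrite gt_eqF.
pose Th' := Theta * (E `^ p^-1 * E `^ q'^-1).
have k0 : 0 < normc K0.
  by apply: lt_le_trans K0c; rewrite mulr_gt0// invr_gt0 exprn_gt0.
have test := osc_absorb (x0 := x0) (y0 := y0) (Theta := Th') r0 k0 lu lv _ hw.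
have {test} : normc K0 * (2 * r) ^+ d *
    \int[mu]_(y in cube y0 r) `|w y - mean (cube y0 r) w| <= 16 * Th'.
  apply: test => f g w' a1 a2 mf mg f1 g1 hw'.
  have e0 : 0 <= normc K0 * (2 * r) ^+ d / 24.
    by rewrite divr_ge0// mulr_ge0 ?exprn_ge0 ?mulr_ge0 ?ltW.
  apply: (commutator_test lu lv bE mG1 mG2 GE e0 Nx Ny a1 a2 mf mg f1 g1 _ hw').
  have [fB f0 fle1] := test_Linfty mf (Qs y0) f1.
  have [gB g0 gle1] := test_Linfty mg (Qs x0) g1.
  apply: le_trans (H y0 x0 s s0 dist _ _ fB gB) _.
  rewrite /Th' ler_wpM2l//; apply: ler_pM.
  - by rewrite mulr_ge0// powR_ge0.
  - by rewrite mulr_ge0// powR_ge0.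
  - rewrite -[leRHS]mul1r; apply: ler_pM; rewrite ?powR_ge0//.
    have /andP[m0 m1] := muE y0.
    by apply: ge0_ler_powR; rewrite ?nnegrE ?invr_ge0 ?(ltW p0) ?(ltW E0).
  - rewrite -[leRHS]mul1r; apply: ler_pM; rewrite ?powR_ge0//.
    have /andP[m0 m1] := muE x0.
    apply: ge0_ler_powR; rewrite ?nnegrE ?(ltW E0)// q'E subr_ge0.
    by rewrite invf_le1// ltW.
set I := Rintegral _ _ _; have I0 : 0 <= I by exact: Rintegral_ge0.
move=> hI.
(* The exponents add up to [1 + (p^-1 - q^-1)]: on the scale of [r], the 1 gives [r ^+ d] and the
   rest gives [r] to the power [alpha]. *)
have ThE : Th' = Theta * ((2 * (d%:R + 1)) ^+ d *
    ((2 * (d%:R + 1)) ^+ d) `^ (p^-1 - q^-1)) * (r ^+ d * r `^ alpha).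
  rewrite /Th' -powRD; last by apply/implyP => _; rewrite gt_eqF.
  rewrite q'E (_ : p^-1 + (1 - q^-1) = 1 + (p^-1 - q^-1)); last by ring.
  rewrite powRD; last by apply/implyP => _; rewrite gt_eqF.
  rewrite powRr1 ?(ltW E0)//.
  have -> : E = (2 * (d%:R + 1)) ^+ d * r ^+ d by rewrite /E /s mulrA exprMn.
  rewrite powRM ?exprn_ge0 ?mulr_ge0 ?addr_ge0 ?(ltW r0)//.
  have rE : (r ^+ d) `^ (p^-1 - q^-1) = r `^ alpha.
    by rewrite -powR_mulrn ?(ltW r0)// -powRrM.
  by rewrite rE; ring.
have cI : c * 2 ^+ d * I <= normc K0 * (2 * r) ^+ d * I.
  rewrite ler_wpM2r// exprMn (_ : c * 2 ^+ d = c * r ^- d * (2 ^+ d * r ^+ d)).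
    by rewrite ler_wpM2r// mulr_ge0// exprn_ge0// ltW.
  by field; rewrite expf_neq0// gt_eqF.
have c2 : 0 < c * 2 ^+ d by rewrite mulr_gt0// exprn_gt0.
rewrite -(ler_pM2l c2); apply: le_trans cI _; apply: le_trans hI _.
rewrite ThE /osc_const le_eqVlt; apply/orP; left; apply/eqP.
rewrite (exprMn d 2 r) (_ : 4 = 2 * 2); last by lra.
rewrite (exprMn d 2 2); have T0 : 2 ^+ d != 0 :> R by rewrite expf_neq0.
move: (r `^ alpha) (_ `^ (_ - _)) => X Y.
by field; rewrite T0 gt_eqF.
Qed.

End key.

End assembly.

(** * From cubes to balls, and the three conclusions *)

Section conclusions.
Context {R : realType} {d : nat}.
Local Notation Rd := 'rV[R]_d.
Local Notation mu := (@lebesgue_rV R d).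
Implicit Types (x y z : Rd).

Lemma mu_eball_ge x r : 0 < r ->
  (2 * (r / (d%:R + 1))) ^+ d <= fine (mu (eball x r)).
Proof.
move=> r0; have d1 : 0 < d%:R + 1 :> R by rewrite ltr_wpDl.
have s0 : 0 < r / (d%:R + 1) by rewrite divr_gt0.
have mB := measurable_eball x r.
have fB : mu (eball x r) \is a fin_num.
  rewrite ge0_fin_numE//; exact: fin_mu_sub (eball_sub_cube (x := x) (r := r)) mB.
rewrite -lee_fin fineK// -(mu_cube x (ltW s0)).
apply: le_measure; rewrite ?inE//; first exact: measurable_cube.
apply: cube_sub_eball => //; rewrite mulrA ltr_pdivrMr// mulrC ltr_pM2l//.
by rewrite ltrDl.
Qed.

Lemma osc_eball (w : Rd -> R) (M : R) x r : locint w -> 0 < r ->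
  \int[mu]_(y in cube x r) `|w y - mean (cube x r) w| <= M * (2 * r) ^+ d ->
  \int[mu]_(y in eball x r) `|w y - mean (eball x r) w| <= 2 * M * (2 * r) ^+ d.
Proof.
move=> lw r0 H; have mB := measurable_eball x r.
have mQ := measurable_cube x r.
have BQ := eball_sub_cube (x := x) (r := r).
have B0 : 0 < fine (mu (eball x r)).
  apply: lt_le_trans (mu_eball_ge x r0).
  by rewrite exprn_gt0// mulr_gt0// divr_gt0// ltr_wpDl.
apply: le_trans (osc_mean_le lw (mean (cube x r) w) mB BQ B0) _.
rewrite -mulrA ler_pM2l//; apply: le_trans H.
exact: (le_dist_subset lw (mean (cube x r) w) mB mQ BQ (@subset_refl _ (cube x r))).
Qed.

(** The 4 combines a factor 2 for passing from the mean over a cube to the mean over a ball and a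
    factor 2 for the two parts of [b]; [(d + 1) ^+ d] compares the enclosing cube of half side [r]
    with the cube of half side [r / (d + 1)] inside the ball. *)
Lemma BMO_bound (b : Rd -> R[i]) (u v : Rd -> R) (M : R) :
  locint u -> locint v -> b = (fun x => Complex (u x) (v x)) %[ae mu] ->
  0 <= M ->
  (forall w, w = u \/ w = v -> forall x r, 0 < r ->
    \int[mu]_(y in cube x r) `|w y - mean (cube x r) w| <= M * (2 * r) ^+ d) ->
  (BMO_norm b <= (4 * (d%:R + 1) ^+ d * M)%:E)%E.
Proof.
move=> lu lv bE M0 H; apply: ge_ereal_sup => _ [x [r [r0 ->]]].
set B := eball x r; have mB : measurable B := measurable_eball x r.
have d1 : 0 < d%:R + 1 :> R by rewrite ltr_wpDl.
have BQ := eball_sub_cube (x := x) (r := r).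
have muB := mu_eball_ge x r0; rewrite -/B in muB.
have V0 : 0 < (2 * (r / (d%:R + 1))) ^+ d by rewrite exprn_gt0// mulr_gt0// divr_gt0.
have B0 : 0 < fine (mu B) by apply: lt_le_trans V0 muB.
have avgE : average b B = Complex (mean B u) (mean B v).
  rewrite /average /cintegral.
  rewrite (@ae_eq_Rintegral _ _ _ mu B (fun y => Re (b y)) u); last first.
    by apply: filterS bE => y E _; rewrite E.
  rewrite (@ae_eq_Rintegral _ _ _ mu B (fun y => Im (b y)) v); last first.
    by apply: filterS bE => y E _; rewrite E.
  rewrite /mean; apply/eqP; rewrite eq_complex /=.
  by apply/andP; split; apply/eqP; ring.
pose F y := `|u y - mean B u| + `|v y - mean B v|.
have iu := locint_dist lu (mean B u) mB BQ.
have iv := locint_dist lv (mean B v) mB BQ.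
have iF : mu.-integrable B (EFin \o F) := integrableD mB iu iv.
have le1 : (\int[mu]_(y in B) (normc (b y - average b B))%:E <=
    \int[mu]_(y in B) (F y)%:E)%E.
  rewrite integral_mkcond [leRHS]integral_mkcond.
  apply: ge0_ae_le_integral.
  - by move=> y; rewrite patchE; case: ifP => // _; rewrite lee_fin normc_ge0.
  - by move=> y; rewrite patchE; case: ifP => // _; rewrite lee_fin addr_ge0.
  apply: filterS bE => y E; rewrite !patchE; case: ifP => // _.
  by rewrite lee_fin avgE E//; exact: normc_le.
have FE : (\int[mu]_(y in B) (F y)%:E = (\int[mu]_(y in B) F y)%R%:E)%E.
  by rewrite fineK//; exact: integrable_fin_num.
have le2 : \int[mu]_(y in B) F y <= 4 * M * (2 * r) ^+ d.
  rewrite RintegralD//.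
  have h1 := osc_eball lu r0 (H u (or_introl erefl) x r r0).
  have h2 := osc_eball lv r0 (H v (or_intror erefl) x r r0).
  by apply: le_trans (lerD h1 h2) _; rewrite -/B; lra.
apply: (@le_trans _ _ ((fine (mu B))^-1%:E * (4 * M * (2 * r) ^+ d)%:E)%E).
  apply: lee_wpmul2l; first by rewrite lee_fin invr_ge0 ltW.
  by apply: le_trans le1 _; rewrite FE lee_fin.
rewrite -EFinM lee_fin mulrC ler_pdivrMr//.
have -> : 4 * M * (2 * r) ^+ d =
    4 * (d%:R + 1) ^+ d * M * (2 * (r / (d%:R + 1))) ^+ d.
  have -> : 2 * r = (d%:R + 1) * (2 * (r / (d%:R + 1))) by field; rewrite gt_eqF.
  by rewrite (exprMn d (d%:R + 1)); ring.
by rewrite ler_wpM2l// mulr_ge0// mulr_ge0// exprn_ge0// ltW.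
Qed.

Lemma commutator_form_cst (b : Rd -> R[i]) (K : Rd -> Rd -> R[i]) (c : R[i])
    (f g : Rd -> R[i]) : b = cst c %[ae mu] -> commutator_form b K f g = 0.
Proof.
move=> bc; rewrite /commutator_form /cintegral.
have b1 := @ae_fst _ _ _ _ _ mu mu _ bc.
have b2 := @ae_snd _ _ _ _ _ mu mu _ bc.
have F0 : {ae (mu \x mu)%E, forall z : Rd * Rd,
    (b z.1 - b z.2) * K z.1 z.2 * f z.2 * g z.1 = 0}.
  apply: filterS2 b1 b2 => z h1 h2.
  by rewrite h1// h2// /cst subrr !mul0r.
rewrite (ae_eq_Rintegral (g := fun=> 0)); last by apply: filterS F0 => z ->.
rewrite [X in Complex _ X](ae_eq_Rintegral (g := fun=> 0)); last first.
  by apply: filterS F0 => z ->.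
by rewrite Rintegral_cst// mul0r.
Qed.

End conclusions.

Theorem theorem2p4p1 (R : realType) (d : nat) (d_gt0 : (0 < d)%N)
    (K : 'rV[R]_d -> 'rV[R]_d -> R[i])
    (ndK : nondegenerate_CZ_kernel K)
    (p q kappa : R) (p_gt1 : 1 < p) (le_pq : p <= q) (kappa_gt0 : 0 < kappa) :
  let q' := q / (q - 1) in
  let alpha := d%:R * (p^-1 - q^-1) in
  let mu := lebesgue_rV d in
  [/\ 0 <= alpha,
      alpha = 0 <-> p = q &
      exists C : R, forall (b : 'rV[R]_d -> R[i]) (Theta : R),
        L1loc b -> 0 <= Theta ->
        (forall (x0 y0 : 'rV[R]_d) (r : R), 0 < r ->
          let B := eball x0 r in
          let B' := eball y0 r in
          kappa * r <= set_dist B B' ->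
          forall f g : 'rV[R]_d -> R[i], Linfty_on B f -> Linfty_on B' g ->
            Normc.normc (commutator_form b K f g) <=
              Theta * (fine (Linfty_norm f) * fine (mu B) `^ p^-1 *
                       (fine (Linfty_norm g) * fine (mu B') `^ q'^-1))) ->
        [/\ alpha = 0 -> BMO b /\ (BMO_norm b <= (C * Theta)%:E)%E,
            0 < alpha <= 1 ->
              exists b' : 'rV[R]_d -> R[i],
                [/\ b = b' %[ae mu],
                    (holder_norm alpha b' < +oo)%E &
                    (holder_norm alpha b' <= (C * Theta)%:E)%E] &
            1 < alpha ->
              (exists c : R[i], b = cst c %[ae mu]) /\
              forall f g : 'rV[R]_d -> R[i], commutator_form b K f g = 0]].
Proof.
move=> q' alpha mu.
have p0 : 0 < p := lt_trans ltr01 p_gt1.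
have q0 : 0 < q := lt_le_trans p0 le_pq.
have dR : 0 < d%:R :> R by rewrite ltr0n.
split.
- by rewrite mulr_ge0// subr_ge0 lef_pV2 ?posrE.
- split => [/eqP|pq]; last by rewrite /alpha pq subrr mulr0.
  by rewrite mulf_eq0 gt_eqF//= subr_eq0 => /eqP/invr_inj.
(* Cubes of half side [r] are enclosed in balls of radius [(d + 1) * r]; their centres must be
   [kappa + 2] such radii apart for the balls to be [kappa] radii apart. *)
have [c c0 Kc] := nondegenerate_approx_kernel d_gt0 ((kappa + 2) * (d%:R + 1)) ndK.
pose M := @osc_const R d p q c.
have M0 : 0 <= M by exact: osc_const_ge0.
pose C1 := 4 * (d%:R + 1) ^+ d * M.
have C10 : 0 <= C1 by rewrite mulr_ge0// mulr_ge0// exprn_ge0// addr_ge0.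
(* At [alpha = 0] the denominator is 0 and so is the quotient by convention. The absolute value in
   the final constant avoids discussing the sign of [C2]; the 2 in front of it accounts for the two
   parts of [b]. *)
pose C2 := 2 * (2 * 8 ^+ d / (1 - 2 `^ (- alpha)) + 8 ^+ d * 2 `^ alpha).
exists (C1 + 2 * `|C2| * M) => b Theta bL Th0 H.
have CC2 : 0 <= 2 * `|C2| * M by apply: mulr_ge0 => //; apply: mulr_ge0.
have [u [v [lu lv bE]]] := L1loc_parts bL.
have osc w (hw : w = u \/ w = v) := key_osc p_gt1 le_pq c0 Kc Th0 lu lv bE H hw.
have MT0 : 0 <= M * Theta by rewrite mulr_ge0.
have campanato : 0 < alpha -> exists u' v' : 'rV[R]_d -> R,
    [/\ b = (fun x => Complex (u' x) (v' x)) %[ae mu],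
      (forall (x y : 'rV[R]_d) t, 0 < t -> (forall i, `|x 0 i - y 0 i| <= t) ->
        `|u' x - u' y| <= C2 * (M * Theta) * t `^ alpha) &
      (forall (x y : 'rV[R]_d) t, 0 < t -> (forall i, `|x 0 i - y 0 i| <= t) ->
        `|v' x - v' y| <= C2 * (M * Theta) * t `^ alpha)].
  move=> a0.
  have [u' [uu' hu']] := campanato_ex lu MT0 a0 (osc u (or_introl erefl)).
  have [v' [vv' hv']] := campanato_ex lv MT0 a0 (osc v (or_intror erefl)).
  exists u', v'; split => //.
  by apply: filterS3 bE uu' vv' => x h1 h2 h3 _; rewrite h1// h2// h3.
split.
- move=> a0.
  have bnd : (BMO_norm b <= ((C1 + 2 * `|C2| * M) * Theta)%:E)%E.
    apply: (@le_trans _ _ (C1 * Theta)%:E); last first.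
      by rewrite lee_fin ler_wpM2r// lerDl.
    rewrite /C1 -mulrA; apply: (BMO_bound lu lv bE MT0) => w hw x r r0.
    by have := osc w hw x r r0; rewrite -/alpha a0 powRr0 mulr1.
  by split => //; split => //; apply: le_lt_trans bnd (ltry _).
- move=> /andP[a0 _]; have [u' [v' [bE' hu' hv']]] := campanato a0.
  have bnd : (holder_norm alpha (fun x => Complex (u' x) (v' x)) <=
      ((C1 + 2 * `|C2| * M) * Theta)%:E)%E.
    apply: ge_ereal_sup => _ [x [y [xy ->]]]; rewrite lee_fin.
    have t0 : 0 < enorm (x - y).
      rewrite lt_neqAle enorm_ge0 andbT; apply/eqP => E; apply: xy.
      apply/rowP => i; apply/eqP; rewrite -subr_eq0 -normr_le0 E.
      by have := coord_le_enorm (x - y) i; rewrite !mxE.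
    have xyt i : `|x 0 i - y 0 i| <= enorm (x - y).
      by have := coord_le_enorm (x - y) i; rewrite !mxE.
    rewrite ler_pdivrMr ?powR_gt0//; apply: le_trans (normc_le _) _ => /=.
    apply: le_trans (lerD (hu' x y _ t0 xyt) (hv' x y _ t0 xyt)) _.
    rewrite -mulrDl ler_wpM2r ?powR_ge0//.
    have : C2 * (M * Theta) <= `|C2| * (M * Theta).
      by rewrite ler_wpM2r// ler_norm.
    have : 0 <= C1 * Theta by rewrite mulr_ge0.
    lra.
  exists (fun x => Complex (u' x) (v' x)); split => //.
  exact: le_lt_trans bnd (ltry _).
move=> a1; have a0 : 0 < alpha := lt_trans ltr01 a1.
have [u' [v' [bE' hu' hv']]] := campanato a0.
have bc : b = cst (Complex (u' 0) (v' 0)) %[ae mu].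
  apply: filterS bE' => x h _; rewrite h// /cst.
  by rewrite (holder_gt1_const a1 hu' x 0) (holder_gt1_const a1 hv' x 0).
by split; [exists (Complex (u' 0) (v' 0))|move=> f g; exact: commutator_form_cst bc].
Qed.
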